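(* There exists a uniform constant $c_b>0$ such that $$|a_h(\boldsymbol x_h,\boldsymbol y_h)|\le c_b\,|||\boldsymbol x_h|||_{\boldsymbol X_h}\,|||\boldsymbol y_h|||_{\boldsymbol X_h}\qquad\text{for all }\boldsymbol x_h,\boldsymbol y_h\in\boldsymbol X_h,$$ where $a_h$ is the bilinear form of the HDG discretization of Biot's model and $|||\cdot|||_{\boldsymbol X_h}$ the parameter-dependent norm on $\boldsymbol X_h$ (both defined in the context).
   Context: **Mesh and spaces.** $\Omega\subset\mathbb{R}^d$ ($d=2,3$) is an open bounded polygonal/polyhedral domain. $\mathcal{T}_h=\{K\}$ is a triangulation of $\Omega$ into non-overlapping simplices, from a conforming shape-regular family; $h_K$ is the characteristic length (e.g. the diameter) of $K$, $n$ the outward unit normal on $\partial K$, $h$ the mesh size, $\mathcal{F}_h$ the set of all faces and $\Gamma_0$ the union of all faces. $k\ge 1$ is a fixed integer and $\mathbb{P}_m$ denotes polynomials of degree at most $m$. Define - $V_h=\{v_h\in L^2(\Omega)^d: v_h|_K\in\mathbb{P}_k(K)^d\ \forall K\}$, $\quad Q_h=\{q_h\in L^2(\Omega): q_h|_K\in\mathbb{P}_{k-1}(K)\ \forall K\}$, - $\bar V_h=\{\bar v_h\in L^2(\Gamma_0)^d:\bar v_h|_F\in\mathbb{P}_k(F)^d\ \forall F\in\mathcal{F}_h,\ \bar v_h=0\text{ on }\partial\Omega\}$, - $\bar Q_h=\{\bar q_h\in L^2(\Gamma_0):\bar q_h|_F\in\mathbb{P}_k(F)\ \forall F\in\mathcal{F}_h\}$,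 $\quad\bar Q_h^0=\{\bar q_h\in\bar Q_h:\bar q_h=0\text{ on }\partial\Omega\}$, - $\boldsymbol V_h=V_h\times\bar V_h$, $\boldsymbol Q_h=Q_h\times\bar Q_h$, $\boldsymbol Q_h^0=Q_h\times\bar Q_h^0$, $\boldsymbol X_h=\boldsymbol V_h\times\boldsymbol Q_h\times V_h\times\boldsymbol Q_h^0$. Boldface denotes cell/face pairs, e.g. $\boldsymbol v_h=(v_h,\bar v_h)$. Write $(p,q)_{\mathcal{T}_h}=\sum_K\int_K pq\,dx$ and $\langle p,q\rangle_{\partial\mathcal{T}_h}=\sum_K\int_{\partial K}pq\,ds$ (similarly for vectors and matrices); gradients and divergences are taken cellwise; $\varepsilon(u)=(\nabla u+(\nabla u)^T)/2$. **Parameters.** $\mu>0$, $\lambda\ge c_l^{-1}\mu$ (i.e. $\mu\lambda^{-1}\le c_l$) for a fixed constant $c_l>0$, $0<\alpha\le1$, $\kappa>0$, $c_0\ge0$. A *uniform constant* is one independent of $\mu,\lambda,\alpha,\kappa,c_0$ (in these ranges) and of $h$; no independence from other fixed data ($c_l$, $d$, $k$, $\Omega$, shape-regularity, $\eta$) is part of this definition. **Forms.** With penalty parameter $\eta>1$, $$d_h(\boldsymbol u_h,\boldsymbol v_h)=(\mu\varepsilon(u_h),\varepsilon(v_h))_{\mathcal{T}_h}+\langle\tfrac{\eta\mu}{h_K}(u_h-\bar u_h),v_h-\bar v_h\rangle_{\partial\mathcal{T}_h}-\langle\mu\varepsilon(u_h)n,v_h-\bar v_h\rangle_{\partial\mathcal{T}_h}-\langle\mu\varepsilon(v_h)n,u_h-\bar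 u_h\rangle_{\partial\mathcal{T}_h},$$ $$b_h(v_h,\boldsymbol q_h)=-(q_h,\nabla\cdot v_h)_{\mathcal{T}_h}+\langle\bar q_h,v_h\cdot n\rangle_{\partial\mathcal{T}_h}.$$ For $\boldsymbol x_h=(\boldsymbol u_h,\boldsymbol p_{Th},z_h,\boldsymbol p_h)$ and $\boldsymbol y_h=(\boldsymbol v_h,\boldsymbol q_{Th},w_h,\boldsymbol q_h)$ in $\boldsymbol X_h$, $$a_h(\boldsymbol x_h,\boldsymbol y_h)=d_h(\boldsymbol u_h,\boldsymbol v_h)+b_h(v_h,\boldsymbol p_{Th})+b_h(u_h,\boldsymbol q_{Th})+(\kappa^{-1}z_h,w_h)_{\mathcal{T}_h}+b_h(w_h,\boldsymbol p_h)+b_h(z_h,\boldsymbol q_h)-(c_0p_h,q_h)_{\mathcal{T}_h}-\lambda^{-1}(\alpha p_h-p_{Th},\alpha q_h-q_{Th})_{\mathcal{T}_h}.$$ **Inner products and norms.** $(\boldsymbol u_h,\boldsymbol v_h)_v=\mu(\varepsilon(u_h),\varepsilon(v_h))_{\mathcal{T}_h}+\mu\eta\langle h_K^{-1}(u_h-\bar u_h),v_h-\bar v_h\rangle_{\partial\mathcal{T}_h}$; $(\boldsymbol p_{Th},\boldsymbol q_{Th})_{q_T}=\mu^{-1}(p_{Th},q_{Th})_{\mathcal{T}_h}+\mu^{-1}\eta^{-1}\langle h_K\bar p_{Th},\bar q_{Th}\rangle_{\partial\mathcal{T}_h}$; $(z_h,w_h)_w=\kappa^{-1}(z_h,w_h)_{\mathcal{T}_h}$;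 $(\boldsymbol p_h,\boldsymbol q_h)_q=(c_0+\alpha^2\lambda^{-1})(p_h,q_h)_{\mathcal{T}_h}+\kappa(\nabla p_h,\nabla q_h)_{\mathcal{T}_h}+\kappa\eta\langle h_K^{-1}(p_h-\bar p_h),q_h-\bar q_h\rangle_{\partial\mathcal{T}_h}$. The inner product $(\cdot,\cdot)_{\boldsymbol X_h}$ on $\boldsymbol X_h$ is the sum of these four applied to the corresponding components, and $|||\cdot|||_{\boldsymbol X_h}$ is the induced norm. *)

(* Defs.v *)
(* The space dimension is d = n.+1 and points are
   row vectors 'rV[R]_n.+1.  The norm, open sets etc. that the library puts on
   'rV are those of the sup norm; Euclidean lengths are written with [enorm]. *)
From HB Require Import structures.
From mathcomp Require Import all_boot all_order all_algebra.
From mathcomp Require Import all_classical all_reals all_analysis.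
From mathcomp Require mpoly.
(* the notations of mpoly clash with those of mathcomp-analysis *)
Import -(notations) mpoly.

Set Implicit Arguments.
Unset Strict Implicit.
Unset Printing Implicit Defensive.

Import Order.TTheory GRing.Theory Num.Theory.
Import numFieldNormedType.Exports.
Local Open Scope classical_set_scope.
Local Open Scope ring_scope.

Section Integration.
Context {R : realType}.

(* Lebesgue integral over R^m, as an iterated one-dimensional Lebesgue integral.
   It is only applied to bounded Borel functions with bounded support, for which
   Fubini's theorem identifies it with the integral for the m-dimensional
   Lebesgue measure. *)
Fixpoint lebint (m : nat) : ('rV[R]_m -> R) -> R :=
  match m with
  | 0%N => fun f => f 0
  | m'.+1 => fun f => \int[@lebesgue_measure R]_t
      lebint (fun x : 'rV[R]_m' => f (row_mx (t%:M : 'rV[R]_1) x))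
  end.

Definition ref_simplex (m : nat) : set 'rV[R]_m :=
  [set s | (forall j, 0 <= s 0 j) /\ \sum_j s 0 j <= 1].

End Integration.

Section Geometry.
Context {R : realType} {n : nat}.
Local Notation pt := 'rV[R]_n.+1.

Definition dot (u v : pt) : R := \sum_i u 0 i * v 0 i.
Definition enorm (u : pt) : R := Num.sqrt (dot u u).

(* convex hull of the points v i with P i *)
Definition hull (m : nat) (v : 'I_m -> pt) (P : pred 'I_m) : set pt :=
  [set x | exists t : 'I_m -> R,
    [/\ forall i, 0 <= t i, forall i, ~~ P i -> t i = 0,
        \sum_i t i = 1 & x = \sum_i t i *: v i]].

Definition simplex (v : 'I_n.+2 -> pt) : set pt := hull v predT.

(* the face opposite to the i-th vertex *)
Definition facet (v : 'I_n.+2 -> pt) (i : 'I_n.+2) : set pt := hull v (predC1 i).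

(* rows w_(j+1) - w_0 *)
Definition edges (m : nat) (w : 'I_m.+1 -> pt) : 'M[R]_(m, n.+1) :=
  \matrix_(j < m) (w (lift ord0 j) - w ord0).

Definition nondegenerate (v : 'I_n.+2 -> pt) : Prop := row_free (edges v).

Definition int_simplex (v : 'I_n.+2 -> pt) (f : pt -> R) : R :=
  lebint (fun x => f x * \1_(simplex v) x).

(* integral over the face opposite to the i-th vertex with respect to the
   surface measure ds, through the affine parametrization
   s |-> w_0 + s J of that face over the reference simplex of R^(d-1), whose
   area element is the square root of the Gram determinant of J *)
Definition int_facet (v : 'I_n.+2 -> pt) (i : 'I_n.+2) (f : pt -> R) : R :=
  let w := fun j : 'I_n.+1 => v (lift i j) in
  let J := edges w in
  Num.sqrt (\det (J *m J^T)) *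
  lebint (fun s : 'rV[R]_n => f (w ord0 + s *m J) * \1_(@ref_simplex R n) s).

Definition outward_unit_normal (v : 'I_n.+2 -> pt) (i : 'I_n.+2) : set pt :=
  [set nu | [/\ enorm nu = 1,
      forall x y, facet v i x -> facet v i y -> dot nu (x - y) = 0 &
      forall x, facet v i x -> dot nu (v i - x) < 0]].

Definition normal (v : 'I_n.+2 -> pt) (i : 'I_n.+2) : pt :=
  xget 0 (outward_unit_normal v i).

Definition diam (A : set pt) : R :=
  sup [set r | exists x y, [/\ A x, A y & r = enorm (x - y)]].

(* supremum of the diameters of the Euclidean balls contained in A *)
Definition ball_diam (A : set pt) : R :=
  sup [set 2 * r | r in [set r | 0 <= r /\
    exists c, forall x, enorm (x - c) <= r -> A x]].

Definition polyhedral_domain (Omega : set pt) : Prop :=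
  [/\ open Omega, bounded_set Omega, connected Omega, Omega !=set0 &
      exists (N : nat) (s : 'I_N -> 'I_n.+2 -> pt),
        (forall j, nondegenerate (s j)) /\
        Omega = interior (\bigcup_j simplex (s j))].

Definition bdry (Omega : set pt) : set pt := closure Omega `\` interior Omega.

End Geometry.

Record mesh (R : realType) (n : nat) := Mesh {
  cell : finType ;
  vert : cell -> 'I_n.+2 -> 'rV[R]_n.+1
}.
Arguments vert {R n} m K i.

Section Meshes.
Context {R : realType} {n : nat}.
Implicit Type T : mesh R n.
Local Notation pt := 'rV[R]_n.+1.

Definition elt T (K : cell T) : set pt := simplex (vert T K).
Definition face T (K : cell T) (i : 'I_n.+2) : set pt := facet (vert T K) i.
Definition mesh_faces T : set (set pt) :=
  [set F | exists (K : cell T) i, F = face K i].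
Definition hsize T (K : cell T) : R := diam (elt K).
Definition nrm T (K : cell T) (i : 'I_n.+2) : pt := normal (vert T K) i.

(* The last clause is conformity: two cells meet in the hull of their common
   vertices (the empty set if there are none). *)
Definition conforming_triangulation (Omega : set pt) T : Prop :=
  [/\ forall K : cell T, nondegenerate (vert T K),
      \bigcup_(K : cell T) elt K = closure Omega,
      forall K K' : cell T, K != K' ->
        interior (elt K) `&` interior (elt K') = set0 &
      forall K K' : cell T, elt K `&` elt K' =
        hull (vert T K) [pred i | [exists j, vert T K i == vert T K' j]]].

Definition shape_regular (I : Type) (Th : I -> mesh R n) : Prop :=
  exists sigma : R, forall (i : I) (K : cell (Th i)),
    hsize K <= sigma * ball_diam (elt K).

(* the integrals (.,.)_(T_h) and <.,.>_(dT_h) of a cellwise integrand *)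
Definition cell_int T (f : cell T -> pt -> R) : R :=
  \sum_(K : cell T) int_simplex (vert T K) (f K).
Definition bnd_int T (f : cell T -> 'I_n.+2 -> pt -> R) : R :=
  \sum_(K : cell T) \sum_(i < n.+2) int_facet (vert T K) i (f K i).

End Meshes.

Section Spaces.
Context {R : realType} {n : nat}.
Implicit Type T : mesh R n.
Local Notation pt := 'rV[R]_n.+1.
Local Notation mpol := (mpoly n.+1 R).

Definition ev (p : mpol) (x : pt) : R := meval (fun i => x 0 i) p.

(* total degree at most m; [mmeasure mdeg] is 1 + degree, and 0 for p = 0 *)
Definition deg_le (m : nat) (p : mpol) : Prop := (mmeasure mdeg p <= m.+1)%N.

(* A piecewise polynomial field is the family of its cellwise polynomials.
   A function on the skeleton is given facewise: [F : set pt] is a face as a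
   set of points, so that the value on a face shared by two cells is unique. *)
Definition cscal T := cell T -> mpol.
Definition cvec T := cell T -> 'I_n.+1 -> mpol.
Definition fscal := set pt -> pt -> R.
Definition fvec := set pt -> pt -> pt.

Definition Vh k T (v : cvec T) : Prop := forall K i, deg_le k (v K i).
Definition Qh k T (q : cscal T) : Prop := forall K, deg_le k.-1 (q K).

Definition face_poly k (F : set pt) (g : pt -> R) : Prop :=
  exists2 p : mpol, deg_le k p & forall x, F x -> g x = ev p x.

Definition Vbh (Omega : set pt) k T (vb : fvec) : Prop :=
  forall F, mesh_faces T F ->
    (forall i, face_poly k F (fun x => vb F x 0 i)) /\
    (F `<=` bdry Omega -> forall x, F x -> vb F x = 0).

Definition Qbh k T (qb : fscal) : Prop :=
  forall F, mesh_faces T F -> face_poly k F (qb F).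

Definition Qbh0 (Omega : set pt) k T (qb : fscal) : Prop :=
  Qbh k T qb /\
  forall F, mesh_faces T F -> F `<=` bdry Omega -> forall x, F x -> qb F x = 0.

Definition bvec T : Type := cvec T * fvec.
Definition bscal T : Type := cscal T * fscal.

Record hdg T := Hdg { xu : bvec T ; xpT : bscal T ; xz : cvec T ; xp : bscal T }.

Definition Xh (Omega : set pt) k T (x : hdg T) : Prop :=
  [/\ Vh k (xu x).1 /\ Vbh Omega k T (xu x).2,
      Qh k (xpT x).1 /\ Qbh k T (xpT x).2,
      Vh k (xz x) &
      Qh k (xp x).1 /\ Qbh0 Omega k T (xp x).2].

End Spaces.

Section Forms.
Context {R : realType} {n : nat}.
Local Notation pt := 'rV[R]_n.+1.
Variable T : mesh R n.
Implicit Types (K : cell T) (x : pt).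

Definition vval (v : cvec T) K x : pt := \row_i ev (v K i) x.
Definition vgrad (v : cvec T) K x : 'M[R]_n.+1 :=
  \matrix_(i, j) ev (mderiv j (v K i)) x.
Definition eps (v : cvec T) K x : 'M[R]_n.+1 :=
  2^-1 *: (vgrad v K x + (vgrad v K x)^T).
Definition vdiv (v : cvec T) K x : R := \tr (vgrad v K x).
Definition qgrad (q : cscal T) K x : pt := \row_j ev (mderiv j (q K)) x.

Definition frob (A B : 'M[R]_n.+1) : R := \sum_i \sum_j A i j * B i j.
(* A nu, for vectors written as rows *)
Definition mapp (A : 'M[R]_n.+1) (nu : pt) : pt := (A *m nu^T)^T.

Definition vjump (v : bvec T) K (i : 'I_n.+2) x : pt :=
  vval v.1 K x - v.2 (face K i) x.
Definition qjump (q : bscal T) K (i : 'I_n.+2) x : R :=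
  ev (q.1 K) x - q.2 (face K i) x.

Definition d_h (eta mu : R) (u v : bvec T) : R :=
  cell_int (fun K x => mu * frob (eps u.1 K x) (eps v.1 K x))
  + bnd_int (fun K i x =>
      eta * mu / hsize K * dot (vjump u K i x) (vjump v K i x))
  - bnd_int (fun K i x =>
      mu * dot (mapp (eps u.1 K x) (nrm K i)) (vjump v K i x))
  - bnd_int (fun K i x =>
      mu * dot (mapp (eps v.1 K x) (nrm K i)) (vjump u K i x)).

Definition b_h (v : cvec T) (q : bscal T) : R :=
  - cell_int (fun K x => ev (q.1 K) x * vdiv v K x)
  + bnd_int (fun K i x => q.2 (face K i) x * dot (vval v K x) (nrm K i)).

Definition a_h (eta mu lambda alpha kappa c0 : R) (x y : hdg T) : R :=
  d_h eta mu (xu x) (xu y)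
  + b_h (xu y).1 (xpT x) + b_h (xu x).1 (xpT y)
  + cell_int (fun K s => kappa^-1 * dot (vval (xz x) K s) (vval (xz y) K s))
  + b_h (xz y) (xp x) + b_h (xz x) (xp y)
  - cell_int (fun K s => c0 * ev ((xp x).1 K) s * ev ((xp y).1 K) s)
  - lambda^-1 * cell_int (fun K s =>
      (alpha * ev ((xp x).1 K) s - ev ((xpT x).1 K) s) *
      (alpha * ev ((xp y).1 K) s - ev ((xpT y).1 K) s)).

Definition ip_v (eta mu : R) (u v : bvec T) : R :=
  mu * cell_int (fun K x => frob (eps u.1 K x) (eps v.1 K x))
  + mu * eta * bnd_int (fun K i x =>
      (hsize K)^-1 * dot (vjump u K i x) (vjump v K i x)).

Definition ip_qT (eta mu : R) (p q : bscal T) : R :=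
  mu^-1 * cell_int (fun K x => ev (p.1 K) x * ev (q.1 K) x)
  + mu^-1 * eta^-1 * bnd_int (fun K i x =>
      hsize K * p.2 (face K i) x * q.2 (face K i) x).

Definition ip_w (kappa : R) (z w : cvec T) : R :=
  kappa^-1 * cell_int (fun K x => dot (vval z K x) (vval w K x)).

Definition ip_q (eta lambda alpha kappa c0 : R) (p q : bscal T) : R :=
  (c0 + alpha ^+ 2 * lambda^-1) *
    cell_int (fun K x => ev (p.1 K) x * ev (q.1 K) x)
  + kappa * cell_int (fun K x => dot (qgrad p.1 K x) (qgrad q.1 K x))
  + kappa * eta * bnd_int (fun K i x =>
      (hsize K)^-1 * qjump p K i x * qjump q K i x).

Definition ip_X (eta mu lambda alpha kappa c0 : R) (x y : hdg T) : R :=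
  ip_v eta mu (xu x) (xu y) + ip_qT eta mu (xpT x) (xpT y)
  + ip_w kappa (xz x) (xz y) + ip_q eta lambda alpha kappa c0 (xp x) (xp y).

Definition norm_X (eta mu lambda alpha kappa c0 : R) (x : hdg T) : R :=
  Num.sqrt (ip_X eta mu lambda alpha kappa c0 x x).

End Forms.

(* Main.v *)
Require Import Defs.
From HB Require Import structures.
From mathcomp Require Import all_boot all_order all_algebra.
From mathcomp Require Import all_classical all_reals all_analysis.
From mathcomp Require Import perm measurable_realfun ring lra.
From mathcomp Require mpoly.
Import -(notations) mpoly.
Import Order.TTheory GRing.Theory Num.Theory.
Import numFieldNormedType.Exports.
Local Open Scope classical_set_scope.
Local Open Scope ring_scope.
Set Implicit Arguments.
Unset Strict Implicit.
Unset Printing Implicit Defensive.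

(** Every term of [a_h] is a sum over cells, or over faces of cells, of
    integrals of products. The Cauchy-Schwarz inequality therefore bounds it by
    the square root of a product of two quadratic expressions, one in [x] and
    one in [y], and the theorem follows once each of these expressions is at
    most a uniform multiple of the squared norm. The weights of the norm make
    this immediate for most terms: each coefficient is the geometric mean of
    two weights, as in 1 = (mu^-1 mu)^(1/2), and the term with [lambda^-1] is
    controlled because [lambda^-1 <= cl * mu^-1]. Three terms need an idea.

    - The traction <mu eps(u) n, v - vb> contains the trace of eps(u) on the
      faces, while the norm controls eps(u) in the cells. The discrete trace
      inequality [trace_inequality] bounds h_K times the square integral of a
      polynomial over the boundary of K by its square integral over K. In
      barycentric coordinates both sides are quadratic forms on a
      finite-dimensional space which do not depend on K, so that some constant
      exists by [form_dominated]; the ratio of the area of a facet to the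
      volume of the cell is, up to a constant, the length of the gradient of
      a barycentric coordinate, which shape regularity bounds by a multiple
      of 1 / h_K ([shape_regular_bgrad]).

    - The coupling [b_h v q] of the displacement with the total pressure
      contains <qb, v.n>, while the norm controls v - vb. Since qb and vb have
      one value on each face, since the normals of two cells at a common face
      are opposite, and since vb vanishes on the boundary of the domain,
      <qb, vb.n> = 0 ([single_valued_flux]); hence v may be replaced by v - vb.

    - The coupling [b_h w p] of the flux with the pore pressure contains div w,
      while the norm controls w only. Integration by parts in each cell
      ([divergence_theorem]) turns it into (grad p, w) - <p - pb, w.n>, whose
      last part is again bounded by the trace inequality.

    All integrals are computed on the reference simplex. The bridge is the
    affine change of variables [lebint_affine] for the iterated integral; it
    also shows that integrals over simplices and facets do not depend on the
    numbering of the vertices, which reduces the divergence theorem to the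
    fundamental theorem of calculus along one edge. *)

Local Notation nondegenerate := Defs.nondegenerate.
Local Notation normal := Defs.normal.
Local Notation face := Defs.face.

(** * One-dimensional integrals *)
Section OneDim.
Context {R : realType}.
Local Notation mu := (@lebesgue_measure R).

Lemma measurable_affine (a b : R) :
  measurable_fun [set: measurableTypeR R] (fun t => a * t + b : measurableTypeR R).
Proof. by apply: measurable_realfun.measurable_funD => //; apply: measurable_funM. Qed.

Definition affine_image (a b : R) : {measure set (measurableTypeR R) -> \bar R} :=
  measure_function_pushforward__canonical__measure_function_Measure mu (measurable_affine a b).

(** Lebesgue measure is determined by the lengths of half-open intervals. *)
Lemma lebesgue_measure_affine (a b : R) (a0 : a != 0) (A : set R) :
  measurable A ->
  mscale (NngNum (normr_ge0 a)) (affine_image a b) A = mu A.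
Proof.
move=> mA; apply/esym/lebesgue_measure_unique => //= _ [[x y] _ <-] /=.
rewrite /mscale /= /pushforward /=.
move: a0; rewrite neq_lt => /orP[a0|a0].
  have -> : (fun t => a * t + b) @^-1` `]x, y] = `[(y - b) / a, (x - b) / a[%classic.
    apply/seteqP; split => t /=; rewrite !in_itv /= ler_ndivrMr // ltr_ndivlMr //.
      move=> /andP[h1 h2]; apply/andP; split; lra.
    move=> /andP[h1 h2]; apply/andP; split; lra.
  rewrite !lebesgue_measure_itv /= !lte_fin ltr_nM2r ?invr_lt0 // ltrD2r.
  case: ifP => _; last by rewrite mule0.
  rewrite ltr0_norm // -!EFinD -EFinM; congr EFin.
  by field; rewrite lt_eqF.
have -> : (fun t => a * t + b) @^-1` `]x, y] = `](x - b) / a, (y - b) / a]%classic.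
  apply/seteqP; split => t /=; rewrite !in_itv /= ler_pdivlMr // ltr_pdivrMr //.
    move=> /andP[h1 h2]; apply/andP; split; lra.
  move=> /andP[h1 h2]; apply/andP; split; lra.
rewrite !lebesgue_measure_itv /= !lte_fin ltr_pM2r ?invr_gt0 // ltrD2r.
case: ifP => _; last by rewrite mule0.
rewrite gtr0_norm // -!EFinD -EFinM; congr EFin.
by field; rewrite gt_eqF.
Qed.

Definition sym_itv (B : R) : set (measurableTypeR R) := [set` `[- B, B] : interval R].

Lemma measurable_sym_itv B : measurable (sym_itv B).
Proof. exact: measurable_itv. Qed.

Lemma lebesgue_measure_sym_itv B : 0 <= B -> mu (sym_itv B) = (2 * B)%:E.
Proof.
move=> B0; rewrite lebesgue_measure_itv /= lte_fin.
case: ifP => h; first by rewrite -EFinD; congr EFin; ring.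
congr EFin; move/negbT: h; rewrite -leNgt => h; lra.
Qed.

Lemma lebesgue_measure_sym_itv_fin B : (mu (sym_itv B) < +oo)%E.
Proof.
by rewrite lebesgue_measure_itv /=; case: ifP; rewrite ?ltry // -EFinD ltry.
Qed.

Lemma patch_bounded_support (f : R -> R) (B : R) :
  (forall t, f t != 0 -> `|t| <= B) -> f = f \_ (sym_itv B).
Proof.
move=> fB; apply/funext => t; rewrite /patch; case: ifPn => //.
rewrite notin_setE /sym_itv /= in_itv /= -ler_norml => tB.
by apply/eqP; apply: contra_notT tB => /fB.
Qed.

Lemma integrable_bounded1 (f : measurableTypeR R -> R) (M B : R) :
  measurable_fun [set: measurableTypeR R] f -> (forall t, `|f t| <= M) ->
  (forall t, f t != 0 -> `|t| <= B) -> mu.-integrable setT (EFin \o f).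
Proof.
move=> mf fM fB.
have -> : EFin \o f = (EFin \o f) \_ (sym_itv B).
  by rewrite {1}(patch_bounded_support fB) restrict_EFin.
apply: (proj1 (integrable_mkcond _ (measurable_sym_itv B))).
apply: (@measurable_bounded_integrable _ _ _ mu f) => //.
- exact: measurable_sym_itv.
- exact: lebesgue_measure_sym_itv_fin.
- exact: measurable_funTS.
- exists M; split; first by rewrite num_real.
  by move=> x Mx t _ /=; rewrite (le_trans (fM _)) // ltW.
Qed.

Lemma ge0_integral_affine (f : measurableTypeR R -> \bar R) (a b : R) : a != 0 ->
  measurable_fun [set: measurableTypeR R] f -> (forall t, (0 <= f t)%E) ->
  (`|a|%:E * \int[mu]_t f (a * t + b)%R = \int[mu]_t f t)%E.
Proof.
move=> a0 mf f0.
rewrite [RHS](eq_measure_integral (mscale (NngNum (normr_ge0 a)) (affine_image a b))); last first.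
  by move=> A mA _; apply/esym/lebesgue_measure_affine.
rewrite ge0_integral_mscale //=; congr (_ * _)%E.
rewrite ge0_integral_pushforward //; exact: measurable_affine.
Qed.

(** The Lebesgue change of variables is first known for nonnegative functions;
    bounded support makes the positive and negative parts integrable. *)
Lemma Rintegral_affine (f : measurableTypeR R -> R) (M B a b : R) : a != 0 ->
  measurable_fun [set: measurableTypeR R] f -> (forall t, `|f t| <= M) ->
  (forall t, f t != 0 -> `|t| <= B) ->
  `|a| * \int[mu]_t f (a * t + b) = \int[mu]_t f t.
Proof.
move=> a0 mf fM fB.
have mef : measurable_fun [set: measurableTypeR R] (EFin \o f) by apply/measurable_EFinP.
have If : mu.-integrable setT (EFin \o f) by apply: integrable_bounded1 mf fM fB.
have Ig : mu.-integrable setT (EFin \o (fun t => f (a * t + b))).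
  apply: (@integrable_bounded1 _ M ((B + `|b|) / `|a|)).
  - exact: (measurableT_comp mf (measurable_affine a b)).
  - by move=> t.
  - move=> t /fB h; rewrite ler_pdivlMr ?normr_gt0 //.
    rewrite -normrM mulrC.
    have -> : a * t = a * t + b - b by ring.
    by rewrite (le_trans (ler_normB _ _)) // lerD.
rewrite /Rintegral [in LHS]integralE [in RHS]integralE.
rewrite -[X in (X * _)%R]/(fine `|a|%:E) -fineM //; last first.
  by have := integrable_fin_num measurableT Ig; rewrite integralE.
congr fine.
rewrite muleBr //; last first.
  by apply: fin_num_adde_defr; apply: integrable_pos_fin_num.
congr (_ - _)%E.
  have := @ge0_integral_affine (EFin \o f)^\+%E a b a0 (measurable_funepos mef).
  by move=> <- //; congr (_ * _)%E; apply: eq_integral => x _; rewrite !funeposE.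
have := @ge0_integral_affine (EFin \o f)^\-%E a b a0 (measurable_funeneg mef).
by move=> <- //; congr (_ * _)%E; apply: eq_integral => x _; rewrite !funenegE.
Qed.

Lemma le_Rintegral_bounded (f : measurableTypeR R -> R) (M B : R) : 0 <= B ->
  measurable_fun [set: measurableTypeR R] f -> (forall t, `|f t| <= M) ->
  (forall t, f t != 0 -> `|t| <= B) -> `|\int[mu]_t f t| <= M * (2 * B).
Proof.
move=> B0 mf fM fB.
have If := integrable_bounded1 mf fM fB.
have If' : mu.-integrable (sym_itv B) (EFin \o f).
  by apply: integrableS If => //; exact: measurable_sym_itv.
rewrite (patch_bounded_support fB) -Rintegral_mkcond.
apply: (le_trans (le_normr_Rintegral (measurable_sym_itv B) If')).
apply: (@le_trans _ _ (\int[mu]_(t in sym_itv B) M)).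
  apply: (le_Rintegral (measurable_sym_itv B)) => //.
  - by apply: integrable_norm If'.
  - apply: measurable_bounded_integrable => //.
    + exact: measurable_sym_itv.
    + exact: lebesgue_measure_sym_itv_fin.
    exists `|M|; split; first by rewrite num_real.
    by move=> x Mx t _ /=; rewrite ltW.
rewrite Rintegral_cst //; last exact: measurable_sym_itv.
by have /(congr1 fine) -> := lebesgue_measure_sym_itv B0.
Qed.

End OneDim.

(** * Measurability of iterated integrals *)
Section Borel.
Context {R : realType}.
Local Notation mu := (@lebesgue_measure R).

(** Borel measurability, stated as stability under measurable substitutions of
    the coordinates: in this form it needs no sigma-algebra on row vectors and
    passes to slices, which suits inductions on the dimension. *)
Definition borel_family d (T : measurableType d) m (f : T -> 'rV[R]_m -> R) : Prop :=
  forall d' (S : measurableType d') (h : S -> T) (g : 'I_m -> S -> R),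
    measurable_fun setT h -> (forall i, measurable_fun setT (g i)) ->
    measurable_fun setT (fun s => f (h s) (\row_i g i s)).

Definition borel m (f : 'rV[R]_m -> R) : Prop :=
  forall d (T : measurableType d) (g : 'I_m -> T -> R),
    (forall i, measurable_fun setT (g i)) ->
    measurable_fun setT (fun t => f (\row_i g i t)).

Lemma row_mx_scalar_row m (t : R) (g : 'I_m -> R) :
  row_mx (t%:M : 'rV_1) (\row_i g i) =
  \row_(i < 1 + m) match fintype.split i with inl _ => t | inr j => g j end.
Proof.
apply/rowP => i; rewrite !mxE; case: fintype.split => j; rewrite !mxE //.
by rewrite !ord1 eqxx.
Qed.

(** The outermost variable of integration joins the parameters, and a
    one-dimensional integral depends measurably on the parameters by Tonelli's
    theorem, applied to the positive and negative parts. *)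
Lemma borel_family_lebint d (T : measurableType d) m (f : T -> 'rV[R]_m -> R) :
  borel_family f -> measurable_fun setT (fun t => lebint (f t)).
Proof.
elim: m d T f => [|m IHm] d T f fb /=.
  have := fb _ T id (fun=> cst 0) (@measurable_id _ _ _) (fun=> measurable_cst _).
  congr (measurable_fun _ _); apply/funext => t; congr (f t _).
  by apply/rowP => -[].
have /IHm mF : borel_family (fun (p : T * measurableTypeR R) (x : 'rV[R]_m) =>
    f p.1 (row_mx (p.2%:M : 'rV_1) x)).
  move=> d' S h g mh mg /=.
  pose k (i : 'I_m.+1) s :=
    match fintype.split (i : 'I_(1 + m)) with inl _ => (h s).2 | inr j => g j s end.
  have -> : (fun s => f (h s).1 (row_mx ((h s).2%:M : 'rV_1) (\row_i g i s))) =
      fun s => f (h s).1 (\row_i k i s).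
    by apply/funext => s; rewrite row_mx_scalar_row.
  apply: (fb _ S (fst \o h)); first exact: measurableT_comp.
  by move=> i; rewrite /k; case: fintype.split => j //; exact: measurableT_comp.
set F := fun p : T * measurableTypeR R => lebint _ in mF.
have mFe : measurable_fun setT (EFin \o F) by apply/measurable_EFinP.
have -> : (fun t => \int[mu]_s lebint (fun x : 'rV_m => f t (row_mx (s%:M : 'rV_1) x))) =
    fun t => fine (fubini_F mu (EFin \o F)^\+%E t - fubini_F mu (EFin \o F)^\-%E t)%E.
  apply/funext => t; rewrite /Rintegral integralE /fubini_F; congr fine.
  by congr (_ - _)%E; apply: eq_integral => x _; rewrite ?funeposE ?funenegE.
apply: measurableT_comp => //; apply: emeasurable_funB.
  by apply: measurable_fun_fubini_tonelli_F => //; exact: measurable_funepos.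
by apply: measurable_fun_fubini_tonelli_F => //; exact: measurable_funeneg.
Qed.

Lemma borel_slice m (f : 'rV[R]_m.+1 -> R) :
  borel f -> borel_family (fun (t : measurableTypeR R) (x : 'rV_m) =>
    f (row_mx (t%:M : 'rV_1) x)).
Proof.
move=> fb d S h g mh mg.
pose k (i : 'I_m.+1) s :=
  match fintype.split (i : 'I_(1 + m)) with inl _ => h s | inr j => g j s end.
have -> : (fun s => f (row_mx ((h s)%:M : 'rV_1) (\row_i g i s))) =
    fun s => f (\row_i k i s).
  by apply/funext => s; rewrite row_mx_scalar_row.
by apply: fb => i; rewrite /k; case: fintype.split.
Qed.

Lemma borel_row_mx m (f : 'rV[R]_m.+1 -> R) (t : R) :
  borel f -> borel (fun x : 'rV_m => f (row_mx (t%:M : 'rV_1) x)).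
Proof.
move=> fb d S g mg.
exact: (borel_slice fb (measurable_cst (t : measurableTypeR R)) mg).
Qed.

Lemma borel_measurable_lebint m (f : 'rV[R]_m.+1 -> R) : borel f ->
  measurable_fun [set: measurableTypeR R]
    (fun t => lebint (fun x : 'rV_m => f (row_mx (t%:M : 'rV_1) x))).
Proof. by move=> fb; exact: (borel_family_lebint (borel_slice fb)). Qed.

Lemma Rintegral_swap (G : measurableTypeR R * measurableTypeR R -> R) (M B : R) :
  measurable_fun setT G -> (forall p, `|G p| <= M) ->
  (forall p, G p != 0 -> `|p.1| <= B /\ `|p.2| <= B) ->
  \int[mu]_t \int[mu]_s G (t, s) = \int[mu]_s \int[mu]_t G (t, s).
Proof.
move=> mG GM GB.
have IG : (mu \x mu)%E.-integrable setT (EFin \o G).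
  pose D := (sym_itv B `*` sym_itv B).
  have mD : measurable D by apply: measurableX; exact: measurable_sym_itv.
  have -> : EFin \o G = (EFin \o G) \_ D.
    apply/funext => p; rewrite /patch; case: ifPn => //; rewrite notin_setE => pD.
    congr EFin; apply/eqP; apply: contra_notT pD => /GB[p1 p2].
    by split; rewrite /sym_itv /= in_itv /= -ler_norml.
  apply: (proj1 (integrable_mkcond _ mD)).
  apply: (@measurable_bounded_integrable _ _ _ (mu \x mu)%E G) => //.
  - rewrite /D; have /= -> := @product_measure1E _ _ _ _ _ mu mu _ _ (measurable_sym_itv B)
      (measurable_sym_itv B).
    apply: lte_mul_pinfty => //; last exact: lebesgue_measure_sym_itv_fin.
    by rewrite ge0_fin_numE //; exact: lebesgue_measure_sym_itv_fin.
  - exact: measurable_funTS.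
  - exists M; split; first by rewrite num_real.
    by move=> x Mx t _ /=; rewrite (le_trans (GM _)) // ltW.
have M1 t : measurable_fun [set: measurableTypeR R] (fun s : measurableTypeR R => G (t, s)).
  exact: (measurableT_comp mG (pair1_measurable _)).
have M2 s : measurable_fun [set: measurableTypeR R] (fun t : measurableTypeR R => G (t, s)).
  exact: (measurableT_comp mG (pair2_measurable _)).
have I1 t : mu.-integrable setT (EFin \o (fun s => G (t, s))).
  by apply: (@integrable_bounded1 _ _ M B) => // s /GB[].
have I2 s : mu.-integrable setT (EFin \o (fun t => G (t, s))).
  by apply: (@integrable_bounded1 _ _ M B) => // t /GB[].
rewrite {1 3}/Rintegral; congr fine.
transitivity (\int[mu]_t \int[mu]_s (G (t, s))%:E)%E.
  apply: eq_integral => t _; rewrite /Rintegral fineK //.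
  exact: (integrable_fin_num measurableT (I1 t)).
transitivity (\int[mu]_s \int[mu]_t (G (t, s))%:E)%E.
  exact: (Fubini IG).
apply: eq_integral => s _; rewrite /Rintegral fineK //.
exact: (integrable_fin_num measurableT (I2 s)).
Qed.

End Borel.

(** * The iterated integral *)
Section Tame.
Context {R : realType}.
Local Notation mu := (@lebesgue_measure R).

Definition bounded_by m (M B : R) (f : 'rV[R]_m -> R) : Prop :=
  (forall x, `|f x| <= M) /\ (forall x, f x != 0 -> forall i, `|x 0 i| <= B).

(** For these functions all the partial integrals exist, and slices, partial
    integrals and invertible affine substitutions give such functions again. *)
Definition tame m (f : 'rV[R]_m -> R) : Prop :=
  borel f /\ exists M B, bounded_by M B f.

Definition slice m (f : 'rV[R]_m.+1 -> R) (t : R) : 'rV[R]_m -> R :=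
  fun x => f (row_mx (t%:M : 'rV_1) x).

Lemma lebintS m (f : 'rV[R]_m.+1 -> R) : lebint f = \int[mu]_t lebint (slice f t).
Proof. by []. Qed.

Lemma eq_lebint m (f g : 'rV[R]_m -> R) : f =1 g -> lebint f = lebint g.
Proof. by move=> /funext ->. Qed.

Lemma lebint0 m : lebint (fun _ : 'rV[R]_m => 0) = 0.
Proof.
elim: m => [//|m IHm] /=; rewrite IHm.
by rewrite /Rintegral integral0.
Qed.

Lemma row_mx_head m (t : R) (x : 'rV[R]_m) : (row_mx (t%:M : 'rV_1) x : 'rV_m.+1) 0 ord0 = t.
Proof.
by rewrite mxE; case: fintype.splitP => k //= _; rewrite mxE !ord1 eqxx.
Qed.

Lemma row_mx_tail m (t : R) (x : 'rV[R]_m) j :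
  (row_mx (t%:M : 'rV_1) x : 'rV_m.+1) 0 (lift ord0 j) = x 0 j.
Proof.
rewrite mxE; case: fintype.splitP => k /=; first by rewrite ord1.
by rewrite /bump leq0n => -[/val_inj <-].
Qed.

Lemma bounded_by_slice m M B (f : 'rV[R]_m.+1 -> R) t :
  bounded_by M B f -> bounded_by M B (slice f t).
Proof.
move=> [fM fB]; split=> [x|x fx j]; first exact: fM.
by have := fB _ fx (lift ord0 j); rewrite row_mx_tail.
Qed.

Lemma tame_slice m (f : 'rV[R]_m.+1 -> R) t : tame f -> tame (slice f t).
Proof.
move=> [fb [M [B fMB]]]; split; first exact: borel_row_mx.
by exists M, B; exact: bounded_by_slice.
Qed.

Lemma bounded_by_ge0 m M B (f : 'rV[R]_m -> R) : bounded_by M B f ->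
  0 <= M /\ bounded_by M `|B| f.
Proof.
move=> [fM fB]; split; first exact: (le_trans (normr_ge0 _) (fM 0)).
by split=> // x /fB H i; exact: (le_trans (H i) (ler_norm _)).
Qed.

Lemma lebint_slice_support m M B (f : 'rV[R]_m.+1 -> R) t : bounded_by M B f ->
  lebint (slice f t) != 0 -> `|t| <= B.
Proof.
move=> [_ fB]; apply: contra_neqT => tB.
rewrite -(lebint0 m); apply: eq_lebint => x; apply/eqP.
apply: contraNT tB => /fB /(_ ord0); by rewrite row_mx_head.
Qed.

Lemma lebint_bounded m (M B : R) (f : 'rV[R]_m -> R) : borel f -> 0 <= B ->
  bounded_by M B f -> `|lebint f| <= M * (2 * B) ^+ m.
Proof.
move=> fb B0; elim: m f fb => [|m IHm] f fb fMB.
  by rewrite expr0 mulr1; exact: fMB.1.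
rewrite lebintS exprSr [leRHS]mulrA.
apply: (@le_Rintegral_bounded _ (fun t => lebint (slice f t)) (M * (2 * B) ^+ m) B) => //.
- exact: borel_measurable_lebint.
- by move=> t; apply: IHm; [exact: borel_row_mx|exact: bounded_by_slice].
- by move=> t; exact: (lebint_slice_support fMB).
Qed.

Lemma integrable_lebint_slice m (f : 'rV[R]_m.+1 -> R) : tame f ->
  mu.-integrable setT (EFin \o (fun t => lebint (slice f t))).
Proof.
move=> [fb [M [B /bounded_by_ge0[M0 fMB]]]].
apply: (@integrable_bounded1 _ _ (M * (2 * `|B|) ^+ m) `|B|).
- exact: borel_measurable_lebint.
- by move=> t; apply: lebint_bounded => //; [exact: borel_row_mx|exact: bounded_by_slice].
- by move=> t; exact: (lebint_slice_support fMB).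
Qed.

Lemma borel_cst m (c : R) : borel (fun _ : 'rV[R]_m => c).
Proof. by move=> d T g mg. Qed.

Lemma borel_coord m (i : 'I_m) : borel (fun x : 'rV[R]_m => x 0 i).
Proof.
move=> d T g mg; rewrite (_ : (fun t => _) = g i) //.
by apply/funext => t; rewrite mxE.
Qed.

Lemma borelD m (f g : 'rV[R]_m -> R) : borel f -> borel g -> borel (fun x => f x + g x).
Proof. by move=> fb gb d T h mh; apply: measurable_funD; [exact: fb|exact: gb]. Qed.

Lemma borelM m (f g : 'rV[R]_m -> R) : borel f -> borel g -> borel (fun x => f x * g x).
Proof. by move=> fb gb d T h mh; apply: measurable_funM; [exact: fb|exact: gb]. Qed.

Lemma borel_comp m p (f : 'rV[R]_p -> R) (h : 'I_p -> 'rV[R]_m -> R) :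
  borel f -> (forall i, borel (h i)) -> borel (fun x => f (\row_i h i x)).
Proof. by move=> fb hb d T g mg; apply: fb => i; exact: hb. Qed.

Lemma borel_sum (J : Type) (r : seq J) m (f : J -> 'rV[R]_m -> R) :
  (forall j, borel (f j)) -> borel (fun x => \sum_(j <- r) f j x).
Proof. by move=> fb d T h mh; apply: measurable_sum => j; exact: fb. Qed.

Lemma borel_affine m p (f : 'rV[R]_p -> R) (b : 'rV[R]_p) (A : 'M[R]_(m, p)) :
  borel f -> borel (fun x => f (x *m A + b)).
Proof.
move=> fb.
have -> : (fun x : 'rV[R]_m => f (x *m A + b)) =
    fun x => f (\row_i ((\sum_j x 0 j * A j i) + b 0 i)).
  by apply/funext => x; congr f; apply/rowP => i; rewrite !mxE.
apply: borel_comp => // i; apply: borelD; last exact: borel_cst.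
by apply: borel_sum => j; apply: borelM; [exact: borel_coord|exact: borel_cst].
Qed.

Lemma tameZ m (c : R) (f : 'rV[R]_m -> R) : tame f -> tame (fun x => c * f x).
Proof.
move=> [fb [M [B [fM fB]]]]; split; first by apply: borelM => //; exact: borel_cst.
exists (`|c| * M), B; split=> [x|x]; first by rewrite normrM ler_wpM2l.
by rewrite mulf_eq0 negb_or => /andP[_ /fB].
Qed.

Lemma lebintD m (f g : 'rV[R]_m -> R) : tame f -> tame g ->
  lebint (fun x => f x + g x) = lebint f + lebint g.
Proof.
elim: m f g => [//|m IHm] f g tf tg.
rewrite !lebintS -RintegralD //; [|exact: integrable_lebint_slice..].
by apply: eq_Rintegral => t _; rewrite -IHm //; exact: tame_slice.
Qed.

Lemma lebintZ m (c : R) (f : 'rV[R]_m -> R) : tame f ->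
  lebint (fun x => c * f x) = c * lebint f.
Proof.
elim: m f => [//|m IHm] f tf.
rewrite !lebintS -RintegralZl //; last exact: integrable_lebint_slice.
by apply: eq_Rintegral => t _; rewrite -IHm //; exact: tame_slice.
Qed.

Lemma lebint_ge0 m (f : 'rV[R]_m -> R) : (forall x, 0 <= f x) -> 0 <= lebint f.
Proof.
elim: m f => [|m IHm] f f0; first exact: f0.
by rewrite lebintS; apply: Rintegral_ge0 => t _; apply: IHm => x; exact: f0.
Qed.

Lemma le_lebint m (f g : 'rV[R]_m -> R) : tame f -> tame g ->
  (forall x, f x <= g x) -> lebint f <= lebint g.
Proof.
move=> tf tg fg; rewrite -subr_ge0 -[X in _ - X]mul1r -mulNr -lebintZ // -lebintD //.
  by apply: lebint_ge0 => x; rewrite mulN1r subr_ge0.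
exact: tameZ.
Qed.

End Tame.

(** * Order of integration *)
Section ChangeOfVariables.
Context {R : realType}.
Local Notation mu := (@lebesgue_measure R).

Definition head_int m (f : 'rV[R]_m.+1 -> R) (x : 'rV[R]_m) : R :=
  \int[mu]_t slice f t x.

Lemma head_int_lebint1 m (f : 'rV[R]_m.+1 -> R) x :
  head_int f x = lebint (fun y : 'rV[R]_1 => slice f (y 0 0) x).
Proof.
rewrite lebintS; apply: eq_Rintegral => t _ /=.
by rewrite /slice row_mx_head.
Qed.

Lemma tame_head_int m (f : 'rV[R]_m.+1 -> R) : tame f -> tame (head_int f).
Proof.
move=> [fb [M [B /bounded_by_ge0[M0 [fM fB]]]]].
have sB y : borel (fun t : 'rV[R]_1 => slice f (t 0 0) y).
  move=> d T g mg.
  have H := borel_slice fb (mg ord0) (fun i => measurable_cst (y 0 i)).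
  suff -> : (fun t => slice f ((\row_i g i t) 0 0) y) =
      fun t => slice f (g ord0 t) (\row_i y 0 i) by [].
  apply/funext => t; rewrite mxE; congr (slice f _ _).
  by apply/rowP => i; rewrite mxE.
split.
  move=> d T g mg.
  have -> : (fun t => head_int f (\row_i g i t)) =
      fun t => lebint (fun y : 'rV[R]_1 => slice f (y 0 0) (\row_i g i t)).
    by apply/funext => t; rewrite head_int_lebint1.
  apply: borel_family_lebint => d' S h k mh mk.
  have H := borel_slice fb (mk ord0) (fun i => measurableT_comp (mg i) mh).
  suff -> : (fun s => slice f ((\row_i k i s) 0 0) (\row_i g i (h s))) =
      fun s => slice f (k ord0 s) (\row_i (g i \o h) s) by [].
  by apply/funext => t; rewrite mxE.
exists (M * (2 * `|B|)), `|B|; split=> [x|x].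
  rewrite head_int_lebint1 -[2 * _]expr1; apply: lebint_bounded => //.
  split=> [y|y /fB /(_ ord0)]; first exact: fM.
  by rewrite row_mx_head => h i; rewrite !ord1.
apply: contra_neqP => /existsNP[i /negP xi].
rewrite head_int_lebint1 -(lebint0 1); apply: eq_lebint => y; apply/eqP.
by apply: contraNT xi => /fB /(_ (lift ord0 i)); rewrite row_mx_tail.
Qed.

(** [lebint] performs the integration over the first coordinate last; here it
    comes first. The two outermost integrals are exchanged by the theorem in
    the plane, and the induction hypothesis applies to the function of the
    other coordinates with the second one frozen. *)
Lemma lebint_Fubini m (f : 'rV[R]_m.+1 -> R) : tame f -> lebint f = lebint (head_int f).
Proof.
elim: m f => [//|m IHm] f tf.
transitivity (\int[mu]_t \int[mu]_s lebint (slice (slice f t) s)); first by [].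
have [fb [M [B /bounded_by_ge0[M0 fMB]]]] := tf.
have swap2 (t s : R) (x : 'rV[R]_m) : slice (slice f t) s x =
    f (row_mx (t%:M : 'rV_1) (row_mx (s%:M : 'rV_1) x)) by [].
rewrite -[LHS]/(\int[mu]_t \int[mu]_s (fun p : measurableTypeR R * measurableTypeR R =>
   lebint (slice (slice f p.1) p.2)) (t, s)).
rewrite (@Rintegral_swap _ _ (M * (2 * `|B|) ^+ m) `|B|).
- rewrite lebintS; apply: eq_Rintegral => s _ /=.
  pose g : 'rV[R]_m.+1 -> R := fun y => f (row_mx ((y 0 ord0)%:M : 'rV_1)
    (row_mx (s%:M : 'rV_1) (\row_i y 0 (lift ord0 i)))).
  have gE t : slice g t =1 slice (slice f t) s.
    move=> x; rewrite /g /slice row_mx_head; do 3 congr (_ _).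
    by apply/rowP => i; rewrite mxE row_mx_tail.
  have tg : tame g.
    split.
      move=> d T k mk.
      have H := borel_slice fb (mk ord0) (g := fun j t =>
        match fintype.split (j : 'I_(1 + m)) with inl _ => s | inr j => k (lift ord0 j) t end).
      suff -> : (fun t => g (\row_i k i t)) = fun t => slice f (k ord0 t)
        (\row_j match fintype.split (j : 'I_(1 + m)) with inl _ => s | inr j => k (lift ord0 j) t end).
        by apply: H => j; case: fintype.split.
      apply/funext => t; rewrite /g /slice mxE -row_mx_scalar_row.
      by do 3 congr (_ _); apply/rowP => i; rewrite !mxE.
    exists M, `|B|; split=> [x|x]; first exact: fMB.1.
    move=> /fMB.2 H i; case: (unliftP ord0 i) => [j|] ->.
      by have := H (lift ord0 (lift ord0 j)); rewrite !row_mx_tail mxE.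
    by have := H ord0; rewrite row_mx_head.
  transitivity (lebint g).
    by rewrite lebintS; apply: eq_Rintegral => t _; apply: eq_lebint => x; rewrite gE.
  rewrite IHm //; apply: eq_lebint => x; apply: eq_Rintegral => t _.
  by rewrite gE.
- apply: (@borel_family_lebint _ _ (measurableTypeR R * measurableTypeR R)%type m
    (fun p => slice (slice f p.1) p.2)).
  move=> d S h k mh mk.
  pose k2 (i : 'I_m.+1) s :=
    match fintype.split (i : 'I_(1 + m)) with inl _ => (h s).2 | inr j => k j s end.
  have mh1 : measurable_fun setT (fst \o h) by exact: measurableT_comp.
  have mh2 : measurable_fun setT (snd \o h) by exact: measurableT_comp.
  have H := borel_slice fb mh1 (g := k2).
  suff -> : (fun s => slice (slice f (h s).1) (h s).2 (\row_i k i s)) =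
    (fun s => slice f (h s).1 (\row_i k2 i s)).
    by apply: H => i; rewrite /k2; case: fintype.split.
  by apply/funext => t; rewrite /slice row_mx_scalar_row.
- move=> [t s] /=; apply: lebint_bounded => //.
    by do 2 apply: borel_row_mx.
  by do 2 apply: bounded_by_slice.
- move=> [t s] /= H; split.
    move: H; apply: contra_neqT => tB; rewrite -(lebint0 m); apply: eq_lebint => x.
    apply/eqP; apply: contraNT tB => /fMB.2 /(_ ord0).
    by rewrite row_mx_head.
  exact: (lebint_slice_support (bounded_by_slice t fMB) H).
Qed.

End ChangeOfVariables.

(** * Affine change of variables *)
Section Affine.
Context {R : realType}.

Lemma tame_affine m (f : 'rV[R]_m -> R) (A : 'M[R]_m) b : A \in unitmx ->
  tame f -> tame (fun x => f (x *m A + b)).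
Proof.
move=> uA [fb [M [B /bounded_by_ge0[M0 [fM fB]]]]]; split; first exact: borel_affine.
exists M, (\sum_j \sum_i (`|B| + `|b 0 j|) * `|invmx A j i|); split=> // x /fB fx i.
have -> : x = (x *m A + b - b) *m invmx A by rewrite addrK mulmxK.
rewrite mxE (le_trans (ler_norm_sum _ _ _)) //; apply: ler_sum => j _.
rewrite (bigD1 i) //= normrM; apply: ler_wpDr.
  by apply: sumr_ge0 => k _; rewrite mulr_ge0 // addr_ge0.
rewrite ler_wpM2r // mxE [(- b) 0 j]mxE.
by rewrite (le_trans (ler_normB _ _)) // lerD2r.
Qed.

Definition volume_scaling m (A : 'M[R]_m) : Prop := forall (f : 'rV[R]_m -> R) b,
  tame f -> `|\det A| * lebint (fun x => f (x *m A + b)) = lebint f.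

Lemma volume_scalingM m (A A' : 'M[R]_m) : A' \in unitmx ->
  volume_scaling A -> volume_scaling A' -> volume_scaling (A *m A').
Proof.
move=> uA' hA hA' f b tf.
rewrite det_mulmx normrM -(hA' f b tf) -(hA (fun x => f (x *m A' + b)) 0); last first.
  exact: tame_affine.
rewrite mulrA (mulrC `|\det A'|); congr (_ * _).
by apply: eq_lebint => x; rewrite addr0 mulmxA.
Qed.

Lemma split_affine_u m (a : R) (d : 'rV[R]_m) (A : 'M[R]_m) (b : 'rV[R]_(1 + m)) t x :
  row_mx (t%:M : 'rV_1) x *m block_mx (a%:M : 'M[R]_1) d 0 A + b =
  row_mx ((a * t + lsubmx b 0 0)%:M : 'rV_1) (x *m A + (t *: d + rsubmx b)).
Proof.
rewrite mul_row_block mulmx0 addr0 -[b in LHS]hsubmxK add_row_mx; congr row_mx.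
  rewrite -scalar_mxM raddfD /= mulrC; congr (_ + _).
  by apply/rowP => i; rewrite ord1 !mxE eqxx.
by rewrite mul_scalar_mx addrAC addrC.
Qed.

Lemma split_affine_l m (a : R) (c : 'cV[R]_m) (A : 'M[R]_m) (b : 'rV[R]_(1 + m)) t x :
  row_mx (t%:M : 'rV_1) x *m block_mx (a%:M : 'M[R]_1) 0 c A + b =
  row_mx ((a * t + ((x *m c) 0 0 + lsubmx b 0 0))%:M : 'rV_1) (x *m A + rsubmx b).
Proof.
rewrite mul_row_block mulmx0 add0r -[b in LHS]hsubmxK add_row_mx; congr row_mx.
rewrite -scalar_mxM !raddfD /= mulrC addrA; congr (_ + _ + _).
  by apply/rowP => i; rewrite ord1 [LHS]mxE [RHS]mxE !mxE eqxx; apply: eq_bigr.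
by apply/rowP => i; rewrite ord1 !mxE eqxx.
Qed.

Lemma det_ublock1 m (a : R) (d : 'rV[R]_m) (A : 'M[R]_m) :
  \det (block_mx (a%:M : 'M[R]_1) d 0 A : 'M[R]_m.+1) = a * \det A.
Proof. by apply: (etrans (det_ublock (a%:M : 'M[R]_1) d A)); rewrite det_scalar1. Qed.

Lemma det_lblock1 m (a : R) (c : 'cV[R]_m) (A : 'M[R]_m) :
  \det (block_mx (a%:M : 'M[R]_1) 0 c A : 'M[R]_m.+1) = a * \det A.
Proof. by apply: (etrans (det_lblock (a%:M : 'M[R]_1) c A)); rewrite det_scalar1. Qed.

(** The first coordinate of the image depends on the first coordinate alone, so
    that slices are mapped to slices. *)
Lemma volume_scaling_ublock m (a : R) (d : 'rV[R]_m) (A : 'M[R]_m) : a != 0 ->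
  A \in unitmx -> volume_scaling A ->
  @volume_scaling m.+1 (block_mx (a%:M : 'M[R]_1) d 0 A).
Proof.
move=> a0 uA hA f b tf.
rewrite det_ublock1 normrM -mulrA [in LHS]lebintS.
have [fb [M [B /bounded_by_ge0[M0 fMB]]]] := tf.
have E t : lebint (slice (fun x : 'rV_m.+1 =>
    f (x *m (block_mx (a%:M : 'M[R]_1) d 0 A : 'M[R]_m.+1) + b)) t) =
    `|\det A|^-1 * lebint (slice f (a * t + lsubmx (b : 'rV_(1 + m)) 0 0)).
  rewrite -(hA (slice f (a * t + lsubmx (b : 'rV_(1 + m)) 0 0))
     (t *: d + rsubmx (b : 'rV_(1 + m)))); last exact: tame_slice.
  rewrite mulKf; last by rewrite normr_eq0 -unitfE -unitmxE.
  by apply: eq_lebint => x; rewrite /slice split_affine_u.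
under eq_Rintegral => t _ do rewrite E.
pose F (t : measurableTypeR R) := lebint (slice f t).
have mF : measurable_fun [set: measurableTypeR R] F by exact: borel_measurable_lebint.
have F1 t : `|F t| <= M * (2 * `|B|) ^+ m.
  by apply: lebint_bounded; [exact: borel_row_mx| |exact: bounded_by_slice].
have F2 t : F t != 0 -> `|t| <= `|B| by exact: (lebint_slice_support fMB).
have := @Rintegral_affine _ F _ `|B| a (lsubmx (b : 'rV_(1 + m)) 0 0) a0 mF F1 F2.
rewrite /F => H.
rewrite RintegralZl //; last first.
  apply: (@integrable_bounded1 _ (fun t => F (a * t + lsubmx (b : 'rV_(1 + m)) 0 0)) _
    ((`|B| + `|lsubmx (b : 'rV_(1 + m)) 0 0|) / `|a|)).
  - exact: (measurableT_comp mF (measurable_affine _ _)).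
  - by move=> t; exact: F1.
  - move=> t /F2 h; rewrite ler_pdivlMr ?normr_gt0 // -normrM mulrC.
    set s := lsubmx _ _ _ in h *.
    have -> : a * t = a * t + s - s by ring.
    by rewrite (le_trans (ler_normB _ _)) // lerD.
by rewrite mulVKf ?H // normr_eq0 -unitfE -unitmxE.
Qed.

(** The other coordinates of the image do not involve the first coordinate:
    with the integral over the latter taken first, the translation that they
    cause in it is harmless. *)
Lemma volume_scaling_lblock m (a : R) (c : 'cV[R]_m) (A : 'M[R]_m) : a != 0 ->
  A \in unitmx -> volume_scaling A ->
  @volume_scaling m.+1 (block_mx (a%:M : 'M[R]_1) 0 c A).
Proof.
move=> a0 uA hA f b tf.
have u : (block_mx (a%:M : 'M[R]_1) 0 c A : 'M[R]_m.+1) \in unitmx.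
  by rewrite unitmxE det_lblock1 unitrM unitfE a0 -unitmxE.
rewrite det_lblock1 normrM (lebint_Fubini (tame_affine b u tf)).
have [fb [M [B /bounded_by_ge0[M0 fMB]]]] := tf.
rewrite (lebint_Fubini tf) -(hA _ (rsubmx (b : 'rV_(1 + m))) (tame_head_int tf)).
rewrite -mulrA mulrCA; congr (_ * _).
rewrite -lebintZ; last first.
  exact: (tame_head_int (tame_affine b u tf)).
apply: eq_lebint => x; rewrite /head_int.
have mF : measurable_fun [set: measurableTypeR R]
    (fun t => slice f t (x *m A + rsubmx (b : 'rV_(1 + m)))).
  have H := borel_slice fb (@measurable_id _ _ setT)
    (fun i => measurable_cst ((x *m A + rsubmx (b : 'rV_(1 + m))) 0 i)).
  suff -> : (fun t => slice f t (x *m A + rsubmx (b : 'rV_(1 + m)))) =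
    fun t => slice f t (\row_i ((x *m A + rsubmx (b : 'rV_(1 + m))) 0 i)) by [].
  by apply/funext => t; congr slice; apply/rowP => i; rewrite [RHS]mxE.
rewrite -(@Rintegral_affine _ _ M `|B| a ((x *m c) 0 0 + lsubmx (b : 'rV_(1 + m)) 0 0) a0 mF).
- congr (_ * _); apply: eq_Rintegral => t _.
  by rewrite /slice split_affine_l.
- by move=> t; exact: fMB.1.
- by move=> t /fMB.2 /(_ ord0); rewrite row_mx_head.
Qed.

Lemma volume_scaling1 m : volume_scaling (1%:M : 'M[R]_m).
Proof.
elim: m => [|m IHm].
  move=> f b tf; rewrite det1 normr1 mul1r /=; congr f.
  by apply/rowP => -[].
have -> : (1%:M : 'M[R]_m.+1) = block_mx (1%:M : 'M[R]_1) 0 0 (1%:M : 'M[R]_m).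
  exact: (scalar_mx_block 1 m 1).
by apply: volume_scaling_ublock; rewrite ?oner_eq0 ?unitmx1.
Qed.

(** Gaussian elimination: a matrix with nonzero upper left entry is the product
    of a block lower and a block upper triangular matrix. *)
Lemma lebint_affine m (A : 'M[R]_m) : A \in unitmx -> volume_scaling A.
Proof.
elim: m A => [|m IHm] A uA.
  move=> f b tf; rewrite det_mx00 normr1 mul1r /=; congr f.
  by apply/rowP => -[].
have nz (A' : 'M[R]_(1 + m)) : A' \in unitmx -> ulsubmx A' 0 0 != 0 ->
    @volume_scaling m.+1 A'.
  move=> uA' a0.
  set a := ulsubmx A' 0 0 in a0.
  pose S := drsubmx A' - a^-1 *: (dlsubmx A' *m ursubmx A').
  have E : A' = (block_mx (1%:M : 'M[R]_1) 0 (a^-1 *: dlsubmx A') 1%:M : 'M[R]_(1 + m)) *m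
      block_mx (a%:M : 'M[R]_1) (ursubmx A') 0 S.
    rewrite mulmx_block !(mul1mx, mul0mx, mulmx0, addr0).
    rewrite -[LHS]submxK; congr block_mx.
    - by apply/matrixP => i j; rewrite !ord1 [RHS]mxE eqxx.
    - by rewrite -scalemxAl mul_mx_scalar scalerA mulVf // scale1r.
    - by rewrite -scalemxAl addrC subrK.
  have uS : S \in unitmx.
    move: uA'; rewrite {1}E !unitmxE det_mulmx det_ublock.
    by rewrite !unitrM => /andP[_ /andP[]].
  rewrite E; apply: volume_scalingM.
  - by rewrite unitmxE det_ublock1 unitrM unitfE a0 -unitmxE.
  - apply: volume_scaling_lblock; rewrite ?oner_eq0 ?unitmx1 //.
    exact: volume_scaling1.
  - by apply: volume_scaling_ublock => //; exact: IHm.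
pose A1 : 'M[R]_(1 + m) := A.
have [a0|] := eqVneq (ulsubmx A1 0 0) 0; last exact: nz.
have [c0|/rV0Pn[j cj]] := eqVneq (dlsubmx A1)^T 0.
  have dl0 : dlsubmx A1 = 0 by rewrite -[LHS]trmxK c0 trmx0.
  have ul0 : ulsubmx A1 = 0 by apply/matrixP => i k; rewrite !ord1 a0 mxE.
  have dA0 : \det A1 = 0.
    by rewrite -[X in \det X]submxK dl0 ul0 det_ublock det0 mul0r.
  by move: uA; rewrite unitmxE -[A]/A1 dA0 unitr0.
(* an invertible matrix has a nonzero entry in its first column; adding its row
   to the first one creates the pivot *)
pose U (s : R) : 'M[R]_(1 + m) := block_mx (1%:M : 'M[R]_1) (s *: delta_mx 0 j) 0 1%:M.
have uU s : U s \in unitmx by rewrite unitmxE det_ublock !det1 mulr1 unitr1.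
have UU : U (-1) *m U 1 = 1%:M.
  rewrite mulmx_block !(mul1mx, mulmx1, mul0mx, mulmx0, addr0, add0r).
  by rewrite -scalerDl subrr scale0r -scalar_mx_block.
have -> : A = U (-1) *m (U 1 *m A1) by rewrite mulmxA UU mul1mx.
apply: volume_scalingM.
- by rewrite unitmx_mul uU.
- apply: volume_scaling_ublock; rewrite ?oner_eq0 ?unitmx1 //.
  exact: volume_scaling1.
- apply: nz; first by rewrite unitmx_mul uU.
  rewrite -[A1]submxK mulmx_block block_mxKul mul1mx scale1r mxE a0 add0r.
  rewrite -rowE !mxE; by move: cj; rewrite !mxE.
Qed.

End Affine.

(** * Integration over the reference simplex *)
Section Regular.
Context {R : realType}.

(** The factor allowed in front of the indicator of a bounded set
    ([tame_indic]): it contains the polynomials which are not [tame] themselves. *)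
Definition regular m (g : 'rV[R]_m -> R) : Prop :=
  borel g /\ forall B : R, exists M : R, forall x : 'rV[R]_m, (forall i, `|x 0 i| <= B) -> `|g x| <= M.

Lemma regular_cst m (c : R) : regular (fun _ : 'rV[R]_m => c).
Proof. by split; [exact: borel_cst|move=> B; exists `|c|]. Qed.

Lemma regular_coord m (i : 'I_m) : regular (fun x : 'rV[R]_m => x 0 i).
Proof. by split; [exact: borel_coord|move=> B; exists B => x]. Qed.

Lemma regularD m (f g : 'rV[R]_m -> R) :
  regular f -> regular g -> regular (fun x => f x + g x).
Proof.
move=> [fb fl] [gb gl]; split; first exact: borelD.
move=> B; have [M HM] := fl B; have [N HN] := gl B; exists (M + N) => x xB.
by rewrite (le_trans (ler_normD _ _)) // lerD ?HM ?HN.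
Qed.

Lemma regularM m (f g : 'rV[R]_m -> R) :
  regular f -> regular g -> regular (fun x => f x * g x).
Proof.
move=> [fb fl] [gb gl]; split; first exact: borelM.
move=> B; have [M HM] := fl B; have [N HN] := gl B; exists (M * N) => x xB.
by rewrite normrM ler_pM ?HM ?HN.
Qed.

Lemma regular_sum (J : Type) (r : seq J) m (f : J -> 'rV[R]_m -> R) :
  (forall j, regular (f j)) -> regular (fun x => \sum_(j <- r) f j x).
Proof.
move=> H; elim: r => [|j r IHr].
  by under eq_fun do rewrite big_nil; exact: regular_cst.
by under eq_fun do rewrite big_cons; exact: regularD.
Qed.

Lemma regular_prod (J : Type) (r : seq J) m (f : J -> 'rV[R]_m -> R) :
  (forall j, regular (f j)) -> regular (fun x => \prod_(j <- r) f j x).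
Proof.
move=> H; elim: r => [|j r IHr].
  by under eq_fun do rewrite big_nil; exact: regular_cst.
by under eq_fun do rewrite big_cons; exact: regularM.
Qed.

Lemma regularX m (f : 'rV[R]_m -> R) k : regular f -> regular (fun x => f x ^+ k).
Proof.
move=> H; elim: k => [|k IHk].
  by under eq_fun do rewrite expr0; exact: regular_cst.
by under eq_fun do rewrite exprS; exact: regularM.
Qed.

Lemma regular_ev m n (p : mpoly n.+1 R) (h : 'rV[R]_m -> 'rV[R]_n.+1) :
  (forall i, regular (fun x => h x 0 i)) -> regular (fun x => ev p (h x)).
Proof.
move=> hr; under eq_fun do rewrite /ev mevalE.
apply: regular_sum => a; apply: regularM; first exact: regular_cst.
by apply: regular_prod => i; exact: regularX.
Qed.

Lemma tame_indic m (g : 'rV[R]_m -> R) (S : set 'rV[R]_m) (B : R) :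
  regular g -> borel (\1_S : 'rV[R]_m -> R) ->
  (forall x, S x -> forall i, `|x 0 i| <= B) -> tame (fun x => g x * \1_S x).
Proof.
move=> [gb gl] Sb SB; split; first exact: borelM.
have [M HM] := gl B; exists (Num.max M 0), B; split=> x.
  rewrite indicE; case: (boolP (x \in S)) => [xS|_]; last first.
    by rewrite mulr0 normr0 le_max lexx orbT.
  by rewrite mulr1 le_max HM //; apply: SB; rewrite inE in xS.
rewrite indicE; case: (boolP (x \in S)) => [xS _|_]; last by rewrite mulr0 eqxx.
by apply: SB; rewrite inE in xS.
Qed.

End Regular.

Section ReferenceSimplex.
Context {R : realType}.

(** Barycentric coordinates; vertex 0 of the reference simplex is the origin. *)
Definition bary m (s : 'rV[R]_m) (i : 'I_m.+1) : R :=
  if unlift ord0 i is Some j then s 0 j else 1 - \sum_j s 0 j.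

Lemma bary0 m (s : 'rV[R]_m) : bary s ord0 = 1 - \sum_j s 0 j.
Proof. by rewrite /bary unlift_none. Qed.

Lemma bary_lift m (s : 'rV[R]_m) j : bary s (lift ord0 j) = s 0 j.
Proof. by rewrite /bary liftK. Qed.

Lemma sum_bary m (s : 'rV[R]_m) : \sum_i bary s i = 1.
Proof.
rewrite big_ord_recl bary0.
have -> : \sum_(j < m) bary s (lift ord0 j) = \sum_j s 0 j.
  by apply: eq_bigr => j _; exact: bary_lift.
by rewrite subrK.
Qed.

Lemma ref_simplexE m (s : 'rV[R]_m) : ref_simplex s <-> forall i, 0 <= bary s i.
Proof.
split=> [[s0 s1] i|H].
  by case: (unliftP ord0 i) => [j|] ->; rewrite ?bary_lift ?bary0 // subr_ge0.
split=> [j|]; first by have := H (lift ord0 j); rewrite bary_lift.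
by have := H ord0; rewrite bary0 subr_ge0.
Qed.

Lemma regular_bary m (i : 'I_m.+1) : regular (fun s : 'rV[R]_m => bary s i).
Proof.
case: (unliftP ord0 i) => [j|] ->.
  by under eq_fun do rewrite bary_lift; exact: regular_coord.
under eq_fun do rewrite bary0 -sumrN; apply: regularD; first exact: regular_cst.
apply: regular_sum => j; under eq_fun do rewrite -mulN1r.
by apply: regularM; [exact: regular_cst|exact: regular_coord].
Qed.

Lemma borel_indic_ge0 m (f : 'rV[R]_m -> R) : borel f ->
  borel (fun x => ((0 <= f x)%R)%:R : R).
Proof.
move=> fb d T g mg.
have -> : (fun t => ((0 <= f (\row_i g i t))%R)%:R) =
    (\1_(`[0, +oo[ : set R) : R -> R) \o (fun t => f (\row_i g i t)).
  apply/funext => t /=; rewrite indicE; congr (_ %:R); congr nat_of_bool.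
  by apply/idP/idP => [H|]; rewrite ?inE /= in_itv /= andbT.
apply: measurableT_comp; last exact: fb.
by apply: measurable_indic; exact: measurable_itv.
Qed.

Lemma borel_indic_ref m : borel (\1_(@ref_simplex R m) : 'rV[R]_m -> R).
Proof.
have -> : (\1_(@ref_simplex R m) : 'rV[R]_m -> R) =
    fun s => \prod_(i : 'I_m.+1) ((0 <= bary s i)%R)%:R.
  apply/funext => s; rewrite indicE; case: (boolP (s \in _)) => [|]; rewrite ?inE ?notin_setE.
    by move=> /ref_simplexE H; rewrite big1 // => i _; rewrite H.
  move=> H; have /existsNP[i /negP Hi] : ~ forall i, 0 <= bary s i.
    by move/ref_simplexE.
  by rewrite (bigD1 i) //= (negbTE Hi) mul0r.
move=> d T g mg; apply: measurable_prod => i _.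
exact: (borel_indic_ge0 (regular_bary i).1 mg).
Qed.

Lemma ref_simplex_bounded m (s : 'rV[R]_m) : ref_simplex s -> forall i, `|s 0 i| <= 1.
Proof.
move=> [s0 s1] i; rewrite ger0_norm //; apply: le_trans s1.
by rewrite (bigD1 i) //= lerDl sumr_ge0.
Qed.

Definition refint m (h : 'rV[R]_m -> R) : R :=
  lebint (fun s => h s * \1_(@ref_simplex R m) s).

(** Only the values on the simplex are constrained: a function on the skeleton
    agrees with a polynomial on each face and is arbitrary elsewhere. *)
Definition ref_regular m (h : 'rV[R]_m -> R) : Prop :=
  exists2 g, regular g & forall s, ref_simplex s -> h s = g s.

Lemma regular_ref_regular m (h : 'rV[R]_m -> R) : regular h -> ref_regular h.
Proof. by exists h. Qed.

Lemma ref_regularD m (f g : 'rV[R]_m -> R) :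
  ref_regular f -> ref_regular g -> ref_regular (fun s => f s + g s).
Proof.
move=> [f' rf ff'] [g' rg gg']; exists (fun s => f' s + g' s); first exact: regularD.
by move=> s hs; rewrite ff' ?gg'.
Qed.

Lemma ref_regularM m (f g : 'rV[R]_m -> R) :
  ref_regular f -> ref_regular g -> ref_regular (fun s => f s * g s).
Proof.
move=> [f' rf ff'] [g' rg gg']; exists (fun s => f' s * g' s); first exact: regularM.
by move=> s hs; rewrite ff' ?gg'.
Qed.

Lemma mul_indic_ref m (f g : 'rV[R]_m -> R) (s : 'rV[R]_m) :
  (ref_simplex s -> f s = g s) ->
  f s * \1_(@ref_simplex R m) s = g s * \1_(@ref_simplex R m) s.
Proof.
move=> fg; rewrite indicE; case: (boolP (s \in _)) => [|_]; last by rewrite !mulr0.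
by rewrite inE => /fg ->.
Qed.

Lemma tame_ref m (h : 'rV[R]_m -> R) :
  ref_regular h -> tame (fun s => h s * \1_(@ref_simplex R m) s).
Proof.
move=> [g rg hg].
have -> : (fun s => h s * \1_(@ref_simplex R m) s) =
    fun s => g s * \1_(@ref_simplex R m) s.
  by apply/funext => s; apply: mul_indic_ref; exact: hg.
by apply: tame_indic => //; [exact: borel_indic_ref|exact: ref_simplex_bounded].
Qed.

Lemma eq_refint m (f g : 'rV[R]_m -> R) :
  (forall s, ref_simplex s -> f s = g s) -> refint f = refint g.
Proof. by move=> fg; apply: eq_lebint => s; apply: mul_indic_ref; exact: fg. Qed.

Lemma refintD m (f g : 'rV[R]_m -> R) : ref_regular f -> ref_regular g ->
  refint (fun s => f s + g s) = refint f + refint g.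
Proof.
move=> rf rg; rewrite -lebintD; [|exact: tame_ref..].
by apply: eq_lebint => s; rewrite mulrDl.
Qed.

Lemma refintZ m (c : R) (f : 'rV[R]_m -> R) : ref_regular f ->
  refint (fun s => c * f s) = c * refint f.
Proof.
move=> rf; rewrite -lebintZ; last exact: tame_ref.
by apply: eq_lebint => s; rewrite mulrA.
Qed.

Lemma refint_ge0 m (f : 'rV[R]_m -> R) :
  (forall s, ref_simplex s -> 0 <= f s) -> 0 <= refint f.
Proof.
move=> f0; apply: lebint_ge0 => s; rewrite indicE.
by case: (boolP (s \in _)) => [|_]; rewrite ?mulr0 // inE mulr1 => /f0.
Qed.

Lemma ref_regular_sum (J : Type) (r : seq J) m (f : J -> 'rV[R]_m -> R) :
  (forall j, ref_regular (f j)) -> ref_regular (fun x => \sum_(j <- r) f j x).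
Proof.
move=> H; elim: r => [|j r IHr].
  by under eq_fun do rewrite big_nil; exact/regular_ref_regular/regular_cst.
by under eq_fun do rewrite big_cons; exact: ref_regularD.
Qed.

Lemma refint_sum (J : Type) (r : seq J) m (f : J -> 'rV[R]_m -> R) :
  (forall j, ref_regular (f j)) ->
  refint (fun x => \sum_(j <- r) f j x) = \sum_(j <- r) refint (f j).
Proof.
move=> H; elim: r => [|j r IHr].
  rewrite big_nil -[RHS](lebint0 m).
  by apply: eq_lebint => s; rewrite big_nil mul0r.
rewrite big_cons -IHr -refintD //; last exact: ref_regular_sum.
by apply: eq_refint => s _; rewrite big_cons.
Qed.

End ReferenceSimplex.

(** * Integration over simplices *)
Section Hull.
Context {R : realType} {n : nat}.
Local Notation pt := 'rV[R]_n.+1.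

Lemma bary_pointE m (w : 'I_m.+1 -> pt) (s : 'rV[R]_m) :
  w ord0 + s *m edges w = \sum_i bary s i *: w i.
Proof.
rewrite mulmx_sum_row big_ord_recl bary0 scalerBl scale1r -addrA; congr (_ + _).
rewrite scaler_suml -sumrN -big_split /=; apply: eq_bigr => j _.
by rewrite bary_lift rowK scalerBr addrC.
Qed.

Lemma bary_of m (t : 'I_m.+1 -> R) : \sum_i t i = 1 ->
  bary (\row_j t (lift ord0 j)) =1 t.
Proof.
rewrite big_ord_recl => /esym t1 i; case: (unliftP ord0 i) => [j|] ->.
  by rewrite bary_lift mxE.
rewrite bary0 t1.
have -> : \sum_j (\row_j0 t (lift ord0 j0)) 0 j = \sum_(j < m) t (lift ord0 j).
  by apply: eq_bigr => j _; rewrite mxE.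
by rewrite addrK.
Qed.

Lemma hullTE m (w : 'I_m.+1 -> pt) x :
  hull w predT x <-> exists2 s, ref_simplex s & x = w ord0 + s *m edges w.
Proof.
split=> [[t [t0 _ t1 ->]]|[s /ref_simplexE s0 ->]].
  exists (\row_j t (lift ord0 j)); first by apply/ref_simplexE => i; rewrite bary_of.
  by rewrite bary_pointE; apply: eq_bigr => i _; rewrite bary_of.
by exists (bary s); split => //; [exact: sum_bary|exact: bary_pointE].
Qed.

Lemma hull_lift m (v : 'I_m.+2 -> pt) i :
  hull v (predC1 i) = hull (fun j => v (lift i j)) predT.
Proof.
apply/seteqP; split=> x [t [t0 tP t1 ->]].
  exists (fun j => t (lift i j)); split=> //.
    by rewrite -t1 (bigD1_ord i) //= tP ?add0r //= negbK.
  by rewrite (bigD1_ord i) //= tP ?scale0r ?add0r //= negbK.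
exists (fun k => if unlift i k is Some j then t j else 0); split.
- by move=> k; case: unliftP.
- by move=> k; rewrite /= negbK => /eqP ->; rewrite unlift_none.
- by rewrite (bigD1_ord i) //= unlift_none add0r -t1; apply: eq_bigr => j _; rewrite liftK.
- rewrite (bigD1_ord i) //= unlift_none scale0r add0r.
  by apply: eq_bigr => j _; rewrite liftK.
Qed.

Lemma sub_hull m m' (v : 'I_m -> pt) (v' : 'I_m'.+1 -> pt) (P : pred 'I_m)
    (Q : pred 'I_m'.+1) :
  (forall i, P i -> exists2 j, Q j & v i = v' j) -> hull v P `<=` hull v' Q.
Proof.
move=> PQ.
have /choice[f fP] : forall i, exists j, P i -> Q j /\ v i = v' j.
  move=> i; case: (boolP (P i)) => [/PQ[j]|_]; first by exists j.
  by exists ord0.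
move=> x [t [t0 tP t1 ->]].
exists (fun j => \sum_(i | f i == j) t i); split.
- by move=> j; exact: sumr_ge0.
- move=> j Qj; apply: big1 => i /eqP fij; apply: tP.
  by apply: contra Qj => /fP[]; rewrite fij.
- by rewrite -t1 (partition_big f predT).
- rewrite (partition_big f predT) //=; apply: eq_bigr => j _.
  rewrite scaler_suml; apply: eq_bigr => i /eqP <-.
  case: (boolP (P i)) => [/fP[_ ->] //|/tP ->]; by rewrite !scale0r.
Qed.

Lemma vertex_hull m (v : 'I_m -> pt) (P : pred 'I_m) i : P i -> hull v P (v i).
Proof.
move=> Pi; exists (fun j => (j == i)%:R); split.
- by move=> j; rewrite ler0n.
- by move=> j; have [-> /negP //|//] := eqVneq j i.
- rewrite (bigD1 i) //= eqxx big1 ?addr0 // => j ji.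
  by rewrite (negbTE ji).
- rewrite (bigD1 i) //= eqxx scale1r big1 ?addr0 // => j ji.
  by rewrite (negbTE ji) scale0r.
Qed.

End Hull.

Section SimplexIntegral.
Context {R : realType}.

Definition regular_on n m (w : 'I_m.+1 -> 'rV[R]_n.+1) (f : 'rV[R]_n.+1 -> R) : Prop :=
  exists2 g, regular g & forall x, hull w predT x -> f x = g x.

(** The volume factor is left out, so that cells and facets are treated alike
    and the vertices need not be independent. *)
Definition sint n m (w : 'I_m.+1 -> 'rV[R]_n.+1) (f : 'rV[R]_n.+1 -> R) : R :=
  refint (fun s => f (w ord0 + s *m edges w)).

Lemma regular_comp_affine m p (f : 'rV[R]_p -> R) (b : 'rV[R]_p) (A : 'M[R]_(m, p)) :
  regular f -> regular (fun x => f (b + x *m A)).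
Proof.
move=> [fb fl]; split.
  by under eq_fun do rewrite addrC; exact: borel_affine.
move=> B; have [M HM] := fl (\sum_i (`|b 0 i| + \sum_j `|B| * `|A j i|)).
exists M => x xB; apply: HM => i.
rewrite !mxE (le_trans (ler_normD _ _)) // (bigD1 i) //=; apply: ler_wpDr.
  by apply: sumr_ge0 => k _; rewrite addr_ge0 // sumr_ge0 // => j _; rewrite mulr_ge0.
rewrite lerD2l (le_trans (ler_norm_sum _ _ _)) //; apply: ler_sum => j _.
by rewrite normrM ler_wpM2r // (le_trans (xB j)) // ler_norm.
Qed.

Section Fixed.
Variables (n m : nat) (w : 'I_m.+1 -> 'rV[R]_n.+1).
Implicit Types f g : 'rV[R]_n.+1 -> R.

Lemma regular_on_ref f : regular_on w f ->
  ref_regular (fun s : 'rV[R]_m => f (w ord0 + s *m edges w)).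
Proof.
move=> [g rg fg]; exists (fun s => g (w ord0 + s *m edges w)).
  exact: regular_comp_affine.
by move=> s hs; apply: fg; apply/hullTE; exists s.
Qed.

Lemma regular_regular_on f : regular f -> regular_on w f.
Proof. by exists f. Qed.

Lemma regular_on_cst (c : R) : regular_on w (fun _ => c).
Proof. exact/regular_regular_on/regular_cst. Qed.

Lemma regular_onD f g : regular_on w f -> regular_on w g ->
  regular_on w (fun x => f x + g x).
Proof.
move=> [f' rf ff'] [g' rg gg']; exists (fun s => f' s + g' s); first exact: regularD.
by move=> s hs; rewrite ff' ?gg'.
Qed.

Lemma regular_onM f g : regular_on w f -> regular_on w g ->
  regular_on w (fun x => f x * g x).
Proof.
move=> [f' rf ff'] [g' rg gg']; exists (fun s => f' s * g' s); first exact: regularM.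
by move=> s hs; rewrite ff' ?gg'.
Qed.

Lemma regular_onN f : regular_on w f -> regular_on w (fun x => - f x).
Proof.
move=> rf; under eq_fun do rewrite -mulN1r.
by apply: regular_onM => //; exact: regular_on_cst.
Qed.

Lemma regular_on_sum (J : Type) (r : seq J) (f : J -> 'rV[R]_n.+1 -> R) :
  (forall j, regular_on w (f j)) -> regular_on w (fun x => \sum_(j <- r) f j x).
Proof.
move=> H; elim: r => [|j r IHr].
  by under eq_fun do rewrite big_nil; exact: regular_on_cst.
by under eq_fun do rewrite big_cons; exact: regular_onD.
Qed.

Lemma regular_on_ev (p : mpoly n.+1 R) : regular_on w (ev p).
Proof. by apply: regular_regular_on; apply: regular_ev => i; exact: regular_coord. Qed.

Lemma eq_regular_on f g : (forall x, hull w predT x -> f x = g x) ->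
  regular_on w g -> regular_on w f.
Proof. by move=> fg [h rh gh]; exists h => // x hx; rewrite fg // gh. Qed.

Lemma eq_sint f g : (forall x, hull w predT x -> f x = g x) -> sint w f = sint w g.
Proof.
by move=> fg; apply: eq_refint => s hs; apply: fg; apply/hullTE; exists s.
Qed.

Lemma sintD f g : regular_on w f -> regular_on w g ->
  sint w (fun x => f x + g x) = sint w f + sint w g.
Proof. by move=> rf rg; apply: refintD; exact: regular_on_ref. Qed.

Lemma sintZ (c : R) f : regular_on w f -> sint w (fun x => c * f x) = c * sint w f.
Proof.
by move=> rf; apply: (refintZ c (f := fun s => f _)); exact: regular_on_ref.
Qed.

Lemma sint_sum (J : Type) (r : seq J) (f : J -> 'rV[R]_n.+1 -> R) :
  (forall j, regular_on w (f j)) ->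
  sint w (fun x => \sum_(j <- r) f j x) = \sum_(j <- r) sint w (f j).
Proof.
by move=> H; apply: (refint_sum r (f := fun j s => f j _)) => j; exact: regular_on_ref.
Qed.

Lemma sint_ge0 f : (forall x, hull w predT x -> 0 <= f x) -> 0 <= sint w f.
Proof.
by move=> f0; apply: refint_ge0 => s hs; apply: f0; apply/hullTE; exists s.
Qed.

Lemma le_sint f g : regular_on w f -> regular_on w g ->
  (forall x, hull w predT x -> f x <= g x) -> sint w f <= sint w g.
Proof.
move=> rf rg fg; rewrite -subr_ge0 -[X in _ - X]mul1r -mulNr -sintZ // -sintD //.
  by apply: sint_ge0 => x /fg; rewrite mulN1r subr_ge0.
by apply: regular_onM => //; exact: regular_on_cst.
Qed.

End Fixed.

Lemma discriminant_le0 (a b c : R) : 0 <= a ->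
  (forall t, 0 <= a * t ^+ 2 + 2 * b * t + c) -> b ^+ 2 <= a * c.
Proof.
move=> a_ge0 H; have [a0|a0] := eqVneq a 0.
  rewrite a0 mul0r; have [->|b0] := eqVneq b 0; first by rewrite expr0n.
  have := H (- (c + 1) / (2 * b)); rewrite a0 mul0r add0r.
  have -> : 2 * b * (- (c + 1) / (2 * b)) = - (c + 1) by field.
  by move=> h; exfalso; lra.
have := H (- b / a); rewrite (_ : _ + _ = (a * c - b ^+ 2) / a); last by field.
by rewrite pmulr_lge0 ?invr_gt0 ?lt_def ?a0 // subr_ge0.
Qed.

Lemma sint_CauchySchwarz n m (w : 'I_m.+1 -> 'rV[R]_n.+1) f g :
  regular_on w f -> regular_on w g ->
  sint w (fun x => f x * g x) ^+ 2 <=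
  sint w (fun x => f x ^+ 2) * sint w (fun x => g x ^+ 2).
Proof.
move=> rf rg; apply: discriminant_le0 => [|t].
  by apply: sint_ge0 => x _; exact: sqr_ge0.
have rff : regular_on w (fun x => f x * f x) by exact: regular_onM.
have rgg : regular_on w (fun x => g x * g x) by exact: regular_onM.
have rfg : regular_on w (fun x => f x * g x) by exact: regular_onM.
have -> : sint w (fun x => f x ^+ 2) * t ^+ 2 + 2 * sint w (fun x => f x * g x) * t +
   sint w (fun x => g x ^+ 2) = sint w (fun x => (t * f x + g x) ^+ 2).
  have rZ c h : regular_on w h -> regular_on w (fun x => c * h x).
    by move=> rh; apply: regular_onM => //; exact: regular_on_cst.
  have -> : sint w (fun x => f x ^+ 2) * t ^+ 2 = sint w (fun x => t ^+ 2 * f x ^+ 2).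
    by rewrite mulrC -sintZ.
  have -> : 2 * sint w (fun x => f x * g x) * t = sint w (fun x => 2 * t * (f x * g x)).
    by rewrite mulrAC -sintZ.
  by rewrite -!sintD //; do ?[exact: rZ|apply: regular_onD];
    apply: eq_sint => x _; ring.
by apply: sint_ge0 => x _; exact: sqr_ge0.
Qed.

End SimplexIntegral.

(** * Positivity of integrals *)
Section Positivity.
Context {R : realType}.
Local Notation mu := (@lebesgue_measure R).

Lemma indic_ballE (c r : R) :
  (fun t : measurableTypeR R => ((`|t - c| <= r)%R%:R : R)) =
  \1_([set` `[c - r, c + r] : interval R] : set (measurableTypeR R)).
Proof.
apply/funext => t; rewrite indicE; congr (_ %:R); congr nat_of_bool.
by apply/idP/idP; rewrite ler_distl ?inE /= in_itv.
Qed.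

Lemma Rintegral_indic_ball (c r : R) : 0 < r ->
  \int[mu]_t (`|t - c| <= r)%R%:R = 2 * r.
Proof.
move=> r0; pose S : set (measurableTypeR R) := [set` `[c - r, c + r] : interval R].
have mS : measurable S by exact: measurable_itv.
have muS : mu S = (2 * r)%:E.
  rewrite lebesgue_measure_itv /= lte_fin ltrD2l gtrN // -EFinD; congr EFin; ring.
rewrite (_ : (fun t => _) = \1_S); last exact: indic_ballE.
by rewrite /Rintegral (integral_indic _ _ mS) // setIT; exact: (congr1 fine muS).
Qed.

Lemma measurable_indic_ball (c r : R) :
  measurable_fun [set: measurableTypeR R] (fun t => ((`|t - c| <= r)%R%:R : R)).
Proof. by rewrite indic_ballE; apply: measurable_indic; exact: measurable_itv. Qed.

Definition cube m (c : 'rV[R]_m) (r : R) (x : 'rV[R]_m) : R :=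
  \prod_i (`|x 0 i - c 0 i| <= r)%R%:R.

Lemma cubeE m (c : 'rV[R]_m) r x :
  cube c r x = [forall i, `|x 0 i - c 0 i| <= r]%:R.
Proof.
rewrite /cube; case: (boolP [forall i, _]) => [/forallP H|].
  by rewrite big1 // => i _; rewrite H.
by rewrite negb_forall => /existsP[i /negbTE Hi]; rewrite (bigD1 i) //= Hi mul0r.
Qed.

Lemma tame_cube m (c : 'rV[R]_m) r : tame (cube c r).
Proof.
split.
  move=> d T g mg; apply: measurable_prod => i _.
  under eq_fun do rewrite mxE.
  exact: (measurableT_comp (measurable_indic_ball _ _) (mg i)).
exists 1, (\sum_i `|c 0 i| + `|r|); split=> x; rewrite cubeE.
  by case: [forall i, _]; rewrite ?normr1 ?normr0.
case: (boolP [forall i, _]) => [/forallP H _ i|]; last by rewrite eqxx.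
have -> : x 0 i = c 0 i + (x 0 i - c 0 i) by ring.
rewrite (le_trans (ler_normD _ _)) // lerD //; last by rewrite (le_trans (H i)) ?ler_norm.
by rewrite (bigD1 i) //= lerDl sumr_ge0.
Qed.

Lemma lebint_cube m (c : 'rV[R]_m) r : 0 < r -> lebint (cube c r) = (2 * r) ^+ m.
Proof.
move=> r0; elim: m c => [|m IHm] c; first by rewrite /= /cube big_ord0.
rewrite lebintS exprS.
pose c' : 'rV[R]_m := \row_j c 0 (lift ord0 j).
have E t : lebint (slice (cube c r) t) = (`|t - c 0 ord0| <= r)%R%:R * (2 * r) ^+ m.
  rewrite -(IHm c') -lebintZ; last exact: tame_cube.
  apply: eq_lebint => x; rewrite /slice /cube big_ord_recl row_mx_head; congr (_ * _).
  by apply: eq_bigr => j _; rewrite row_mx_tail mxE.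
under eq_Rintegral => t _ do rewrite E.
rewrite RintegralZr ?Rintegral_indic_ball //.
apply: (@integrable_bounded1 _ _ 1 (`|c 0 ord0| + r)).
- exact: measurable_indic_ball.
- by move=> t; case: (_ <= r); rewrite ?normr1 ?normr0.
- move=> t; case: (boolP (_ <= r)) => [h _|]; last by rewrite eqxx.
  have -> : t = c 0 ord0 + (t - c 0 ord0) by ring.
  by rewrite (le_trans (ler_normD _ _)) // lerD.
Qed.

Lemma refint_gt0 m (h : 'rV[R]_m -> R) (c : 'rV[R]_m) (r e : R) :
  ref_regular h -> (forall s, ref_simplex s -> 0 <= h s) -> 0 < r -> 0 < e ->
  (forall s : 'rV[R]_m, (forall i, `|s 0 i - c 0 i| <= r) -> ref_simplex s /\ e <= h s) ->
  0 < refint h.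
Proof.
move=> rh h0 r0 e0 H.
have : 0 < e * (2 * r) ^+ m by rewrite mulr_gt0 // exprn_gt0 // mulr_gt0.
move=> /lt_le_trans; apply; rewrite -(lebint_cube c r0) -lebintZ; last exact: tame_cube.
apply: le_lebint => [||s].
- by apply: tameZ; exact: tame_cube.
- exact: tame_ref.
- rewrite cubeE; case: (boolP [forall i, _]) => [/forallP /H[sr es]|_].
    by rewrite mulr1 indicE mem_set // mulr1.
  rewrite mulr0 indicE; case: (boolP (s \in _)) => [|_]; rewrite ?mulr0 // inE mulr1.
  exact: h0.
Qed.

(** The barycentre of the reference simplex is at distance 1 / (m + 1) from the
    coordinate hyperplanes, and its coordinates add up to 1 - 1 / (m + 1); both
    leave room for the cube of radius 1 / (m + 1)^2 around it. *)
Lemma ref_cube m (s : 'rV[R]_m) :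
  (forall i, `|s 0 i - m.+1%:R^-1| <= m.+1%:R^-1 ^+ 2) -> ref_simplex s.
Proof.
set a := m.+1%:R^-1 => H.
have a0 : 0 < a by rewrite invr_gt0.
have a1 : a <= 1 by rewrite invf_le1 ?ler1n.
have am : a * m%:R = 1 - a.
  rewrite -[m%:R](addrK 1) natr1 mulrBr mulr1 mulVf //.
split=> [j|].
  have := H j; rewrite ler_distl => /andP[+ _].
  have : a ^+ 2 <= a by rewrite expr2 ger_pMl.
  lra.
apply: (@le_trans _ _ (\sum_(j < m) (a + a ^+ 2))).
  by apply: ler_sum => j _; have := H j; rewrite ler_distl => /andP[].
rewrite sumr_const card_ord -mulr_natr mulrDl am expr2 -mulrA am.
nra.
Qed.

Lemma refint1_gt0 m : 0 < refint (fun _ : 'rV[R]_m => 1).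
Proof.
apply: (@refint_gt0 _ _ (const_mx m.+1%:R^-1) (m.+1%:R^-1 ^+ 2) 1).
- by exists (fun=> 1) => //; exact: regular_cst.
- by move=> s _; exact: ler01.
- by apply: exprn_gt0; rewrite invr_gt0.
- exact: ltr01.
- by move=> s H; split=> //; apply: ref_cube => i; have := H i; rewrite mxE.
Qed.

End Positivity.

(** * Independence of the numbering of the vertices *)
Section IntSimplex.
Context {R : realType} {n : nat}.
Local Notation pt := 'rV[R]_n.+1.
Implicit Types v : 'I_n.+2 -> pt.

Lemma nondegenerate_unit v : nondegenerate v -> edges v \in unitmx.
Proof. by rewrite /Defs.nondegenerate row_free_unit. Qed.

Lemma simplex_ref v x : nondegenerate v ->
  simplex v x <-> ref_simplex ((x - v ord0) *m invmx (edges v)).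
Proof.
move=> /nondegenerate_unit uE; rewrite /simplex hullTE; split=> [[s hs ->]|hs].
  by rewrite addrC addKr mulmxK.
exists ((x - v ord0) *m invmx (edges v)) => //.
by rewrite mulmxKV // addrC subrK.
Qed.

Lemma int_simplexE v f : nondegenerate v -> regular_on v f ->
  int_simplex v f = `|\det (edges v)| * sint v f.
Proof.
move=> nv rf; have uE := nondegenerate_unit nv.
have uE' : invmx (edges v) \in unitmx by rewrite unitmx_inv.
have := lebint_affine uE' (- (v ord0 *m invmx (edges v))) (tame_ref (regular_on_ref rf)).
rewrite /sint /refint => <-.
rewrite det_inv normrV // mulVKf; last by rewrite normr_eq0 -unitfE -unitmxE.
apply: eq_lebint => x.
rewrite -mulmxBl mulmxKV // addrC subrK; congr (_ * _).
rewrite !indicE; congr (_ %:R); congr nat_of_bool.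
by apply/idP/idP; rewrite !inE => /(simplex_ref x nv).
Qed.

Lemma int_facetE v i f :
  int_facet v i f = Num.sqrt (\det (edges (fun j => v (lift i j)) *m
    (edges (fun j => v (lift i j)))^T)) * sint (fun j => v (lift i j)) f.
Proof. by []. Qed.

End IntSimplex.

Section Permutation.
Context {R : realType}.

Lemma hull_perm n m (w : 'I_m.+1 -> 'rV[R]_n.+1) (s : 'I_m.+1 -> 'I_m.+1) :
  injective s -> hull (w \o s) predT = hull w predT.
Proof.
move=> si; apply/seteqP; split; apply: sub_hull => i _; first by exists (s i).
by exists (invF si i) => //=; rewrite f_invF.
Qed.

Lemma nondegenerate_perm n (v : 'I_n.+2 -> 'rV[R]_n.+1) (s : 'I_n.+2 -> 'I_n.+2) :
  injective s -> nondegenerate v -> nondegenerate (v \o s).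
Proof.
move=> si; rewrite /Defs.nondegenerate !row_free_unit -!row_full_unit -!sub1mx.
move=> H; apply: (submx_trans H); apply/row_subP => j; rewrite rowK.
have vs k : (v k - (v \o s) ord0 <= edges (v \o s))%MS.
  rewrite -(f_invF si k); case: (unliftP ord0 (invF si k)) => [l|] ->.
    have -> : v (s (lift ord0 l)) - (v \o s) ord0 = row l (edges (v \o s)) by rewrite rowK.
    exact: row_sub.
  by rewrite subrr sub0mx.
have -> : v (lift ord0 j) - v ord0 =
  (v (lift ord0 j) - (v \o s) ord0) - (v ord0 - (v \o s) ord0).
  by rewrite opprB addrA subrK.
by rewrite addmx_sub ?eqmx_opp.
Qed.

Lemma regular_on_perm n m (w : 'I_m.+1 -> 'rV[R]_n.+1) (s : 'I_m.+1 -> 'I_m.+1) f :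
  injective s -> regular_on w f -> regular_on (w \o s) f.
Proof. by move=> si [g rg fg]; exists g => // x; rewrite hull_perm // => /fg. Qed.

(** [int_simplex] sees the simplex as a set only. Comparing the two sides for
    the constant 1 gives the equality of the volume factors, by which the
    general case can then be divided. *)
Lemma simplex_perm n (v : 'I_n.+2 -> 'rV[R]_n.+1) (s : 'I_n.+2 -> 'I_n.+2) f :
  injective s -> nondegenerate v -> regular_on v f ->
  `|\det (edges (v \o s))| = `|\det (edges v)| /\ sint (v \o s) f = sint v f.
Proof.
move=> si nv rf; have nvs := nondegenerate_perm si nv.
have E g : regular_on v g ->
    `|\det (edges (v \o s))| * sint (v \o s) g = `|\det (edges v)| * sint v g.
  move=> rg; rewrite -!int_simplexE //; last exact: regular_on_perm.
  by rewrite /int_simplex /simplex hull_perm.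
have D : `|\det (edges (v \o s))| = `|\det (edges v)|.
  have := E (fun=> 1) (regular_on_cst v 1); rewrite /sint.
  by apply: mulIf; rewrite gt_eqF // refint1_gt0.
have d0 : `|\det (edges v)| != 0.
  by rewrite normr_eq0 -unitfE -unitmxE; exact: nondegenerate_unit.
have cancel (a b c : R) : a != 0 -> a * b = a * c -> b = c by move=> a0; exact: mulfI.
split; first exact: D.
have H := E f rf; rewrite D in H.
exact: (cancel _ _ _ d0 H).
Qed.

Definition std_vertex m (i : 'I_m.+1) : 'rV[R]_m := \row_j (i == lift ord0 j)%:R.

Lemma edges_std n : edges (@std_vertex n.+1) = 1%:M.
Proof.
apply/matrixP => i j; rewrite !mxE (inj_eq lift_inj).
by rewrite (negbTE (neq_lift _ _)) subr0.
Qed.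

Lemma sum_delta m (V : lmodType R) (a : 'I_m -> R) (s : 'I_m -> 'I_m) (w : 'I_m -> V) :
  \sum_i (\sum_k a k * (s k == i)%:R) *: w i = \sum_k a k *: w (s k).
Proof.
under eq_bigr => i _ do rewrite scaler_suml.
rewrite exchange_big; apply: eq_bigr => k _; rewrite (bigD1 (s k)) //=.
rewrite eqxx mulr1 big1 ?addr0 // => i ik.
by rewrite eq_sym (negbTE ik) mulr0 scale0r.
Qed.

Lemma std_point m (a : 'I_m.+1 -> R) (s : 'I_m.+1 -> 'I_m.+1) : \sum_k a k = 1 ->
  bary (\sum_k a k *: std_vertex (s k)) =1 fun i => \sum_k a k * (s k == i)%:R.
Proof.
move=> a1 i; have -> : \sum_k a k *: std_vertex (s k) =
    \row_j \sum_k a k * (s k == lift ord0 j)%:R.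
  by apply/rowP => j; rewrite summxE mxE; apply: eq_bigr => k _; rewrite !mxE.
apply: (bary_of (t := fun i => \sum_k a k * (s k == i)%:R)).
rewrite exchange_big -[RHS]a1; apply: eq_bigr => k _; rewrite (bigD1 (s k)) //=.
rewrite eqxx mulr1 big1 ?addr0 // => l lk.
by rewrite eq_sym (negbTE lk) mulr0.
Qed.

(** A permutation of the vertices is an affine map of the reference simplex of
    the same dimension, to which [simplex_perm] applies. *)
Lemma sint_perm n m (w : 'I_m.+1 -> 'rV[R]_n.+1) (s : 'I_m.+1 -> 'I_m.+1) f :
  injective s -> regular_on w f -> sint (w \o s) f = sint w f.
Proof.
case: m w s => [|m] w s si rf.
  have -> // : w \o s = w.
  by apply/funext => i; rewrite /= (ord1 (s i)) (ord1 i).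
pose h := fun y : 'rV[R]_m.+1 => f (w ord0 + y *m edges w).
have std_pt (y : 'rV[R]_m.+1) : std_vertex ord0 + y *m edges (@std_vertex m.+1) = y.
  rewrite edges_std mulmx1; apply/rowP => j; rewrite !mxE.
  by rewrite (negbTE (neq_lift _ _)) add0r.
have rh : regular_on (@std_vertex m.+1) h.
  have [g rg hg] := regular_on_ref rf; exists g => // x /hullTE[y hy ->].
  by rewrite std_pt; exact: hg.
have nd : nondegenerate (@std_vertex m.+1).
  by rewrite /Defs.nondegenerate row_free_unit edges_std unitmx1.
have [_ E] := simplex_perm si nd rh.
transitivity (sint (@std_vertex m.+1 \o s) h).
  apply: eq_refint => y _; rewrite /h; congr f; rewrite !bary_pointE.
  rewrite -(sum_delta (bary y) s w); apply: eq_bigr => i _; congr (_ *: _).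
  by rewrite -std_point ?sum_bary.
by rewrite E; apply: eq_refint => y _; rewrite /h std_pt.
Qed.

End Permutation.

(** * Barycentric coordinates and normals *)
Section Dot.
Context {R : realType} {n : nat}.
Local Notation pt := 'rV[R]_n.+1.
Implicit Types u v w : pt.

Lemma dotC u v : dot u v = dot v u.
Proof. by apply: eq_bigr => i _; rewrite mulrC. Qed.

Lemma dotDr u v w : dot u (v + w) = dot u v + dot u w.
Proof. by rewrite -big_split; apply: eq_bigr => i _; rewrite mxE mulrDr. Qed.

Lemma dotZr (a : R) u v : dot u (a *: v) = a * dot u v.
Proof. by rewrite mulr_sumr; apply: eq_bigr => i _; rewrite mxE mulrCA. Qed.

Lemma dotDl u v w : dot (u + v) w = dot u w + dot v w.
Proof. by rewrite dotC dotDr !(dotC w). Qed.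

Lemma dotZl (a : R) u v : dot (a *: u) v = a * dot u v.
Proof. by rewrite dotC dotZr dotC. Qed.

Lemma dotBr u v w : dot u (v - w) = dot u v - dot u w.
Proof. by rewrite dotDr -scaleN1r dotZr mulN1r. Qed.

Lemma dot_sumr (J : Type) (r : seq J) (f : J -> pt) u :
  dot u (\sum_(j <- r) f j) = \sum_(j <- r) dot u (f j).
Proof.
elim: r => [|j r IHr]; last by rewrite !big_cons dotDr IHr.
by rewrite !big_nil; apply: big1 => i _; rewrite mxE mulr0.
Qed.

Lemma dot_suml (J : Type) (r : seq J) (f : J -> pt) u :
  dot (\sum_(j <- r) f j) u = \sum_(j <- r) dot (f j) u.
Proof. by rewrite dotC dot_sumr; apply: eq_bigr => j _; rewrite dotC. Qed.

Lemma dot_ge0 u : 0 <= dot u u.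
Proof. by apply: sumr_ge0 => i _; rewrite -expr2 sqr_ge0. Qed.

Lemma dot_eq0 u : dot u u = 0 -> u = 0.
Proof.
move=> /eqP; rewrite psumr_eq0; last by move=> i _; rewrite -expr2 sqr_ge0.
move=> /allP H; apply/rowP => i; have := H i (mem_index_enum _).
by rewrite implyTb mulf_eq0 orbb mxE => /eqP.
Qed.

Lemma enorm_ge0 u : 0 <= enorm u. Proof. exact: sqrtr_ge0. Qed.

Lemma enorm_sqr u : enorm u ^+ 2 = dot u u.
Proof. by rewrite sqr_sqrtr // dot_ge0. Qed.

Lemma enorm_gt0 u : u != 0 -> 0 < enorm u.
Proof.
move=> u0; rewrite lt_def enorm_ge0 andbT; apply: contra u0 => /eqP e0.
by apply/eqP/dot_eq0; rewrite -enorm_sqr e0 expr0n.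
Qed.

Lemma enormZ (a : R) u : enorm (a *: u) = `|a| * enorm u.
Proof. by rewrite /enorm dotZl dotZr mulrA -expr2 sqrtrM ?sqr_ge0 // sqrtr_sqr. Qed.

Lemma dot_CauchySchwarz u v : dot u v ^+ 2 <= dot u u * dot v v.
Proof.
apply: discriminant_le0 => [|t]; first exact: dot_ge0.
have -> : dot u u * t ^+ 2 + 2 * dot u v * t + dot v v = dot (t *: u + v) (t *: u + v).
  by rewrite dotDl !dotDr !dotZl !dotZr (dotC v u); ring.
exact: dot_ge0.
Qed.

Lemma dot_delta u i : dot u (delta_mx 0 i) = u 0 i.
Proof.
rewrite /dot (bigD1 i) //= mxE !eqxx mulr1 big1 ?addr0 // => j ji.
by rewrite mxE eqxx (negbTE ji) mulr0.
Qed.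

Lemma dot_eq u v : (forall e, dot u e = dot v e) -> u = v.
Proof. by move=> H; apply/rowP => i; rewrite -!dot_delta. Qed.

End Dot.

Section Barycentric.
Context {R : realType} {n : nat}.
Local Notation pt := 'rV[R]_n.+1.
Variable v : 'I_n.+2 -> pt.
Hypothesis nv : nondegenerate v.

Definition bcoord (x : pt) (i : 'I_n.+2) : R :=
  bary ((x - v ord0) *m invmx (edges v)) i.

(** Barycentric coordinates are affine functions, so that differences along the
    unit vectors are their partial derivatives. *)
Definition bgrad (i : 'I_n.+2) : pt :=
  \row_a (bcoord (delta_mx 0 a) i - bcoord 0 i).

Lemma sum_bcoord x : \sum_i bcoord x i = 1.
Proof. exact: sum_bary. Qed.

Lemma bcoordK x : \sum_i bcoord x i *: v i = x.
Proof.
have uE := nondegenerate_unit nv.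
by rewrite -bary_pointE mulmxKV // addrC subrK.
Qed.

Lemma bcoord_point (t : 'I_n.+2 -> R) : \sum_i t i = 1 ->
  bcoord (\sum_i t i *: v i) =1 t.
Proof.
move=> t1 i; have uE := nondegenerate_unit nv.
rewrite /bcoord.
have -> : \sum_i t i *: v i = v ord0 + (\row_j t (lift ord0 j)) *m edges v.
  by rewrite bary_pointE; apply: eq_bigr => j _; rewrite bary_of.
by rewrite addrC addKr mulmxK // bary_of.
Qed.

Lemma bcoord_vertex i k : bcoord (v k) i = (i == k)%:R.
Proof.
have {1}-> : v k = \sum_j (j == k)%:R *: v j.
  rewrite (bigD1 k) //= eqxx scale1r big1 ?addr0 // => j jk.
  by rewrite (negbTE jk) scale0r.
rewrite (bcoord_point (t := fun j => (j == k)%:R)) //.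
by rewrite (bigD1 k) //= eqxx big1 ?addr0 // => j jk; rewrite (negbTE jk).
Qed.

Lemma bary_affine m (s s' : 'rV[R]_m) (a : R) i :
  bary (a *: s + (1 - a) *: s') i = a * bary s i + (1 - a) * bary s' i.
Proof.
case: (unliftP ord0 i) => [j|] ->; first by rewrite !bary_lift !mxE.
rewrite !bary0 !mulrBr !mulr1 addrACA (addrC a) subrK -opprD; congr (_ - _).
by rewrite !mulr_sumr -big_split; apply: eq_bigr => j _; rewrite !mxE.
Qed.

Lemma bcoord_affine x y (a : R) i :
  bcoord (a *: x + (1 - a) *: y) i = a * bcoord x i + (1 - a) * bcoord y i.
Proof.
rewrite /bcoord -bary_affine; congr (bary _ _).
rewrite !scalemxAl -mulmxDl; congr (_ *m _).
by rewrite !scalerBr addrACA -opprD -scalerDl (addrC a) subrK scale1r.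
Qed.

Lemma bcoord_lin x i : bcoord x i = bcoord 0 i + dot (bgrad i) x.
Proof.
have lin y z : bcoord (y + z) i - bcoord 0 i =
    (bcoord y i - bcoord 0 i) + (bcoord z i - bcoord 0 i).
  have e1 := bcoord_affine (2 *: y) (2 *: z) 2^-1 i.
  have e2 := bcoord_affine (2 *: y) 0 2^-1 i.
  have e3 := bcoord_affine (2 *: z) 0 2^-1 i.
  have h : (1 - 2^-1 : R) = 2^-1 by field.
  move: e1 e2 e3; rewrite h !scalerA mulVf ?pnatr_eq0 // !scale1r scaler0 !addr0.
  by move=> -> -> ->; field.
have linZ (a : R) y : bcoord (a *: y) i - bcoord 0 i = a * (bcoord y i - bcoord 0 i).
  have := bcoord_affine y 0 a i; rewrite scaler0 addr0 => ->; ring.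
apply/eqP; rewrite addrC -subr_eq; apply/eqP.
rewrite {1}(row_sum_delta x).
have H (r : seq 'I_n.+1) : bcoord (\sum_(j <- r) x 0 j *: delta_mx 0 j) i - bcoord 0 i =
    \sum_(j <- r) bgrad i 0 j * x 0 j.
  elim: r => [|j r IHr]; first by rewrite !big_nil subrr.
  by rewrite !big_cons lin IHr linZ mxE mulrC.
exact: H.
Qed.

Lemma bcoordB x y i : bcoord x i - bcoord y i = dot (bgrad i) (x - y).
Proof. by rewrite (bcoord_lin x) (bcoord_lin y) dotBr; ring. Qed.

Lemma bgrad_edge i k l : dot (bgrad i) (v k - v l) = (i == k)%:R - (i == l)%:R.
Proof. by rewrite -bcoordB !bcoord_vertex. Qed.

Lemma sum_bgrad : \sum_i bgrad i = 0.
Proof.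
apply: dot_eq => e; rewrite dot_suml.
rewrite (eq_bigr (fun i => bcoord e i - bcoord 0 i)); last first.
  by move=> i _; rewrite bcoordB subr0.
rewrite sumrB !sum_bcoord subrr /dot big1 // => i _; by rewrite mxE mul0r.
Qed.

Lemma bgrad_expand e : e = \sum_k dot (bgrad k) e *: v k.
Proof.
have {1}-> : e = \sum_k bcoord e k *: v k - \sum_k bcoord 0 k *: v k.
  by rewrite !bcoordK subr0.
rewrite -sumrB.
by apply: eq_bigr => k _; rewrite -scalerBl bcoordB subr0.
Qed.

Lemma bgrad_neq0 i : bgrad i != 0.
Proof.
apply/negP => /eqP g0.
have [k ki] : exists k : 'I_n.+2, k != i.
  by exists (lift i ord0); rewrite eq_sym neq_lift.
have := bgrad_edge i i k; rewrite g0 eqxx eq_sym (negbTE ki) subr0.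
rewrite /dot big1; last by move=> j _; rewrite mxE mul0r.
by move=> /esym/eqP; rewrite oner_eq0.
Qed.

Lemma hullE (P : pred 'I_n.+2) x :
  hull v P x <-> (forall i, 0 <= bcoord x i) /\ (forall i, ~~ P i -> bcoord x i = 0).
Proof.
split=> [[t [t0 tP t1 ->]]|[x0 xP]].
  by split=> i; rewrite bcoord_point //; exact: tP.
by exists (bcoord x); split=> //; [exact: sum_bcoord|rewrite bcoordK].
Qed.

Lemma bcoord_facet i x : facet v i x -> bcoord x i = 0.
Proof. by move=> /hullE[_ H]; apply: H; rewrite /= negbK. Qed.

(** A vector orthogonal to a facet has the same product with all its vertices,
    which leaves a single term in its expansion over the vertices. *)
Lemma facet_normal_unique i nu :
  (forall x y, facet v i x -> facet v i y -> dot nu (x - y) = 0) ->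
  forall y, facet v i y -> nu = dot nu (v i - y) *: bgrad i.
Proof.
move=> H y hy; apply: dot_eq => e; rewrite dotZl.
have nuv k : k != i -> dot nu (v k) = dot nu y.
  move=> ki; apply/eqP; rewrite -subr_eq0 -dotBr; apply/eqP; apply: H => //.
  exact: vertex_hull.
have s0 : \sum_k dot (bgrad k) e = 0.
  by rewrite -dot_suml sum_bgrad /dot big1 // => j _; rewrite mxE mul0r.
rewrite {1}(bgrad_expand e) dot_sumr (bigD1 i) //= dotZr.
rewrite (eq_bigr (fun k => dot (bgrad k) e * dot nu y)); last first.
  by move=> k ki; rewrite dotZr nuv.
rewrite -mulr_suml dotBr; move: s0; rewrite (bigD1 i) //= => s0.
have -> : \sum_(k | k != i) dot (bgrad k) e = - dot (bgrad i) e by lra.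
ring.
Qed.

(** Barycentric coordinate i grows towards vertex i, so its gradient points
    inwards; hence the sign. *)
Lemma normal_bgrad i : normal v i = - (enorm (bgrad i))^-1 *: bgrad i.
Proof.
have g0 := enorm_gt0 (bgrad_neq0 i).
have [k0 k0i] : exists k : 'I_n.+2, k != i.
  by exists (lift i ord0); rewrite eq_sym neq_lift.
have Fk : facet v i (v k0) by exact: vertex_hull.
have ex : outward_unit_normal v i (- (enorm (bgrad i))^-1 *: bgrad i).
  split.
  - by rewrite enormZ normrN gtr0_norm ?invr_gt0 // mulVf // gt_eqF.
  - move=> x y hx hy; rewrite dotZl -bcoordB !bcoord_facet // subrr mulr0 //.
  - move=> x hx; rewrite dotZl -bcoordB bcoord_vertex eqxx bcoord_facet // subr0 mulr1.
    by rewrite oppr_lt0 invr_gt0.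
have := xgetPex 0 (ex_intro _ _ ex); rewrite -/(Defs.normal v i).
set nu := normal v i => -[nu1 nuo nun].
have E := facet_normal_unique nuo Fk.
have c0 := nun _ Fk; set c := dot nu _ in E c0.
move: nu1; rewrite E enormZ ltr0_norm // => c1.
congr (_ *: _); apply: oppr_inj; rewrite opprK.
by apply: (mulIf (lt0r_neq0 g0)); rewrite c1 mulVf // gt_eqF.
Qed.

Lemma enorm_normal i : enorm (normal v i) = 1.
Proof.
have g0 := enorm_gt0 (bgrad_neq0 i).
by rewrite normal_bgrad enormZ normrN gtr0_norm ?invr_gt0 // mulVf // gt_eqF.
Qed.

End Barycentric.

(** * Areas of facets *)
Section FacetArea.
Context {R : realType} {n : nat}.
Local Notation pt := 'rV[R]_n.+1.
Implicit Types (v : 'I_n.+2 -> pt) (i : 'I_n.+2).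

(** The numbering in which vertex i comes first, followed by its facet. *)
Definition apex_first i (k : 'I_n.+2) : 'I_n.+2 :=
  if unlift ord0 k is Some j then lift i j else i.

Lemma apex_first_inj i : injective (apex_first i).
Proof.
move=> k l; rewrite /apex_first.
case: (unliftP ord0 k) => [k'|] ->; case: (unliftP ord0 l) => [l'|] -> //.
- by move=> /lift_inj ->.
- by move/eqP; rewrite eq_sym (negbTE (neq_lift _ _)).
- by move/eqP; rewrite (negbTE (neq_lift _ _)).
Qed.

(** Let g be the gradient, a an edge from the apex to the facet and J the edges
    of the facet. Since g is orthogonal to J, the matrix with rows g and J has
    squared determinant |g|^2 det (J J^T); since a.g = -1, it is obtained from
    the matrix with rows a and J by an operation of determinant -|g|^2. *)
Lemma det_gram_facet v i : nondegenerate v ->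
  \det (edges (fun j => v (lift i j)) *m (edges (fun j => v (lift i j)))^T) =
  (`|\det (edges v)| * enorm (bgrad v i)) ^+ 2.
Proof.
move=> nv.
set J := edges (fun j => v (lift i j)).
have [dE _] := simplex_perm (@apex_first_inj i) nv (regular_on_cst v 0).
set Eu := edges (v \o apex_first i) in dE.
have uEu : Eu \in unitmx.
  exact/nondegenerate_unit/nondegenerate_perm/nv/apex_first_inj.
pose g := bgrad v i.
pose a : pt := v (lift i ord0) - v i.
pose B : 'M[R]_(n, n.+1) := \matrix_(j < n) (v (lift i (lift ord0 j)) - v i).
pose N : 'M[R]_(1 + n) := col_mx (a : 'M[R]_(1, 1 + n)) J.
pose L : 'M[R]_(1 + n) := block_mx (1%:M : 'M[R]_1) 0 (const_mx (-1)) 1%:M.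
have EuE : Eu = (col_mx (a : 'M[R]_(1, 1 + n)) B : 'M[R]_(1 + n)).
  apply/matrixP => k l; rewrite !mxE /apex_first /= unlift_none liftK.
  case: fintype.splitP => j /= kj.
    have -> : k = ord0 by apply: val_inj; rewrite /= kj ord1.
    by rewrite /a ord1 !mxE.
  have -> : k = lift ord0 j by apply: val_inj; rewrite /= kj.
  by rewrite /B !mxE.
have NE : N = L *m Eu.
  rewrite EuE mul_block_col !mul1mx mul0mx addr0; congr col_mx.
  apply/matrixP => k l; rewrite !mxE big_ord1 !mxE; ring.
have dN : `|\det N| = `|\det (edges v)|.
  by rewrite NE det_mulmx det_lblock !det1 !mul1r.
have uN : N \in unitmx.
  rewrite unitmxE unitfE -normr_eq0 dN normr_eq0 -unitfE -unitmxE.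
  exact: nondegenerate_unit.
have Jg : J *m g^T = 0.
  apply/matrixP => k l; rewrite !mxE ord1.
  have := bgrad_edge nv i (lift i (lift ord0 k)) (lift i ord0).
  rewrite !(negbTE (neq_lift _ _)) subrr dotC /dot => e; rewrite -[RHS]e.
  by apply: eq_bigr => j _; rewrite !mxE.
have ag : a *m g^T = - 1%:M.
  apply/matrixP => k l; rewrite !ord1 !mxE.
  have := bgrad_edge nv i (lift i ord0) i.
  rewrite eqxx (negbTE (neq_lift _ _)) sub0r dotC /dot => e; rewrite eqxx -[RHS]e.
  by apply: eq_bigr => j _; rewrite !mxE.
pose N' : 'M[R]_(1 + n) := col_mx (g : 'M[R]_(1, 1 + n)) J.
pose c : 'rV[R]_(1 + n) := g *m invmx N.
have gg : g *m g^T = (enorm g ^+ 2)%:M.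
  apply/matrixP => k l; rewrite !ord1 enorm_sqr !mxE eqxx.
  by apply: eq_bigr => j _; rewrite !mxE.
have cE : lsubmx c = - (enorm g ^+ 2)%:M.
  have : c *m N = g by rewrite mulmxKV.
  rewrite -[c]hsubmxK mul_row_col => /(congr1 (fun z => z *m g^T)).
  rewrite mulmxDl -!mulmxA Jg mulmx0 addr0 ag mulmxN mulmx1 row_mxKl gg => <-.
  by rewrite opprK.
have N'E : N' = block_mx (- (enorm g ^+ 2)%:M : 'M[R]_1) (rsubmx c) 0 1%:M *m N.
  rewrite mul_block_col mul0mx mul1mx add0r; congr col_mx.
  by rewrite -cE -mul_row_col hsubmxK mulmxKV.
have dN' : \det N' = - enorm g ^+ 2 * \det N.
  by rewrite N'E det_mulmx det_ublock det1 mulr1 -raddfN det_scalar1.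
have g0 : enorm g != 0 by rewrite gt_eqF // enorm_gt0 // bgrad_neq0.
have N'N' : N' *m N'^T = block_mx (enorm g ^+ 2)%:M 0 0 (J *m J^T).
  rewrite tr_col_mx mul_col_row gg Jg; congr block_mx.
  by apply: trmx_inj; rewrite trmx_mul trmxK Jg trmx0.
have := congr1 determinant N'N'; rewrite det_mulmx det_tr dN' det_ublock det_scalar1.
have cancel (x y z : R) : x != 0 -> x * y = x * z -> y = z by move=> x0; exact: mulfI.
move=> e; apply: (cancel (enorm g ^+ 2)); first by rewrite expf_neq0.
by rewrite -e -dN exprMn real_normK ?num_real //; ring.
Qed.

Lemma int_facet_bgrad v i f : nondegenerate v ->
  int_facet v i f =
  `|\det (edges v)| * enorm (bgrad v i) * sint (fun j => v (lift i j)) f.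
Proof.
move=> nv; rewrite int_facetE det_gram_facet // sqrtr_sqr ger0_norm //.
by rewrite mulr_ge0 // enorm_ge0.
Qed.

End FacetArea.

(** * Shape regularity *)
Section ShapeRegularity.
Context {R : realType} {n : nat}.
Local Notation pt := 'rV[R]_n.+1.
Implicit Types (v : 'I_n.+2 -> pt).

Lemma bcoord_le1 v (nv : nondegenerate v) x i :
  (forall j, 0 <= bcoord v x j) -> bcoord v x i <= 1.
Proof.
by move=> x0; rewrite -(sum_bcoord v x) (bigD1 i) //= lerDl sumr_ge0.
Qed.

Lemma simplexP v x : nondegenerate v ->
  simplex v x <-> forall i, 0 <= bcoord v x i.
Proof. by move=> nv; rewrite /simplex hullE //; split=> [[]|]. Qed.

Let ball_radii v : set R := [set 2 * r | r in [set r | 0 <= r /\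
    exists c, forall x, enorm (x - c) <= r -> simplex v x]].

(** The end points of the diameter of direction [bgrad v i] lie in the simplex,
    so that coordinate i changes by at most 1 between them. *)
Let ball_radii_ub v i : nondegenerate v ->
  ubound (ball_radii v) (enorm (bgrad v i))^-1.
Proof.
move=> nv _ [r [r0 [c cr]] <-].
have g0 := enorm_gt0 (bgrad_neq0 nv i); set g := bgrad v i in g0 *.
have on (e : R) : `|e| = 1 -> simplex v (c + (e * r / enorm g) *: g).
  move=> e1; apply: cr; rewrite addrAC subrr add0r enormZ normrM normrM e1 mul1r.
  by rewrite ger0_norm // ger0_norm ?invr_ge0 ?enorm_ge0 // divfK // gt_eqF.
have /(simplexP _ nv) p1 := on 1 (normr1 _).
have /(simplexP _ nv) p2 : simplex v (c + (-1 * r / enorm g) *: g).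
  by apply: on; rewrite normrN1.
have := lerB (bcoord_le1 nv i p1) (p2 i).
rewrite bcoordB // opprD addrACA subrr add0r -scalerBl dotZr -enorm_sqr subr0 -/g.
have -> : (1 * r / enorm g - -1 * r / enorm g) * enorm g ^+ 2 = 2 * r * enorm g.
  by field; rewrite gt_eqF.
by move=> h; rewrite -[leRHS]mul1r ler_pdivlMr.
Qed.

Lemma ball_diam_bgrad v i : nondegenerate v ->
  0 <= ball_diam (simplex v) /\ ball_diam (simplex v) * enorm (bgrad v i) <= 1.
Proof.
move=> nv; have g0 := enorm_gt0 (bgrad_neq0 nv i).
have B0 : ball_radii v 0.
  exists 0; last by rewrite mulr0.
  split=> //; exists (v ord0) => x; rewrite le_eqVlt ltNge enorm_ge0 orbF.
  move=> /eqP e0; have /dot_eq0/eqP : dot (x - v ord0) (x - v ord0) = 0.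
    by rewrite -enorm_sqr e0 expr0n.
  by rewrite subr_eq0 => /eqP ->; exact: vertex_hull.
have hs : has_sup (ball_radii v).
  by split; [exists 0|exists (enorm (bgrad v i))^-1; exact: ball_radii_ub].
split; first exact: (ub_le_sup hs.2 B0).
rewrite -ler_pdivlMr // mul1r.
by apply: ge_sup; [exists 0|exact: ball_radii_ub].
Qed.

Lemma diam_gt0 v : nondegenerate v -> 0 < diam (simplex v).
Proof.
move=> nv; pose S := [set r | exists x y, [/\ simplex v x, simplex v y & r = enorm (x - y)]].
have v01 : v ord0 - v (lift ord0 ord0) != 0.
  apply/negP => /eqP e; have := bgrad_edge nv ord0 ord0 (lift ord0 ord0).
  rewrite e eqxx (negbTE (neq_lift _ _)) subr0 /dot big1 => [|j _]; last by rewrite [X in _ * X]mxE mulr0.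
  by move/esym/eqP; rewrite oner_eq0.
apply: (lt_le_trans (enorm_gt0 v01)).
apply: (@ub_le_sup _ S); last first.
  by exists (v ord0), (v (lift ord0 ord0)); split=> //; exact: vertex_hull.
pose c a := \sum_k `|v k 0 a|.
have bd x a : simplex v x -> `|x 0 a| <= c a.
  move=> [t [t0 _ t1 ->]]; rewrite summxE (le_trans (ler_norm_sum _ _ _)) //.
  apply: ler_sum => k _; rewrite mxE normrM ler_piMl //.
  by rewrite ger0_norm // -t1 (bigD1 k) //= lerDl sumr_ge0.
exists (Num.sqrt (\sum_a (c a + c a) ^+ 2)) => _ [x [y [hx hy ->]]].
apply: ler_wsqrtr; apply: ler_sum => a _; rewrite -expr2 -real_normK ?num_real //.
rewrite ler_pXn2r ?nnegrE ?addr_ge0 ?sumr_ge0 // !mxE.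
by rewrite (le_trans (ler_normB _ _)) // lerD ?bd.
Qed.

(** The height of the simplex over facet i is the inverse of the length of the
    gradient, and it is at least the diameter of an inscribed ball. *)
Lemma shape_regular_bgrad (I : Type) (Th : I -> mesh R n) :
  (forall i (K : cell (Th i)), nondegenerate (vert (Th i) K)) ->
  shape_regular Th ->
  exists2 C : R, 0 <= C & forall i (K : cell (Th i)) j,
    hsize K * enorm (bgrad (vert (Th i) K) j) <= C.
Proof.
move=> nd [sigma Hs]; exists `|sigma| => // i K j.
have [b0 b1] := ball_diam_bgrad j (nd i K).
have := Hs i K; set b := ball_diam _ in b0 b1 *; set g := enorm _ in b1 *.
move=> h; apply: (@le_trans _ _ (`|sigma| * b * g)).
  by rewrite ler_wpM2r ?enorm_ge0 // (le_trans h) // ler_wpM2r // ler_norm.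
by rewrite -mulrA ler_piMr.
Qed.

End ShapeRegularity.

(** * The divergence theorem on a simplex *)
Section PolynomialDerivative.
Context {R : realType} {n : nat}.
Local Notation pt := 'rV[R]_n.+1.
Local Notation mpol := (mpoly n.+1 R).
Local Notation "''X[' m ]" := (@mpolyX n.+1 R m) (at level 8, format "''X[' m ]").

Lemma mnm_ind (P : multinom n.+1 -> Prop) :
  P (mnm0) -> (forall i m, P m -> P (mnm_add (mnm1 i) m)) -> forall m, P m.
Proof.
move=> P0 PS m; have [d] := ubnP (mdeg m); elim: d m => // d IHd m.
have [m0 _|m0] := eqVneq (mdeg m) 0%N.
  by move/eqP: m0; rewrite mdeg_eq0 => /eqP ->.
have [i mi] : exists i, (0 < m i)%N.
  apply/existsP; apply: contraNT m0; rewrite negb_exists => /forallP H.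
  rewrite mdeg_eq0; apply/eqP/mnmP => i; rewrite mnm0E; apply/eqP.
  by rewrite -leqn0 leqNgt.
have mE : m = mnm_add (mnm1 i) (mnm_sub m (mnm1 i)).
  apply/mnmP => j; rewrite mnmDE mnmBE mnm1E.
  by case: eqP => [<-|_]; rewrite ?subn0 //= subnKC.
by rewrite {1}mE mdegD mdeg1 add1n ltnS => md; rewrite mE; apply: PS; exact: IHd.
Qed.

Definition dir_deriv (p : mpol) (e x : pt) : R := \sum_i e 0 i * ev (mderiv i p) x.

Lemma is_derive_ev (p : mpol) (a e : pt) (t : R) :
  is_derive t 1 (fun t : R => ev p (a + t *: e)) (dir_deriv p e (a + t *: e)).
Proof.
pose D (q : mpol) := forall t : R,
  is_derive t 1 (fun t : R => ev q (a + t *: e)) (dir_deriv q e (a + t *: e)).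
suff : D p by apply.
have D1 (c : R) : D (mpolyC n.+1 c).
  move=> s; rewrite (_ : (fun t => _) = cst c); last first.
    by apply/funext => u; rewrite /ev mevalC.
  rewrite /dir_deriv big1; first exact: is_derive_cst.
  by move=> i _; rewrite mderivC /ev meval0 mulr0.
have DX i : D 'X[mnm1 i].
  move=> s; rewrite (_ : (fun t => _) = cst (a 0 i) + (e 0 i) \*: id); last first.
    by apply/funext => u; rewrite /ev mevalXU !mxE /= mulrC.
  apply: is_derive_eq; rewrite add0r /dir_deriv (bigD1 i) //= big1 ?addr0.
    rewrite mderivX mnm1E eqxx scale1r.
    have -> : mnm_sub (mnm1 i) (mnm1 i) = mnm0 :> multinom n.+1.
      by apply/mnmP => j; rewrite mnmBE mnm0E subnn.
    by rewrite mpolyX0 /ev meval1.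
  move=> j ji; rewrite mderivX mnm1E eq_sym (negbTE ji) scale0r /ev meval0.
  exact: mulr0.
have DM q r : D q -> D r -> D (q * r).
  move=> Dq Dr s; rewrite (_ : (fun t => _) =
      (fun t => ev q (a + t *: e)) * (fun t => ev r (a + t *: e))); last first.
    by apply/funext => u; rewrite /ev mevalM.
  apply: (is_derive_eq (is_deriveM (Dq s) (Dr s))).
  rewrite /dir_deriv !scaler_sumr -big_split; apply: eq_bigr => i _ /=.
  rewrite mderivM /ev mevalD !mevalM /GRing.scale /=; ring.
have DD q r : D q -> D r -> D (q + r).
  move=> Dq Dr s; rewrite (_ : (fun t => _) =
      (fun t => ev q (a + t *: e)) + (fun t => ev r (a + t *: e))); last first.
    by apply/funext => u; rewrite /ev mevalD.
  apply: (is_derive_eq (is_deriveD (Dq s) (Dr s))).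
  rewrite /dir_deriv -big_split; apply: eq_bigr => i _ /=.
  by rewrite mderivD /ev mevalD mulrDr.
elim/mpolyind: p => [|c m p _ _ Dp].
  by rewrite -(mpolyC0 n.+1 R); exact: D1.
apply: DD => //; rewrite -mul_mpolyC; apply: (DM) => //.
elim/mnm_ind: m => [|i m Dm]; first by rewrite mpolyX0; exact: (D1 1).
by rewrite mpolyXD; exact: DM.
Qed.

End PolynomialDerivative.

Section Divergence.
Context {R : realType} {n : nat}.
Local Notation mu := (@lebesgue_measure R).
Local Notation pt := 'rV[R]_n.+1.
Local Notation mpol := (mpoly n.+1 R).

Lemma Rintegral_ev_segment (p : mpol) (a e : pt) (L : R) : 0 <= L ->
  \int[mu]_t (dir_deriv p e (a + t *: e) * \1_(`[0, L] : set R) t) =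
  ev p (a + L *: e) - ev p a.
Proof.
move=> L0.
have -> : (fun t : measurableTypeR R => dir_deriv p e (a + t *: e) * \1_(`[0, L] : set R) t) =
    (fun t => dir_deriv p e (a + t *: e)) \_ (`[0, L]).
  by apply/funext => t; rewrite /patch indicE; case: ifPn => _; rewrite ?mulr1 ?mulr0.
rewrite -Rintegral_mkcond.
move: L0; rewrite le_eqVlt => /orP[/eqP <-|L0].
  by rewrite set_itv1 Rintegral_set1 scale0r addr0 subrr.
have dev (q : mpol) (t : R) : derivable (fun t : R => ev q (a + t *: e)) t 1.
  exact: (@ex_derive _ _ _ _ _ _ _ (is_derive_ev q a e t)).
have cev (q : mpol) : continuous (fun t : R => ev q (a + t *: e)).
  by move=> t; apply: differentiable_continuous; apply/derivable1_diffP; exact: dev.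
have cdd : continuous (fun t : R => dir_deriv p e (a + t *: e)).
  have -> : (fun t : R => dir_deriv p e (a + t *: e)) =
      (fun t : R => ev (\sum_i e 0 i *: mderiv i p) (a + t *: e)).
    apply/funext => t; rewrite /dir_deriv /ev raddf_sum; apply: eq_bigr => i _ /=.
    by rewrite mevalZ.
  exact: cev.
rewrite /Rintegral (@continuous_FTC2 _ _ (fun t => ev p (a + t *: e))) //.
- by rewrite scale0r addr0.
- exact: continuous_subspaceT.
- split.
  + by move=> t _; exact: dev.
  + by apply: cvg_at_right_filter; exact: cev.
  + by apply: cvg_at_left_filter; exact: cev.
- by move=> t _; rewrite derive1E; exact: (@derive_val _ _ _ _ _ _ _ (is_derive_ev p a e t)).
Qed.

Lemma indic_ref_row_mx m (t : R) (x : 'rV[R]_m) : ref_simplex x ->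
  \1_(@ref_simplex R m.+1) (row_mx (t%:M : 'rV_1) x : 'rV_m.+1) =
  \1_(`[0, 1 - \sum_j x 0 j] : set R) t :> R.
Proof.
move=> [x0 x1]; rewrite !indicE; congr (_ %:R); congr nat_of_bool.
have sE : \sum_j (row_mx (t%:M : 'rV_1) x : 'rV_m.+1) 0 j = t + \sum_j x 0 j.
  rewrite big_ord_recl row_mx_head; congr (_ + _).
  by apply: eq_bigr => j _; rewrite row_mx_tail.
apply/idP/idP; rewrite !inE /= in_itv /=.
  move=> [h0 h1]; have := h0 ord0; rewrite row_mx_head => -> /=.
  by rewrite lerBrDr -sE.
move=> /andP[t0 t1]; split; last by rewrite sE -lerBrDr.
by move=> j; case: (unliftP ord0 j) => [k|] ->; rewrite ?row_mx_tail ?row_mx_head.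
Qed.

Lemma indic_ref_row_mx0 m (t : R) (x : 'rV[R]_m) : ~ ref_simplex x ->
  \1_(@ref_simplex R m.+1) (row_mx (t%:M : 'rV_1) x : 'rV_m.+1) = 0 :> R.
Proof.
move=> hx; rewrite indicE; case: (boolP (_ \in _)) => //; rewrite inE => -[h0 h1].
exfalso; apply: hx; split=> [j|].
  by have := h0 (lift ord0 j); rewrite row_mx_tail.
have t0 := h0 ord0; rewrite row_mx_head in t0.
move: h1; rewrite big_ord_recl row_mx_head.
under eq_bigr do rewrite row_mx_tail.
by apply: le_trans; rewrite lerDr.
Qed.

Lemma regular_dir_deriv m (w : 'I_m.+1 -> pt) (p : mpol) (e : pt) : regular_on w (dir_deriv p e).
Proof.
apply: regular_on_sum => i; apply: regular_onM; first exact: regular_on_cst.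
exact: regular_on_ev.
Qed.

Definition i1 : 'I_n.+2 := lift ord0 ord0.

Lemma lift_i1_0 : lift i1 ord0 = ord0. Proof. exact: val_inj. Qed.

Lemma lift_i1_S (j : 'I_n) : lift i1 (lift ord0 j) = lift ord0 (lift ord0 j).
Proof. exact: val_inj. Qed.

(** The segments of the simplex that are parallel to the edge from vertex 0 to
    vertex 1 end on the facets opposite to these vertices. The fundamental
    theorem of calculus on each of them leaves the values at the end points,
    and both facets are parametrized by the remaining coordinates. *)
Lemma sint_dir_deriv01 (w : 'I_n.+2 -> pt) (p : mpol) :
  sint w (dir_deriv p (w i1 - w ord0)) =
  sint (fun j => w (lift ord0 j)) (ev p) - sint (fun j => w (lift i1 j)) (ev p).
Proof.
set e := w i1 - w ord0.
set w0 := fun j => w (lift ord0 j); set w1 := fun j => w (lift i1 j).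
have rd := regular_dir_deriv w p e.
rewrite /sint {1}/refint (lebint_Fubini (tame_ref (regular_on_ref rd))).
have pE t x : w ord0 + (row_mx (t%:M : 'rV_1) x : 'rV_n.+1) *m edges w =
    (w1 ord0 + x *m edges w1) + t *: e.
  have w10 : w1 ord0 = w ord0 by rewrite /w1 lift_i1_0.
  rewrite w10 mulmx_sum_row big_ord_recl row_mx_head rowK [t *: _ + _]addrC addrA.
  congr (_ + _ + _); rewrite mulmx_sum_row; apply: eq_bigr => j _.
  by rewrite row_mx_tail !rowK w10 /w1 lift_i1_S.
have p0E (x : 'rV[R]_n) : (w1 ord0 + x *m edges w1) + (1 - \sum_j x 0 j) *: e =
    w0 ord0 + x *m edges w0.
  have w10 : w1 ord0 = w ord0 by rewrite /w1 lift_i1_0.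
  have w00 : w0 ord0 = w ord0 + e by rewrite /w0 /e addrC subrK.
  have -> : x *m edges w0 = x *m edges w1 - (\sum_j x 0 j) *: e.
    rewrite !mulmx_sum_row scaler_suml -sumrB; apply: eq_bigr => j _.
    rewrite -scalerBr; congr (_ *: _).
    by rewrite !rowK w10 w00 /w1 lift_i1_S /w0 opprD addrA.
  rewrite scalerBl scale1r w10 w00; move: (x *m edges w1) (\sum_j x 0 j) => X c.
  by apply/rowP => k; rewrite !mxE; ring.
rewrite -[X in _ = _ - X]mul1r -mulNr -refintZ; last first.
  exact: (regular_on_ref (regular_on_ev w1 p)).
rewrite -refintD; last 2 first.
  exact: (regular_on_ref (regular_on_ev w0 p)).
  apply: ref_regularM; first exact/regular_ref_regular/regular_cst.
  exact: (regular_on_ref (regular_on_ev w1 p)).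
rewrite /refint; apply: eq_lebint => x; rewrite /head_int /slice mulN1r.
rewrite [in RHS]indicE; case: (boolP (x \in _)) => [|]; rewrite ?inE ?notin_setE => hx.
  rewrite mulr1 -p0E -Rintegral_ev_segment; last by rewrite subr_ge0; case: hx.
  by apply: eq_Rintegral => t _; rewrite pE indic_ref_row_mx.
rewrite mulr0.
have -> : (fun t : measurableTypeR R => dir_deriv p e
      (w ord0 + (row_mx (t%:M : 'rV_1) x : 'rV_n.+1) *m edges w) *
    \1_(@ref_simplex R n.+1) (row_mx (t%:M : 'rV_1) x : 'rV_n.+1)) = fun=> 0.
  by apply/funext => t; rewrite indic_ref_row_mx0 ?mulr0.
by rewrite /Rintegral integral0.
Qed.

End Divergence.

Section DivergenceTheorem.
Context {R : realType} {n : nat}.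
Local Notation pt := 'rV[R]_n.+1.
Local Notation mpol := (mpoly n.+1 R).
Implicit Types (v : 'I_n.+2 -> pt) (p : mpol) (i : 'I_n.+2).

Lemma sint_facet_perm v (s : 'I_n.+2 -> 'I_n.+2) k f : injective s ->
  regular_on (fun l => v (lift (s k) l)) f ->
  sint (fun l => v (s (lift k l))) f = sint (fun l => v (lift (s k) l)) f.
Proof.
move=> si rf; pose t (l : 'I_n.+1) := odflt ord0 (unlift (s k) (s (lift k l))).
have tE l : lift (s k) (t l) = s (lift k l).
  rewrite /t; case: (unliftP (s k) (s (lift k l))) => [j ->//|].
  by move=> /si /eqP; rewrite eq_sym (negbTE (neq_lift _ _)).
have ti : injective t.
  by move=> l l' /(congr1 (lift (s k))); rewrite !tE => /si /lift_inj.
rewrite -(sint_perm ti rf).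
by apply: eq_refint => y _; rewrite !bary_pointE; congr f; apply: eq_bigr => l _ /=; rewrite tE.
Qed.

Lemma sint_dir_deriv v p i j : i != j ->
  sint v (dir_deriv p (v i - v j)) =
  sint (fun l => v (lift j l)) (ev p) - sint (fun l => v (lift i l)) (ev p).
Proof.
move=> ij; pose a := tperm ord0 j (@i1 n).
pose s k := tperm a i (tperm ord0 j k).
have si : injective s by apply: inj_comp; exact: perm_inj.
have s0 : s ord0 = j.
  rewrite /s tpermL tpermD // /a -[X in _ != X](tpermL ord0 j) (inj_eq perm_inj).
  by rewrite eq_sym; exact: neq_lift.
have s1 : s (@i1 n) = i by rewrite /s -/a tpermL.
rewrite -(sint_perm si (regular_dir_deriv v p _)) -{1}s0 -{1}s1.
rewrite (sint_dir_deriv01 (v \o s) p) /=.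
rewrite (sint_facet_perm si (regular_on_ev _ p)) (sint_facet_perm si (regular_on_ev _ p)).
by rewrite s0 s1.
Qed.

(** A direction is a combination of the edges issued from vertex 0, with its
    products with the gradients as coefficients. Their sum over all the
    vertices is zero, so the facet opposite to vertex 0 receives its share too;
    |det| times a gradient is minus the normal times the area factor. *)
Lemma divergence_dir v p e : nondegenerate v ->
  int_simplex v (dir_deriv p e) =
  \sum_i dot e (normal v i) * int_facet v i (ev p).
Proof.
move=> nv; rewrite int_simplexE //; last exact: regular_dir_deriv.
pose S (i : 'I_n.+2) := sint (fun l : 'I_n.+1 => v (lift i l)) (ev p).
have g0 : \sum_i dot (bgrad v i) e = 0.
  by rewrite -dot_suml sum_bgrad // /dot big1 // => j _; rewrite mxE mul0r.
have -> : sint v (dir_deriv p e) = \sum_i dot (bgrad v i) e * (S ord0 - S i).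
  transitivity (sint v (fun x => \sum_i dot (bgrad v i) e * dir_deriv p (v i - v ord0) x)).
    apply: eq_sint => x _.
    have {1}-> : e = \sum_i dot (bgrad v i) e *: (v i - v ord0).
      under eq_bigr do rewrite scalerBr.
      by rewrite sumrB -scaler_suml g0 scale0r subr0 -bgrad_expand.
    rewrite /dir_deriv; under [RHS]eq_bigr do rewrite mulr_sumr.
    rewrite exchange_big; apply: eq_bigr => k _ /=.
    rewrite summxE mulr_suml; apply: eq_bigr => i _.
    by rewrite !mxE mulrA.
  rewrite sint_sum; last first.
    move=> i; apply: regular_onM; first exact: regular_on_cst.
    exact: regular_dir_deriv.
  apply: eq_bigr => i _; rewrite sintZ; last exact: regular_dir_deriv.
  congr (_ * _); have [->|i0] := eqVneq i ord0; last exact: sint_dir_deriv.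
  rewrite !subrr; transitivity (sint v (fun=> 0 * 0)).
    apply: eq_sint => x _; rewrite mul0r /dir_deriv big1 // => k _.
    by rewrite mxE mul0r.
  by rewrite sintZ ?mul0r //; exact: regular_on_cst.
have -> : \sum_i dot (bgrad v i) e * (S ord0 - S i) = - \sum_i dot (bgrad v i) e * S i.
  under eq_bigr do rewrite mulrBr.
  by rewrite sumrB -mulr_suml g0 mul0r sub0r.
rewrite mulrN mulr_sumr -sumrN; apply: eq_bigr => i _.
rewrite int_facet_bgrad // normal_bgrad // dotZr (dotC e) -/(S i).
have gi := enorm_gt0 (bgrad_neq0 nv i).
by field; rewrite gt_eqF.
Qed.

Lemma int_facetD v i f g : regular_on (fun j => v (lift i j)) f ->
  regular_on (fun j => v (lift i j)) g ->
  int_facet v i (fun x => f x + g x) = int_facet v i f + int_facet v i g.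
Proof. by move=> rf rg; rewrite !int_facetE sintD // mulrDr. Qed.

Lemma int_facetZ v i (c : R) f : regular_on (fun j => v (lift i j)) f ->
  int_facet v i (fun x => c * f x) = c * int_facet v i f.
Proof. by move=> rf; rewrite !int_facetE sintZ // mulrCA. Qed.

Lemma int_facet_sum v i (J : Type) (r : seq J) (f : J -> pt -> R) :
  (forall j, regular_on (fun l => v (lift i l)) (f j)) ->
  int_facet v i (fun x => \sum_(j <- r) f j x) = \sum_(j <- r) int_facet v i (f j).
Proof. by move=> rf; rewrite int_facetE sint_sum // mulr_sumr. Qed.

Lemma int_simplexD v f g : nondegenerate v -> regular_on v f -> regular_on v g ->
  int_simplex v (fun x => f x + g x) = int_simplex v f + int_simplex v g.
Proof.
by move=> nv rf rg; rewrite !int_simplexE // ?sintD ?mulrDr //; exact: regular_onD.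
Qed.

Lemma int_simplexZ v (c : R) f : nondegenerate v -> regular_on v f ->
  int_simplex v (fun x => c * f x) = c * int_simplex v f.
Proof.
move=> nv rf.
have rcf : regular_on v (fun x => c * f x).
  by apply: regular_onM rf; exact: regular_on_cst.
by rewrite (int_simplexE nv rcf) (int_simplexE nv rf) (sintZ c rf) mulrCA.
Qed.

Lemma int_simplex_sum v (J : Type) (r : seq J) (f : J -> pt -> R) :
  nondegenerate v -> (forall j, regular_on v (f j)) ->
  int_simplex v (fun x => \sum_(j <- r) f j x) = \sum_(j <- r) int_simplex v (f j).
Proof.
move=> nv rf; rewrite int_simplexE //; last exact: regular_on_sum.
by rewrite sint_sum // mulr_sumr; apply: eq_bigr => j _; rewrite int_simplexE.
Qed.

Lemma divergence_theorem v (P : 'I_n.+1 -> mpol) : nondegenerate v ->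
  int_simplex v (fun x => \sum_a ev (mderiv a (P a)) x) =
  \sum_i int_facet v i (fun x => \sum_a ev (P a) x * normal v i 0 a).
Proof.
move=> nv; rewrite int_simplex_sum //; last by move=> a; exact: regular_on_ev.
transitivity (\sum_a \sum_i normal v i 0 a * int_facet v i (ev (P a))).
  apply: eq_bigr => a _.
  transitivity (int_simplex v (dir_deriv (P a) (delta_mx 0 a))).
    congr int_simplex; apply/funext => x; rewrite /dir_deriv (bigD1 a) //= mxE !eqxx mul1r.
    by rewrite big1 ?addr0 // => b ba; rewrite mxE eqxx (negbTE ba) mul0r.
  rewrite divergence_dir //; apply: eq_bigr => i _.
  by rewrite dotC dot_delta.
rewrite exchange_big; apply: eq_bigr => i _ /=.
rewrite int_facet_sum; last first.
  by move=> a; apply: regular_onM; [exact: regular_on_ev|exact: regular_on_cst].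
apply: eq_bigr => a _; rewrite -int_facetZ; last exact: regular_on_ev.
by congr int_facet; apply/funext => x; rewrite mulrC.
Qed.

End DivergenceTheorem.

(** * Comparison of quadratic forms *)
Section QuadraticForms.
Context {R : realType} {V : lmodType R}.
Variables (G H : V -> V -> R).

Definition psd_form (B : V -> V -> R) : Prop :=
  [/\ forall x y, B x y = B y x,
      forall (a : R) x y z, B (a *: x + y) z = a * B x z + B y z &
      forall x, 0 <= B x x].

Section Form.
Variable B : V -> V -> R.
Hypothesis hB : psd_form B.

Lemma formDl x y z : B (x + y) z = B x z + B y z.
Proof. by case: hB => _ L _; have := L 1 x y z; rewrite scale1r mul1r. Qed.

Lemma form0l z : B 0 z = 0.
Proof.
case: hB => _ L _; have := L (-1) 0 0 z.
by rewrite scaler0 addr0 mulN1r addNr.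
Qed.

Lemma formZl (a : R) x z : B (a *: x) z = a * B x z.
Proof. by case: hB => _ L _; have := L a x 0 z; rewrite addr0 form0l addr0. Qed.

Lemma formC x y : B x y = B y x. Proof. by case: hB. Qed.

Lemma formDr x y z : B x (y + z) = B x y + B x z.
Proof. by rewrite formC formDl !(formC x). Qed.

Lemma formZr (a : R) x z : B x (a *: z) = a * B x z.
Proof. by rewrite formC formZl formC. Qed.

Lemma form_CauchySchwarz x y : B x y ^+ 2 <= B x x * B y y.
Proof.
apply: discriminant_le0 => [|t]; first by case: hB.
have -> : B x x * t ^+ 2 + 2 * B x y * t + B y y = B (t *: x + y) (t *: x + y).
  by rewrite formDl !formDr !formZl !formZr (formC y x); ring.
by case: hB.
Qed.

Lemma form_sqrD x y : B (x + y) (x + y) <= 2 * B x x + 2 * B y y.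
Proof.
have : 0 <= B (x + -1 *: y) (x + -1 *: y) by case: hB.
rewrite !formDl !formDr !formZl !formZr (formC y x); lra.
Qed.

End Form.

Hypotheses (hG : psd_form G) (hH : psd_form H).
Hypothesis kerGH : forall x, G x x = 0 -> H x x = 0.

Fixpoint in_span (es : seq V) (x : V) : Prop :=
  if es is e :: es' then exists (a : R) y, in_span es' y /\ x = y + a *: e else x = 0.

Lemma in_spanP es (a : R) x y : in_span es x -> in_span es y -> in_span es (a *: x + y).
Proof.
elim: es x y => [|e es IH] x y /=; first by move=> -> ->; rewrite scaler0 addr0.
move=> [b [x' [hx ->]]] [c [y' [hy ->]]].
exists (a * b + c), (a *: x' + y'); split; first exact: IH.
by rewrite scalerDr scalerA scalerDl addrACA.
Qed.

(** Orthogonalization for [G]: a new vector is replaced by its component r that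
    is [G]-orthogonal to the previous span. If [G r r = 0], then [H r r = 0]
    and nothing is added; otherwise the quotient of the two is a bound on the
    new line. The orthogonal projection on the left of the conjunction is what
    the next step of the induction needs. *)
Lemma in_span_dominated es :
  (forall e, exists2 p, in_span es p & forall y, in_span es y -> G (e - p) y = 0) /\
  (exists2 C, 0 <= C & forall y, in_span es y -> H y y <= C * G y y).
Proof.
elim: es => [|e es [IHp [C C0 IHC]]] /=.
  split=> [e|]; first by exists 0 => // y ->; rewrite (formC hG) (form0l hG).
  by exists 0 => // y ->; rewrite (form0l hH) mul0r.
have [pe hpe oe] := IHp e; pose r := e - pe; pose g := G r r.
have r_orth y : in_span es y -> G r y = 0 by exact: oe.
have decomp (a : R) y : y + a *: e = (a *: pe + y) + a *: r.
  by rewrite /r scalerBr [a *: pe + y]addrC -addrA; congr (_ + _); rewrite addrC subrK.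
have in_W (a : R) y : in_span es y -> in_span es (a *: pe + y) by exact: in_spanP.
split.
  move=> f; have [pf hpf of_] := IHp f.
  have [b bP] : exists b, G (f - pf) r = b * g.
    have [g0|g0] := eqVneq g 0; last by exists (G (f - pf) r / g); rewrite divfK.
    exists 0; rewrite mul0r; apply/eqP; rewrite -sqrf_eq0 eq_le sqr_ge0 andbT.
    by rewrite (le_trans (form_CauchySchwarz hG _ _)) // -/g g0 mulr0.
  exists (pf + b *: r).
    exists b, (- b *: pe + pf); split; first exact: in_spanP.
    rewrite /r scalerBr scaleNr [- _ + pf]addrC -[RHS]addrA; congr (_ + _); exact: addrC.
  move=> _ [a [y [hy ->]]]; rewrite decomp.
  move: (in_W a y hy); move: (a *: pe + y) => z hz.
  have -> : f - (pf + b *: r) = (f - pf) + (- b) *: r by rewrite scaleNr opprD addrA.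
  rewrite (formDl hG) !(formDr hG) !(formZl hG) !(formZr hG).
  by rewrite of_ // r_orth // bP -/g; ring.
pose C' := H r r / g.
have HrC : H r r <= C' * g.
  have [g0|g0] := eqVneq g 0; last by rewrite /C' divfK.
  by rewrite kerGH // g0 mulr0.
have gge0 : 0 <= g by case: hG => _ _ h; exact: h.
have C'0 : 0 <= C' by rewrite divr_ge0 //; case: hH.
exists (2 * C + 2 * C') => [|_ [a [y [hy ->]]]]; first by lra.
rewrite decomp; move: (in_W a y hy); move: (a *: pe + y) => z hz.
apply: (le_trans (form_sqrD hH _ _)).
rewrite (formDl hG) !(formDr hG) !(formZl hG) !(formZr hG) (formC hG z) r_orth //.
rewrite !(formZl hH) !(formZr hH) -/g.
have Gz : 0 <= G z z by case: hG => _ _ h; exact: h.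
have := IHC _ hz.
have aa : 0 <= a * a by rewrite -expr2 sqr_ge0.
have e1 : a * (a * H r r) <= a * a * (C' * g) by rewrite [leLHS]mulrA; apply: ler_wpM2l.
have e2 : 0 <= C' * G z z by rewrite mulr_ge0.
have e3 : 0 <= C * (a * a * g) by apply: mulr_ge0 => //; exact: mulr_ge0.
nra.
Qed.

End QuadraticForms.

(** A compactness-free form of the equivalence of norms in finite dimension. *)
Lemma form_dominated {R : realType} (T : finType) (G H : {ffun T -> R^o} -> {ffun T -> R^o} -> R) :
  psd_form G -> psd_form H -> (forall x, G x x = 0 -> H x x = 0) ->
  exists2 C, 0 <= C & forall x, H x x <= C * G x x.
Proof.
move=> hG hH k; pose d (a : T) : {ffun T -> R^o} := [ffun b => (b == a)%:R].
have [_ [C C0 HC]] := in_span_dominated hG hH k [seq d a | a <- index_enum T].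
exists C => // x; apply: HC.
have -> : x = \sum_a x a *: d a.
  apply/ffunP => b; rewrite sum_ffunE (bigD1 b) //= big1 ?addr0.
    by rewrite !ffunE eqxx [_ *: _]mulr1.
  by move=> a ab; rewrite !ffunE eq_sym (negbTE ab) scaler0.
elim: (index_enum T) => [|a s IH] /=; first by rewrite big_nil.
by rewrite big_cons; exists (x a), (\sum_(j <- s) x j *: d j); rewrite addrC.
Qed.

(** * The discrete trace inequality *)
Section HomogeneousPolynomials.
Context {R : realType}.

(** Monomials of degree k are written as words of k variables. Several words
    give the same monomial; this redundancy makes products simple, and it does
    no harm because the forms compared below need only be semidefinite. *)
Fixpoint mono_idx (N k : nat) : finType :=
  if k is k'.+1 then ('I_N * mono_idx N k')%type else unit.

Fixpoint mono (N k : nat) : mono_idx N k -> ('I_N -> R) -> R :=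
  match k return mono_idx N k -> ('I_N -> R) -> R with
  | 0%N => fun _ _ => 1
  | k'.+1 => fun a l => l a.1 * mono a.2 l
  end.

Definition hom_eval N k (c : {ffun mono_idx N k -> R^o}) (l : 'I_N -> R) : R :=
  \sum_a c a * mono a l.

(** Barycentric coordinates add up to 1, which is used to raise each monomial
    to the degree k: a polynomial of degree at most k is a form of degree k in
    them, with coefficients in a fixed finite-dimensional space. *)
Definition hom_rep N k (f : ('I_N -> R) -> R) : Prop :=
  exists c : {ffun mono_idx N k -> R^o},
    forall l, \sum_i l i = 1 -> f l = hom_eval c l.

Lemma eq_hom_rep N k (f g : ('I_N -> R) -> R) :
  (forall l, \sum_i l i = 1 -> f l = g l) -> hom_rep k g -> hom_rep k f.
Proof. by move=> fg [c gc]; exists c => l l1; rewrite fg // gc. Qed.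

Lemma hom_repD N k (x : R) (f g : ('I_N -> R) -> R) : hom_rep k f -> hom_rep k g ->
  hom_rep k (fun l => x * f l + g l).
Proof.
move=> [c fc] [d gd]; exists [ffun a => x * c a + d a] => l l1.
rewrite fc // gd // /hom_eval mulr_sumr -big_split; apply: eq_bigr => a _ /=.
by rewrite ffunE mulrDl mulrA.
Qed.

Lemma hom_rep0 N k : hom_rep k (fun _ : 'I_N -> R => 0).
Proof.
exists [ffun=> 0] => l _; rewrite /hom_eval big1 // => a _.
by rewrite ffunE mul0r.
Qed.

Lemma hom_repM N k (b : 'I_N -> R) (f : ('I_N -> R) -> R) : hom_rep k f ->
  hom_rep k.+1 (fun l => (\sum_i b i * l i) * f l).
Proof.
move=> [c fc]; exists [ffun a : 'I_N * mono_idx N k => b a.1 * c a.2] => l l1.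
rewrite fc // /hom_eval big_distrlr /= pair_bigA /=; apply: eq_bigr => a _ /=.
by rewrite ffunE /=; ring.
Qed.

Lemma hom_repS N k (f : ('I_N -> R) -> R) : hom_rep k f -> hom_rep k.+1 f.
Proof.
move=> /(hom_repM (fun=> 1)); apply: eq_hom_rep => l l1.
by under eq_bigr do rewrite mul1r; rewrite l1 mul1r.
Qed.

Lemma hom_rep1 N k : hom_rep k (fun _ : 'I_N -> R => 1).
Proof.
elim: k => [|k IHk]; last exact: hom_repS.
exists [ffun=> 1] => l _; rewrite /hom_eval (big_pred1 tt) => [|[]] //.
by rewrite ffunE mul1r.
Qed.

Lemma hom_rep_sum N k (J : eqType) (r : seq J) (x : J -> R) (f : J -> ('I_N -> R) -> R) :
  (forall j, j \in r -> hom_rep k (f j)) ->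
  hom_rep k (fun l => \sum_(j <- r) x j * f j l).
Proof.
elim: r => [|j r IHr] H.
  by apply: (@eq_hom_rep _ _ _ (fun=> 0)) => [l _|]; [rewrite big_nil|exact: hom_rep0].
apply: (@eq_hom_rep _ _ _ (fun l => x j * f j l + \sum_(j <- r) x j * f j l)) => [l _|].
  by rewrite big_cons.
apply: hom_repD; first by apply: H; rewrite mem_head.
by apply: IHr => i ir; apply: H; rewrite inE ir orbT.
Qed.

Lemma hom_rep_ev n N k (w : 'I_N -> 'rV[R]_n.+1) (p : mpoly n.+1 R) : deg_le k p ->
  hom_rep k (fun l => ev p (\sum_i l i *: w i)).
Proof.
move=> dp.
apply: (@eq_hom_rep _ _ _ (fun l => \sum_(m <- msupp p)
    mcoeff m p * ev (mpolyX R m) (\sum_i l i *: w i))) => [l _|].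
  rewrite /ev mevalE; apply: eq_bigr => m _; congr (_ * _).
  by rewrite mevalX.
apply: hom_rep_sum => m mp.
have mk : (mdeg m <= k)%N.
  by rewrite -ltnS; apply: leq_trans dp; exact: msize_mdeg_lt.
move: m k mk {dp mp}; apply: mnm_ind => [|i m IHm] k.
  move=> _; apply: (eq_hom_rep _ (hom_rep1 N k)) => l _.
  by rewrite mpolyX0 /ev meval1.
rewrite mdegD mdeg1; case: k => // k; rewrite add1n ltnS => /IHm.
move=> /(hom_repM (fun j => w j 0 i)); apply: eq_hom_rep => l _.
rewrite mpolyXD /ev mevalM mevalXU; congr (_ * _).
by rewrite summxE; apply: eq_bigr => j _; rewrite mxE mulrC.
Qed.

Lemma hom_eval_lin N k (x : R) (c d : {ffun mono_idx N k -> R^o}) l :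
  hom_eval (x *: c + d) l = x * hom_eval c l + hom_eval d l.
Proof.
rewrite /hom_eval mulr_sumr -big_split; apply: eq_bigr => a _ /=.
by rewrite !ffunE mulrDl mulrA.
Qed.

Lemma regular_hom_eval N k m (c : {ffun mono_idx N k -> R^o}) (h : 'rV[R]_m -> 'I_N -> R) :
  (forall i, regular (fun s => h s i)) -> regular (fun s => hom_eval c (h s)).
Proof.
move=> hr; apply: regular_sum => a; apply: regularM; first exact: regular_cst.
elim: k a {c} => [|k IHk] a /=; first exact: regular_cst.
by apply: regularM => //; exact: IHk.
Qed.

Lemma continuous_sumr (T : topologicalType) (J : Type) (r : seq J) (f : J -> T -> R) :
  (forall j, continuous (f j)) -> continuous (fun x => \sum_(j <- r) f j x).
Proof.
move=> fc; elim: r => [|j r IHr] x.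
  by under eq_fun do rewrite big_nil; exact: cst_continuous.
under eq_fun do rewrite big_cons; exact: (continuousD (fc j x) (IHr x)).
Qed.

Lemma continuous_hom_eval N k (T : topologicalType) (c : {ffun mono_idx N k -> R^o})
    (h : T -> 'I_N -> R) :
  (forall i, continuous (fun s => h s i)) -> continuous (fun s => hom_eval c (h s)).
Proof.
move=> hc; apply: continuous_sumr => a x; apply: continuousM.
  exact: cst_continuous.
elim: k a {c} => [|k IHk] a /=; first exact: cst_continuous.
exact: (continuousM (hc _ x) (IHk _)).
Qed.

Lemma continuous_bary m i : continuous (fun s : 'rV[R]_m => bary s i).
Proof.
case: (unliftP ord0 i) => [j|] -> s.
  by under eq_fun do rewrite bary_lift; exact: coord_continuous.
under eq_fun do rewrite bary0; apply: continuousB; first exact: cst_continuous.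
by apply: continuous_sumr => j; exact: coord_continuous.
Qed.

End HomogeneousPolynomials.

Section Vanishing.
Context {R : realType}.

Lemma ref_simplex_convex m (s y : 'rV[R]_m) (e : R) : 0 <= e -> e <= 1 ->
  ref_simplex s -> ref_simplex y -> ref_simplex (e *: y + (1 - e) *: s).
Proof.
move=> e0 e1 /ref_simplexE hs /ref_simplexE hy; apply/ref_simplexE => i.
by rewrite bary_affine addr_ge0 // mulr_ge0 // subr_ge0.
Qed.

(** If q does not vanish at s, then |q| is bounded below near s, and shrinking
    towards s the cube of [ref_cube] gives a cube of the simplex in this
    neighbourhood, even when s lies on the boundary. *)
Lemma refint_sqr_eq0 m (q : 'rV[R]_m -> R) : regular q -> continuous q ->
  refint (fun s => q s * q s) = 0 -> forall s, ref_simplex s -> q s = 0.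
Proof.
move=> rq cq q0 s hs; apply/eqP; apply/negP => /negP qs.
pose d := `|q s| / 2.
have d0 : 0 < d by rewrite divr_gt0 // normr_gt0.
have [rho /= rho0 near_s] : exists2 rho : R, 0 < rho &
    forall y : 'rV[R]_m, (forall i, `|y 0 i - s 0 i| < rho) -> d <= `|q y|.
  have /cvgrPdist_lt /(_ d d0) /nbhs_ballP[rho /= rho0 H] := cq s.
  exists rho => // y ys.
  have : ball s rho y.
    by split=> // i j; rewrite ord1 /ball /= distrC; exact: ys.
  move=> /H /= h.
  have := lerB_dist (q s) (q y); rewrite /d in h *; lra.
pose a : R := m.+1%:R^-1.
have a0 : 0 < a by rewrite invr_gt0.
have a1 : a <= 1 by rewrite invf_le1 ?ler1n.
pose c : 'rV[R]_m := const_mx a.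
(* two points of the simplex differ by at most 2 in each coordinate, so that the
   shrunk cube stays within rho / 2 of s *)
pose e : R := Num.min (rho / 4) 1.
have e0 : 0 < e by rewrite lt_min ltr01 divr_gt0.
have e1 : e <= 1 by rewrite ge_min lexx orbT.
have erho : e <= rho / 4 by rewrite ge_min lexx.
have := @refint_gt0 _ m (fun s => q s * q s) (e *: c + (1 - e) *: s) (e * a ^+ 2) (d ^+ 2).
rewrite q0 ltxx => F; have /F : ref_regular (fun s => q s * q s).
  by apply: regular_ref_regular; exact: regularM.
move=> {}F; suff : false by []; apply: F.
- by move=> y _; rewrite -expr2 sqr_ge0.
- by rewrite mulr_gt0 // exprn_gt0.
- by rewrite exprn_gt0.
move=> y hy.
have [z yE] : exists z, y = e *: z + (1 - e) *: s.
  exists (e^-1 *: (y - (1 - e) *: s)).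
  by rewrite scalerA divff ?gt_eqF // scale1r subrK.
have hz i : `|z 0 i - a| <= a ^+ 2.
  have := hy i; rewrite {1}yE /c !mxE.
  rewrite (_ : _ - _ = e * (z 0 i - a)); last by ring.
  by rewrite normrM gtr0_norm // ler_pM2l.
split; first by rewrite yE; apply: ref_simplex_convex (ltW e0) e1 hs (ref_cube hz).
rewrite -expr2 -[leRHS]real_normK ?num_real // ler_pXn2r ?nnegrE ?(ltW d0) //.
apply: near_s => i; rewrite yE !mxE.
rewrite (_ : _ - _ = e * (z 0 i - s 0 i)); last by ring.
rewrite normrM gtr0_norm //.
have z1 : `|z 0 i| <= 1 by exact: (ref_simplex_bounded (ref_cube hz)).
have s1 : `|s 0 i| <= 1 by exact: ref_simplex_bounded.
have zs : `|z 0 i - s 0 i| <= 2 by rewrite (le_trans (ler_normB _ _)) //; lra.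
apply: (@le_lt_trans _ _ (rho / 4 * 2)); last by lra.
by rewrite ler_pM // ltW.
Qed.

End Vanishing.

Section Trace.
Context {R : realType} {n : nat}.
Local Notation pt := 'rV[R]_n.+1.

(** Barycentric coordinates with respect to the whole simplex of the point of
    facet i with parameter s. *)
Definition facet_bary (i : 'I_n.+2) (s : 'rV[R]_n) (j : 'I_n.+2) : R :=
  if unlift i j is Some l then bary s l else 0.

Lemma sum_facet_bary i s : \sum_j facet_bary i s j = 1.
Proof.
rewrite (bigD1_ord i) //= /facet_bary unlift_none add0r -(sum_bary s).
by apply: eq_bigr => l _; rewrite liftK.
Qed.

Lemma facet_bary_point i s (v : 'I_n.+2 -> pt) :
  \sum_j facet_bary i s j *: v j = \sum_l bary s l *: v (lift i l).
Proof.
rewrite (bigD1_ord i) //= /facet_bary unlift_none scale0r add0r.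
by apply: eq_bigr => l _; rewrite liftK.
Qed.

Lemma facet_bary_ge0 i s j : ref_simplex s -> 0 <= facet_bary i s j.
Proof. by move=> /ref_simplexE hs; rewrite /facet_bary; case: unliftP. Qed.

Definition hom_form m k (h : 'rV[R]_m -> 'I_n.+2 -> R)
    (c d : {ffun mono_idx n.+2 k -> R^o}) : R :=
  refint (fun s => hom_eval c (h s) * hom_eval d (h s)).

Lemma psd_hom_form m k (h : 'rV[R]_m -> 'I_n.+2 -> R) :
  (forall i, regular (fun s => h s i)) -> psd_form (hom_form (k := k) h).
Proof.
move=> hr.
have rM (c d : {ffun mono_idx n.+2 k -> R^o}) :
    ref_regular (fun s => hom_eval c (h s) * hom_eval d (h s)).
  by apply: regular_ref_regular; apply: regularM; exact: regular_hom_eval.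
split=> [c d|a c d e|c].
- by apply: eq_refint => s _; rewrite mulrC.
- rewrite /hom_form -refintZ // -refintD //.
    by apply: eq_refint => s _; rewrite hom_eval_lin; ring.
  by apply: ref_regularM => //; exact/regular_ref_regular/regular_cst.
- by apply: refint_ge0 => s _; rewrite -expr2 sqr_ge0.
Qed.

Lemma regular_facet_bary i j : regular (fun s : 'rV[R]_n => facet_bary i s j).
Proof.
by rewrite /facet_bary; case: (unliftP i j) => [l|] _; [exact: regular_bary|exact: regular_cst].
Qed.

(** Both sides are quadratic forms in the coefficients of the polynomial in
    barycentric coordinates, and these forms do not depend on v. A polynomial
    with zero integral of its square vanishes on the simplex, hence on its
    facets, so that [form_dominated] applies. *)
Lemma trace_facet k (i : 'I_n.+2) : exists2 C : R, 0 <= C &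
  forall (v : 'I_n.+2 -> pt) (p : mpoly n.+1 R), deg_le k p ->
    sint (fun l => v (lift i l)) (fun x => ev p x ^+ 2) <= C * sint v (fun x => ev p x ^+ 2).
Proof.
pose G := hom_form (k := k) (@bary R n.+1).
pose H := hom_form (k := k) (facet_bary i).
have hG : psd_form G by apply: psd_hom_form => j; exact: regular_bary.
have hH : psd_form H by apply: psd_hom_form => j; exact: regular_facet_bary.
have ker c : G c c = 0 -> H c c = 0.
  move=> G0; have H0 s : ref_simplex s -> hom_eval c (facet_bary i s) = 0.
    move=> hs.
    have -> : facet_bary i s = bary (\row_j facet_bary i s (lift ord0 j)).
      by apply/funext => j; rewrite bary_of // sum_facet_bary.
    apply: (@refint_sqr_eq0 _ _ (fun y => hom_eval c (bary y))) => //.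
    - by apply: regular_hom_eval => j; exact: regular_bary.
    - by apply: continuous_hom_eval => j; exact: continuous_bary.
    - apply/ref_simplexE => j; rewrite bary_of ?sum_facet_bary //.
      exact: facet_bary_ge0.
  rewrite /H /hom_form -[RHS](lebint0 n); apply: eq_lebint => s.
  rewrite -[RHS](mul0r (\1_(@ref_simplex R n) s)).
  apply: (@mul_indic_ref _ _ (fun s => hom_eval c (facet_bary i s) *
    hom_eval c (facet_bary i s)) (fun=> 0)) => /H0 ->; exact: mul0r.
have [C C0 HC] := form_dominated hG hH ker.
exists C => // v p /(hom_rep_ev v)[c pc].
have -> : sint v (fun x => ev p x ^+ 2) = G c c.
  by apply: eq_refint => s _; rewrite bary_pointE pc ?sum_bary.
have -> : sint (fun l => v (lift i l)) (fun x => ev p x ^+ 2) = H c c.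
  by apply: eq_refint => s _; rewrite bary_pointE -facet_bary_point pc ?sum_facet_bary.
exact: HC.
Qed.

Lemma trace_inequality k : exists2 C : R, 0 <= C &
  forall (v : 'I_n.+2 -> pt) (p : mpoly n.+1 R) (i : 'I_n.+2), nondegenerate v -> deg_le k p ->
    int_facet v i (fun x => ev p x ^+ 2) <=
    C * enorm (bgrad v i) * int_simplex v (fun x => ev p x ^+ 2).
Proof.
have /choice[C HC] : forall i : 'I_n.+2, exists C : R, 0 <= C /\
    forall (v : 'I_n.+2 -> pt) (p : mpoly n.+1 R), deg_le k p ->
    sint (fun l => v (lift i l)) (fun x => ev p x ^+ 2) <= C * sint v (fun x => ev p x ^+ 2).
  by move=> i; have [C C0 HC] := trace_facet k i; exists C.
exists (\sum_i C i) => [|v p i nv dp]; first by apply: sumr_ge0 => i _; case: (HC i).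
have [C0 /(_ v p dp) h] := HC i.
have S0 : 0 <= sint v (fun x => ev p x ^+ 2) by apply: sint_ge0 => x _; exact: sqr_ge0.
rewrite int_facet_bgrad // int_simplexE //; last first.
  by apply: regular_onM; exact: regular_on_ev.
have g0 := enorm_ge0 (bgrad v i).
rewrite [leRHS](_ : _ = `|\det (edges v)| * enorm (bgrad v i) *
  ((\sum_i C i) * sint v (fun x => ev p x ^+ 2))); last by ring.
apply: ler_wpM2l; first by rewrite mulr_ge0.
apply: (le_trans h); apply: ler_wpM2r => //.
by rewrite (bigD1 i) //= lerDl sumr_ge0 // => j _; case: (HC j).
Qed.

End Trace.

(** * Faces of a conforming mesh *)
Section FacetGeometry.
Context {R : realType} {n : nat}.
Local Notation pt := 'rV[R]_n.+1.
Implicit Types (v : 'I_n.+2 -> pt) (i j : 'I_n.+2).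

Lemma exists_between0 (d e : R) : 0 < d -> 0 < e -> exists t, [/\ 0 < t, t < d & t < e].
Proof.
move=> d0 e0; have m0 : 0 < Num.min d e by rewrite lt_min d0.
exists (Num.min d e / 2); split; first by rewrite divr_gt0.
  by rewrite (@lt_le_trans _ _ (Num.min d e)) ?ge_min ?lexx //; lra.
by rewrite (@lt_le_trans _ _ (Num.min d e)) ?ge_min ?lexx ?orbT //; lra.
Qed.

Lemma nbhs_segment (x e : pt) (B : set pt) : nbhs x B ->
  exists2 d : R, 0 < d & forall t : R, 0 < t -> t < d -> B (x + t *: e).
Proof.
move=> /nbhs_ballP[r /= r0 H].
have s0 : 0 < 1 + \sum_j `|e 0 j| by rewrite ltr_pwDl // sumr_ge0.
exists (r / (1 + \sum_j `|e 0 j|)) => [|t t0 td]; first by rewrite divr_gt0.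
apply: H; split=> // a b; rewrite ord1 /ball /= !mxE opprD addrA subrr add0r normrN.
rewrite normrM gtr0_norm //; move: td; rewrite ltr_pdivlMr //; apply: le_lt_trans.
apply: ler_wpM2l; first exact: ltW.
by rewrite (bigD1 b) //= addrCA lerDl addr_ge0 // sumr_ge0.
Qed.

Lemma continuous_bcoord v (nv : nondegenerate v) i : continuous (fun x => bcoord v x i).
Proof.
have -> : (fun x => bcoord v x i) = fun x => bcoord v 0 i + \sum_j bgrad v i 0 j * x 0 j.
  by apply/funext => x; rewrite bcoord_lin.
move=> x; apply: continuousD; first exact: cst_continuous.
apply: continuous_sumr => j y; apply: continuousM; first exact: cst_continuous.
exact: coord_continuous.
Qed.

Lemma nbhs_bcoord_gt0 v (nv : nondegenerate v) (P : pred 'I_n.+2) x :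
  (forall i, P i -> 0 < bcoord v x i) ->
  nbhs x [set y | forall i, P i -> 0 < bcoord v y i].
Proof.
move=> H.
apply: (@filter_forall _ _ (fun i => [set y | P i -> 0 < bcoord v y i]) (nbhs x)) => i.
have [Pi|nPi] := boolP (P i); last by apply: filterE => y.
have h : \forall y \near x, 0 < bcoord v y i.
  have c := @continuous_bcoord v nv i x.
  exact: (cvgr_gt (bcoord v x i) c 0 (H i Pi)).
by apply: filterS h => y hy _.
Qed.

Lemma interior_simplex v (nv : nondegenerate v) x :
  (forall i, 0 < bcoord v x i) -> interior (simplex v) x.
Proof.
move=> H; have h := @nbhs_bcoord_gt0 v nv predT x (fun i _ => H i).
apply: filterS h => y hy; apply/(simplexP _ nv) => i; exact/ltW/hy.
Qed.

Lemma closed_simplex v (nv : nondegenerate v) : closed (simplex v).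
Proof.
have -> : simplex v = \bigcap_(i in [set: 'I_n.+2]) [set x | 0 <= bcoord v x i].
  apply/seteqP; split=> x; first by move=> /(simplexP _ nv) H i _; exact: H.
  by move=> H; apply/(simplexP _ nv) => i; exact: H.
apply: closed_bigI => i _.
exact: (closed_comp (fun x _ => @continuous_bcoord v nv i x) (@closed_ge R 0)).
Qed.

Definition facet_center v i : pt := \sum_(l < n.+1) n.+1%:R^-1 *: v (lift i l).

Lemma bcoord_center v (nv : nondegenerate v) i k :
  bcoord v (facet_center v i) k = if k == i then 0 else n.+1%:R^-1.
Proof.
have -> : facet_center v i =
    \sum_k (if k == i then 0 else n.+1%:R^-1) *: v k.
  rewrite (bigD1_ord i) //= eqxx scale0r add0r; apply: eq_bigr => l _.
  by rewrite eq_sym (negbTE (neq_lift _ _)).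
rewrite (bcoord_point nv (t := fun k => if k == i then 0 else n.+1%:R^-1)) //.
rewrite (bigD1_ord i) //= eqxx add0r (eq_bigr (fun=> n.+1%:R^-1)).
  by rewrite sumr_const card_ord -[LHS]mulr_natr mulVf ?pnatr_eq0.
by move=> l _; rewrite eq_sym (negbTE (neq_lift _ _)).
Qed.

Lemma facetP v (nv : nondegenerate v) i x :
  facet v i x <-> (forall k, 0 <= bcoord v x k) /\ bcoord v x i = 0.
Proof.
rewrite /facet hullE //; split=> -[h0 h1]; split=> //.
  by apply: h1; rewrite /= negbK.
by move=> k; rewrite /= negbK => /eqP ->.
Qed.

Lemma facet_center_facet v (nv : nondegenerate v) i : facet v i (facet_center v i).
Proof.
apply/facetP => //; split=> [k|]; rewrite bcoord_center // ?eqxx //.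
by case: eqP => // _; rewrite invr_ge0 ler0n.
Qed.

Lemma facet_simplex v i : facet v i `<=` simplex v.
Proof. by apply: sub_hull => k _; exists k. Qed.

Lemma vertex_inj v : nondegenerate v -> injective v.
Proof.
move=> nv k l vkl; apply/eqP; have := bcoord_vertex nv k l.
by rewrite -vkl bcoord_vertex // eqxx; case: eqP => // _ /eqP; rewrite oner_eq0.
Qed.

Lemma facet_inj v : nondegenerate v -> injective (facet v).
Proof.
move=> nv i j fij; apply/eqP; apply/negP => /negP ij.
have : facet v i (v j) by apply: vertex_hull; rewrite /= eq_sym.
rewrite fij => /(facetP nv)[_]; rewrite bcoord_vertex // eqxx => /eqP.
by rewrite oner_eq0.
Qed.

Lemma facet_bgrad v v' i j : nondegenerate v -> nondegenerate v' ->
  facet v i = facet v' j -> forall y, facet v i y ->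
  bgrad v i = dot (bgrad v i) (v' j - y) *: bgrad v' j.
Proof.
move=> nv nv' F y hy; apply: (facet_normal_unique nv'); last by rewrite -F.
rewrite -F => a b /(facetP nv)[_ a0] /(facetP nv)[_ b0].
by rewrite -bcoordB // a0 b0 subrr.
Qed.

(** The gradients attached to the common facet are proportional. If the factor
    c were positive, both simplices would lie on the same side of the facet,
    and their interiors would meet near a point x of its relative interior. *)
Lemma opposite_normals v v' i j : nondegenerate v -> nondegenerate v' ->
  facet v i = facet v' j -> interior (simplex v) `&` interior (simplex v') = set0 ->
  normal v' j = - normal v i.
Proof.
move=> nv nv' F disj.
(* the midpoint of both centres is visibly in the relative interior of the facet
   for either numbering of its vertices *)
pose x := 2^-1 *: facet_center v i + (1 - 2^-1) *: facet_center v' j.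
have n1 : 0 < n.+1%:R^-1 :> R by rewrite invr_gt0.
have Fc := facet_center_facet nv i; have Fc' := facet_center_facet nv' j.
have h2 : (0 : R) < 1 - 2^-1 by lra.
have xv k : bcoord v x k = if k == i then 0 else bcoord v x k.
  case: eqP => // ->; rewrite bcoord_affine // bcoord_center // eqxx mulr0 add0r.
  by move: Fc'; rewrite -F => /(facetP nv)[_ ->]; rewrite mulr0.
have xv' k : bcoord v' x k = if k == j then 0 else bcoord v' x k.
  case: eqP => // ->; rewrite bcoord_affine // bcoord_center // eqxx mulr0 addr0.
  by move: Fc; rewrite F => /(facetP nv')[_ ->]; rewrite mulr0.
have xpos k : k != i -> 0 < bcoord v x k.
  move=> ki; rewrite bcoord_affine // bcoord_center // (negbTE ki).
  apply: ltr_pwDl; first by rewrite mulr_gt0 // invr_gt0.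
  apply: mulr_ge0; first exact: ltW.
  by move: Fc'; rewrite -F => /(facetP nv)[H _]; exact: H.
have xpos' k : k != j -> 0 < bcoord v' x k.
  move=> kj; rewrite bcoord_affine // addrC bcoord_center // (negbTE kj).
  apply: ltr_pwDl; first exact: mulr_gt0.
  apply: mulr_ge0; first by rewrite invr_ge0.
  by move: Fc; rewrite F => /(facetP nv')[H _]; exact: H.
have x0 : bcoord v x i = 0 by rewrite xv eqxx.
have x0' : bcoord v' x j = 0 by rewrite xv' eqxx.
have Fx : facet v i x.
  apply/facetP => //; split=> // k; have [->|/xpos/ltW//] := eqVneq k i.
  by rewrite x0.
have gE := facet_bgrad nv nv' F Fx.
set c := dot _ _ in gE.
have gx : dot (bgrad v i) (v i - x) = 1.
  by rewrite -bcoordB // bcoord_vertex // eqxx x0 subr0.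
have c0 : c != 0.
  by apply/eqP => c0; have := bgrad_neq0 nv i; rewrite gE c0 scale0r eqxx.
have [cn|cp] : c < 0 \/ 0 < c by move: c0; rewrite neq_lt => /orP.
  rewrite !normal_bgrad // gE enormZ ltr0_norm //.
  have g0' := enorm_gt0 (bgrad_neq0 nv' j).
  rewrite scalerA -scaleNr; congr (_ *: _); field.
  by rewrite gt_eqF // lt_eqF.
exfalso.
have [d d0 Hd] := nbhs_segment (v i - x) (nbhs_bcoord_gt0 nv' (P := predC1 j) xpos').
have [t [t0 td t1]] := exists_between0 d0 (@ltr01 R).
pose y := x + t *: (v i - x).
have yE : y = t *: v i + (1 - t) *: x.
  by rewrite /y scalerBr scalerBl scale1r addrCA.
suff : (interior (simplex v) `&` interior (simplex v')) y by rewrite disj.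
split; apply: interior_simplex => // k.
  rewrite yE bcoord_affine // bcoord_vertex //; have [->|ki] := eqVneq k i.
    by rewrite x0 mulr0 addr0 mulr1.
  by rewrite mulr0 add0r mulr_gt0 ?subr_gt0 // xpos.
have [->|kj] := eqVneq k j; last exact: (Hd t t0 td).
have -> : bcoord v' y j = bcoord v' y j - bcoord v' x j by rewrite x0' subr0.
rewrite bcoordB // /y addrAC subrr add0r dotZr mulr_gt0 //.
have : c * dot (bgrad v' j) (v i - x) = 1 by rewrite -dotZl -gE.
by move=> e; rewrite -(pmulr_rgt0 _ cp) e.
Qed.

Lemma bgrad_perm_facet v i (s : 'I_n.+2 -> 'I_n.+2) : nondegenerate v ->
  injective s -> s i = i -> bgrad (v \o s) i = bgrad v i.
Proof.
move=> nv si sii; have nu := nondegenerate_perm si nv.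
have F : facet (v \o s) i = facet v i.
  apply/seteqP; split; apply: sub_hull => k /= ki.
    by exists (s k) => //=; rewrite -[X in _ != X]sii (inj_eq si).
  exists (invF si k); last by rewrite /= f_invF.
  by rewrite /= -(inj_eq si) f_invF sii.
have Fc := facet_center_facet nu i.
rewrite (facet_bgrad nu nv F Fc) -{2}sii -[v (s i)]/((v \o s) i).
rewrite -bcoordB // bcoord_vertex // bcoord_center // !eqxx subr0 scale1r //.
Qed.

Lemma int_facet_perm v v' i j (s : 'I_n.+1 -> 'I_n.+1) f : nondegenerate v ->
  injective s -> (forall l, v' (lift j l) = v (lift i (s l))) ->
  regular_on (fun l => v (lift i l)) f ->
  int_facet v' j f = int_facet v i f.
Proof.
move=> nv si vs rf.
have E : (fun l => v' (lift j l)) = (fun l => v (lift i l)) \o s by apply/funext.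
rewrite !int_facetE E (sint_perm si rf); congr (Num.sqrt _ * _).
pose sg (k : 'I_n.+2) := if unlift i k is Some l then lift i (s l) else i.
have sgi : injective sg.
  move=> k l; rewrite /sg.
  case: (unliftP i k) => [k'|] ->; case: (unliftP i l) => [l'|] -> //.
  - by move=> /lift_inj/si ->.
  - by move/eqP; rewrite eq_sym (negbTE (neq_lift _ _)).
  - by move/eqP; rewrite (negbTE (neq_lift _ _)).
have E' : (fun l => v (lift i l)) \o s = (fun l => (v \o sg) (lift i l)).
  by apply/funext => l; rewrite /= /sg liftK.
have [dE _] := simplex_perm sgi nv (regular_on_cst v 0).
have sii : sg i = i by rewrite /sg unlift_none.
rewrite E' (det_gram_facet i (nondegenerate_perm sgi nv)) (det_gram_facet i nv).
by rewrite dE (bgrad_perm_facet nv sgi sii).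
Qed.

End FacetGeometry.

Section ConformingMesh.
Context {R : realType} {n : nat}.
Local Notation pt := 'rV[R]_n.+1.
Variables (Omega : set pt) (T : mesh R n).
Hypotheses (oO : open Omega) (hT : conforming_triangulation Omega T).

Let nd (K : cell T) : nondegenerate (vert T K). Proof. by case: hT. Qed.

Lemma shared_facet_normal (K K' : cell T) i j : (K, i) != (K', j) ->
  face K i = face K' j -> nrm K' j = - nrm K i.
Proof.
move=> neq F; have [KK|KK] := eqVneq K K'.
  subst K'; case/negP: neq; apply/eqP; congr (_, _).
  exact: (facet_inj (nd K)).
apply: opposite_normals => //; case: hT => _ _ H _.
exact: H.
Qed.

Lemma common_vertex (K K' : cell T) a : elt K' (vert T K a) ->
  exists b, vert T K a = vert T K' b.
Proof.
case: hT => _ _ _ H Ka.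
have Ka' : elt K (vert T K a) by exact: vertex_hull.
have : (elt K `&` elt K') (vert T K a) by [].
rewrite H => /(hullE (nd K))[_ /(_ a)]; rewrite bcoord_vertex // eqxx /=.
case: (boolP [exists b, vert T K a == vert T K' b]) => [/existsP[b /eqP ->] _|_ /(_ isT)].
  by exists b.
by move/eqP; rewrite oner_eq0.
Qed.

Lemma facet_elt (K : cell T) i : face K i `<=` elt K.
Proof. exact: facet_simplex. Qed.

Lemma shared_facet_int (K K' : cell T) i j f : K != K' ->
  face K i = face K' j ->
  regular_on (fun l => vert T K (lift i l)) f ->
  int_facet (vert T K') j f = int_facet (vert T K) i f.
Proof.
move=> KK F rf.
have /choice[s sP] : forall l, exists l', vert T K' (lift j l) = vert T K (lift i l').
  move=> l.
  have Fl : face K' j (vert T K' (lift j l)).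
    by apply: vertex_hull; rewrite /= eq_sym neq_lift.
  rewrite -F in Fl; have [a aP] := common_vertex (facet_elt Fl).
  case: (unliftP i a) aP => [l'|] -> aP; first by exists l'.
  move: Fl; rewrite aP => /(facetP (nd K))[_]; rewrite bcoord_vertex // eqxx => /eqP.
  by rewrite oner_eq0.
apply: (int_facet_perm (nd K) _ sP rf) => l l' sl.
have := sP l; rewrite sl -sP => /(vertex_inj (nd K')); exact: lift_inj.
Qed.

(** Just beyond x, outside K, there are points of the domain, which belong to
    other cells; the union of these is closed, so some other cell K' contains
    x. By conformity x is in the hull of the common vertices of K and K', and
    as its coordinates are positive at all the vertices of the facet, these are
    all common vertices. *)
Lemma relint_facet_shared (K : cell T) i x : Omega x ->
  bcoord (vert T K) x i = 0 -> (forall k, k != i -> 0 < bcoord (vert T K) x k) ->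
  exists K' j, [/\ K' != K & face K' j = face K i].
Proof.
move=> Ox xi xk; set v := vert T K in xi xk *.
case: (hT) => _ Hcov _ Hconf.
have eltK : elt K x.
  by apply/(simplexP _ (nd K)) => k; have [->|/xk/ltW//] := eqVneq k i; rewrite xi.
have [d d0 Hd] := nbhs_segment (x - v i) (open_nbhs_nbhs (conj oO Ox)).
pose U := \bigcup_(K' in [set K' : cell T | K' != K]) elt K'.
have cU : closed U.
  apply: closed_bigcup => [|K' _]; first exact: finite_finset.
  exact: (closed_simplex (nd K')).
have Ux : U x.
  apply: cU => B nB; have [e e0 He] := nbhs_segment (x - v i) nB.
  have [t [t0 td te]] := exists_between0 d0 e0.
  exists (x + t *: (x - v i)); split; last exact: He.
  have : closure Omega (x + t *: (x - v i)) by apply: subset_closure; exact: Hd.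
  rewrite -Hcov => -[K' _ K'y]; exists K' => //=; apply/negP => /eqP KK; subst K'.
  move: K'y => /(simplexP _ (nd K))/(_ i); rewrite leNgt => /negP; apply.
  have -> : bcoord v (x + t *: (x - v i)) i = bcoord v (x + t *: (x - v i)) i - bcoord v x i.
    by rewrite xi subr0.
  rewrite bcoordB addrAC subrr add0r dotZr -bcoordB xi.
  by rewrite (bcoord_vertex (nd K)) eqxx sub0r mulrN1 oppr_lt0.
have [K' /= KK K'x] := Ux.
have : (elt K `&` elt K') x by [].
rewrite Hconf => /(hullE (nd K))[_ Hcom].
have /choice[s sP] : forall l, exists b, v (lift i l) = vert T K' b.
  move=> l; have [/existsP[b /eqP e]|h] := boolP [exists b, v (lift i l) == vert T K' b].
    by exists b.
  have := xk (lift i l); rewrite eq_sym neq_lift => /(_ isT).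
  by rewrite Hcom ?ltxx.
have si : injective s.
  move=> l l' sl; have := sP l; rewrite sl -sP => /(vertex_inj (nd K)); exact: lift_inj.
have cs : #|codom s| = n.+1 by rewrite card_codom // card_ord.
have [j js] : exists j, j \notin codom s.
  apply/existsP; rewrite -negb_forall; apply/negP => /forallP H.
  have : (#|'I_n.+2| <= #|codom s|)%N.
    by apply: subset_leq_card; apply/fintype.subsetP => k _; exact: H.
  by rewrite cs card_ord ltnn.
have imE : codom s =i predC1 j.
  apply/subset_cardP; first by rewrite cs cardC1 card_ord.
  by apply/fintype.subsetP => k ks; rewrite inE; apply: contraNneq js => <-.
exists K', j; split=> //; apply/seteqP; split; apply: sub_hull => k /= kj.
  have : k \in codom s by rewrite imE inE.
  move=> /codomP[l ->]; exists (lift i l); last exact: (esym (sP l)).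
  by rewrite /= eq_sym neq_lift.
case: (unliftP i k) kj => [l|] -> => [_|]; last by rewrite eqxx.
exists (s l); last exact: sP.
by have := codom_f s l; rewrite imE inE.
Qed.

(** If a point of the facet were interior to the domain, so would be a nearby
    point moved towards the centre of the facet, hence relatively interior. *)
Lemma unshared_facet_bdry (K : cell T) i :
  (forall K' j, K' != K -> face K' j <> face K i) ->
  face K i `<=` bdry Omega.
Proof.
move=> H x Fx; case: (hT) => _ Hcov _ _; split.
  by rewrite -Hcov; exists K => //; exact: facet_elt Fx.
move=> iOx; set v := vert T K.
have [d d0 Hd] := nbhs_segment (facet_center v i - x) iOx.
have [t [t0 td t1]] := exists_between0 d0 (@ltr01 R).
have [x0 xi] := (facetP (nd K) i x).1 Fx.
pose y := t *: facet_center v i + (1 - t) *: x.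
have yE : y = x + t *: (facet_center v i - x).
  by rewrite /y scalerBr scalerBl scale1r addrCA.
have Oy : Omega y by rewrite yE; exact: Hd.
have yi : bcoord v y i = 0.
  by rewrite bcoord_affine (bcoord_center (nd K)) eqxx xi !mulr0 addr0.
have yk k : k != i -> 0 < bcoord v y k.
  move=> ki; rewrite bcoord_affine (bcoord_center (nd K)) (negbTE ki).
  apply: ltr_pwDl; first by rewrite mulr_gt0 // invr_gt0.
  by apply: mulr_ge0; [rewrite subr_ge0 ltW|exact: x0].
have [K' [j [KK F]]] := relint_facet_shared Oy yi yk.
exact: (H K' j KK F).
Qed.

Lemma facet_regular_on k (K : cell T) i (g : pt -> R) : face_poly k (face K i) g ->
  regular_on (fun l => vert T K (lift i l)) g.
Proof.
move=> [p _ gp]; apply: (@eq_regular_on _ _ _ _ _ (ev p)); last exact: regular_on_ev.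
by move=> x hx; apply: gp; rewrite /Defs.face /facet hull_lift.
Qed.

Lemma mesh_face (K : cell T) i : mesh_faces T (face K i).
Proof. by exists K, i. Qed.

(** The pairs (cell, facet) with the same face are matched by an involution
    [phi], which fixes the pairs whose face lies on the boundary. Matched
    contributions are opposite, because the integrand depends on the cell
    through the normal only, and those of the boundary vanish with [vb]; the
    sum is therefore its own opposite. *)
Lemma single_valued_flux k (qb : fscal) (vb : fvec) : Qbh k T qb -> Vbh Omega k T vb ->
  bnd_int (fun (K : cell T) i x =>
    qb (face K i) x * dot (vb (face K i) x) (nrm K i)) = 0.
Proof.
move=> hq hv.
pose c (p : cell T * 'I_n.+2) a := int_facet (vert T p.1) p.2
  (fun x => qb (face p.1 p.2) x * vb (face p.1 p.2) x 0 a).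
pose t (p : cell T * 'I_n.+2) : R := \sum_a nrm p.1 p.2 0 a * c p a.
have reg (p : cell T * 'I_n.+2) a : regular_on (fun l => vert T p.1 (lift p.2 l))
    (fun x => qb (face p.1 p.2) x * vb (face p.1 p.2) x 0 a).
  apply: regular_onM; first exact: (facet_regular_on (hq _ (mesh_face _ _))).
  exact: (facet_regular_on ((hv _ (mesh_face _ _)).1 a)).
transitivity (\sum_p t p).
  rewrite /bnd_int pair_bigA /=; apply: eq_bigr => -[K i] _ /=.
  rewrite /t; under [RHS]eq_bigr do rewrite -int_facetZ //.
  rewrite -int_facet_sum; last first.
    by move=> a; apply: regular_onM; [exact: regular_on_cst|exact: (reg (K, i))].
  congr int_facet; apply/funext => x; rewrite /dot mulr_sumr; apply: eq_bigr => a _ /=.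
  ring.
pose same (p q : cell T * 'I_n.+2) :=
  (q != p) && `[< face q.1 q.2 = face p.1 p.2 >].
have same_nrm p q : same p q -> nrm q.1 q.2 = - nrm p.1 p.2.
  case: p q => [K i] [K' j] /andP[qp /asboolP F]; apply: shared_facet_normal.
    by rewrite eq_sym.
  exact: esym.
have same_t p q : same p q -> t q = - t p.
  move=> pq; rewrite /t (same_nrm _ _ pq) -sumrN; apply: eq_bigr => a _.
  rewrite mxE mulNr; congr (- (_ * _)).
  case: p q pq => [K i] [K' j] /andP[/= qp /asboolP F]; rewrite /c /= F.
  have [KK|KK] := eqVneq K K'.
    by subst K'; have /(facet_inj (nd K)) -> := F.
  by apply: shared_facet_int => //; exact: (reg (K, i)).
pose phi p := if [pick q | same p q] is Some q then q else p.
have phi_t p : t (phi p) = - t p.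
  rewrite /phi; case: pickP => [q|nosame]; first exact: same_t.
  case: p nosame => K i nosame.
  have Fb : face K i `<=` bdry Omega.
    apply: unshared_facet_bdry => K' j KK F; have := nosame (K', j).
    by rewrite /same /= F asboolT // andbT xpair_eqE (negbTE KK).
  suff -> : t (K, i) = 0 by rewrite oppr0.
  rewrite /t big1 // => a _; rewrite /c /=.
  rewrite (_ : int_facet _ _ _ = int_facet (vert T K) i (fun=> 0 * 0)).
    by rewrite int_facetZ ?mul0r ?mulr0 //; exact: regular_on_cst.
  rewrite !int_facetE; congr (_ * _); apply: eq_sint => x hx.
  have Fx : face K i x by rewrite /Defs.face /facet hull_lift.
  by rewrite ((hv _ (mesh_face K i)).2 Fb) // mxE mulr0 mul0r.
(* a third pair with the same face would have both n and -n as its normal *)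
have phiK : involutive phi.
  move=> p; rewrite {2}/phi; case: pickP => [q pq|nosame]; last first.
    by rewrite /phi; case: pickP => // q; rewrite nosame.
  rewrite /phi; case: pickP => [r qr|/(_ p)]; last first.
    by case/andP: pq => qp /asboolP F; rewrite /same eq_sym qp F asboolT.
  apply/eqP; apply/negP => /negP rp.
  have pr : same p r.
    by rewrite /same rp; case/andP: pq => _ /asboolP <-; case/andP: qr.
  have := same_nrm _ _ qr; rewrite (same_nrm _ _ pq) opprK (same_nrm _ _ pr) => e.
  have n0 : nrm p.1 p.2 = 0.
    apply/rowP => a; have := congr1 (fun z : pt => z 0 a) e; rewrite /= !mxE; lra.
  have := enorm_normal (nd p.1) p.2; rewrite -/(nrm p.1 p.2) n0 /enorm /dot big1.
    by rewrite sqrtr0 => /esym/eqP; rewrite oner_eq0.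
  by move=> a _; rewrite mxE mul0r.
have e : \sum_p t p = - \sum_p t p.
  rewrite {1}(reindex_inj (inv_inj phiK)) -sumrN; apply: eq_bigr => p _.
  exact: phi_t.
lra.
Qed.

End ConformingMesh.

(** * Cauchy-Schwarz bounds *)
Section CauchySchwarz.
Context {R : realType}.
Implicit Types a b c : R.

(** |a| is at most the geometric mean of b and c. Such bounds are kept without
    square roots since they then add up term by term ([csboundD]), which is the
    Cauchy-Schwarz inequality for sums. *)
Definition csbound a b c : Prop := [/\ 0 <= b, 0 <= c & a ^+ 2 <= b * c].

Lemma csbound0 : csbound 0 0 0.
Proof. by split; rewrite ?lexx // expr0n mul0r. Qed.

Lemma csboundD a b c a' b' c' : csbound a b c -> csbound a' b' c' ->
  csbound (a + a') (b + b') (c + c').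
Proof.
move=> [b0 c0 h] [b0' c0' h']; split; try exact: addr_ge0.
have bc : 0 <= b * c' by exact: mulr_ge0.
have bc' : 0 <= b' * c by exact: mulr_ge0.
have aa : a * a' <= (b * c' + b' * c) / 2.
  apply: le_trans (ler_norm _) _.
  rewrite -(@ler_pXn2r _ 2) ?nnegrE //; last by rewrite divr_ge0 // addr_ge0.
  rewrite real_normK ?num_real // exprMn.
  apply: (@le_trans _ _ ((b * c) * (b' * c'))).
    by apply: ler_pM => //; exact: sqr_ge0.
  have := sqr_ge0 (b * c' - b' * c); set u := b * c'; set w := b' * c.
  have -> : b * c * (b' * c') = u * w by rewrite /u /w; ring.
  nra.
have -> : (a + a') ^+ 2 = a ^+ 2 + a' ^+ 2 + 2 * (a * a') by ring.
nra.
Qed.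

Lemma csbound_sum (J : Type) (r : seq J) (a b c : J -> R) :
  (forall j, csbound (a j) (b j) (c j)) ->
  csbound (\sum_(j <- r) a j) (\sum_(j <- r) b j) (\sum_(j <- r) c j).
Proof.
move=> H; elim: r => [|j r IHr]; first by rewrite !big_nil; exact: csbound0.
by rewrite !big_cons; exact: csboundD.
Qed.

Lemma csboundM (k x y : R) a b c : 0 <= x -> 0 <= y -> k ^+ 2 = x * y ->
  csbound a b c -> csbound (k * a) (x * b) (y * c).
Proof.
move=> x0 y0 kxy [b0 c0 h]; split; try exact: mulr_ge0.
rewrite exprMn kxy [leRHS]mulrACA; apply: ler_wpM2l => //; exact: mulr_ge0.
Qed.

Lemma csbound_norm (C : R) t b c X Y : 0 <= C -> csbound t b c ->
  b <= C * X -> c <= C * Y -> `|t| <= C * (Num.sqrt X * Num.sqrt Y).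
Proof.
move=> C0 [b0 c0 h] bX cY; rewrite -sqrtr_sqr.
apply: (@le_trans _ _ (Num.sqrt ((C * X) * (C * Y)))).
  by apply: ler_wsqrtr; apply: (le_trans h); exact: ler_pM.
rewrite sqrtrM ?(le_trans b0) // !sqrtrM // mulrACA -expr2 sqr_sqrtr //.
Qed.

End CauchySchwarz.

Section LocalCauchySchwarz.
Context {R : realType} {n : nat}.
Local Notation pt := 'rV[R]_n.+1.

Lemma csbound_sint m (w : 'I_m.+1 -> pt) (f g : pt -> R) :
  regular_on w f -> regular_on w g ->
  csbound (sint w (fun x => f x * g x)) (sint w (fun x => f x ^+ 2))
          (sint w (fun x => g x ^+ 2)).
Proof.
by move=> rf rg; split; [apply: sint_ge0 => x _; exact: sqr_ge0..|exact: sint_CauchySchwarz].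
Qed.

Lemma regular_onX2 m (w : 'I_m.+1 -> pt) (f : pt -> R) :
  regular_on w f -> regular_on w (fun x => f x ^+ 2).
Proof. by move=> rf; exact: regular_onM. Qed.

Lemma csbound_sint_sum m (w : 'I_m.+1 -> pt) (J : finType) (f g : J -> pt -> R) :
  (forall j, regular_on w (f j)) -> (forall j, regular_on w (g j)) ->
  csbound (sint w (fun x => \sum_j f j x * g j x))
          (sint w (fun x => \sum_j f j x ^+ 2)) (sint w (fun x => \sum_j g j x ^+ 2)).
Proof.
move=> rf rg; rewrite !sint_sum; first by apply: csbound_sum => j; exact: csbound_sint.
all: by move=> j; first [exact: regular_onX2|exact: regular_onM].
Qed.

End LocalCauchySchwarz.

Section MeshIntegrals.
Context {R : realType} {n : nat}.
Local Notation pt := 'rV[R]_n.+1.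
Variable T : mesh R n.
Hypothesis nd : forall K : cell T, nondegenerate (vert T K).

Definition cell_regular (f : cell T -> pt -> R) : Prop :=
  forall K, regular_on (vert T K) (f K).

Definition facet_regular (f : cell T -> 'I_n.+2 -> pt -> R) : Prop :=
  forall K (i : 'I_n.+2), regular_on (fun l => vert T K (lift i l)) (f K i).

Lemma cell_intD f g : cell_regular f -> cell_regular g ->
  cell_int (fun K x => f K x + g K x) = cell_int f + cell_int g.
Proof.
move=> rf rg; rewrite /cell_int -big_split; apply: eq_bigr => K _ /=.
by rewrite int_simplexD.
Qed.

Lemma cell_intZ (c : R) f : cell_regular f ->
  cell_int (fun K x => c * f K x) = c * cell_int f.
Proof.
move=> rf; rewrite /cell_int mulr_sumr; apply: eq_bigr => K _ /=.
by rewrite int_simplexZ.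
Qed.

Lemma bnd_intD f g : facet_regular f -> facet_regular g ->
  bnd_int (fun K i x => f K i x + g K i x) = bnd_int f + bnd_int g.
Proof.
move=> rf rg; rewrite /bnd_int -big_split; apply: eq_bigr => K _ /=.
by rewrite -big_split; apply: eq_bigr => i _; rewrite int_facetD.
Qed.

Lemma bnd_intZ (c : R) f : facet_regular f ->
  bnd_int (fun K i x => c * f K i x) = c * bnd_int f.
Proof.
move=> rf; rewrite /bnd_int mulr_sumr; apply: eq_bigr => K _ /=.
by rewrite mulr_sumr; apply: eq_bigr => i _; rewrite int_facetZ.
Qed.

Lemma eq_cell_int (f g : cell T -> pt -> R) : (forall K x, f K x = g K x) ->
  cell_int f = cell_int g.
Proof. by move=> fg; congr cell_int; apply/funext => K; apply/funext => x. Qed.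

Lemma eq_bnd_int (f g : cell T -> 'I_n.+2 -> pt -> R) :
  (forall K i x, f K i x = g K i x) -> bnd_int f = bnd_int g.
Proof.
by move=> fg; congr bnd_int; apply/funext => K; apply/funext => i; apply/funext => x.
Qed.

Lemma cell_int_ge0 (f : cell T -> pt -> R) : cell_regular f ->
  (forall K x, 0 <= f K x) -> 0 <= cell_int f.
Proof.
move=> rf f0; apply: sumr_ge0 => K _; rewrite int_simplexE //.
by rewrite mulr_ge0 // sint_ge0.
Qed.

Lemma bnd_int_ge0 (f : cell T -> 'I_n.+2 -> pt -> R) :
  (forall K i x, 0 <= f K i x) -> 0 <= bnd_int f.
Proof.
move=> f0; apply: sumr_ge0 => K _; apply: sumr_ge0 => i _; rewrite int_facetE.
by rewrite mulr_ge0 ?sqrtr_ge0 // sint_ge0.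
Qed.

Lemma le_cell_int f g : cell_regular f -> cell_regular g ->
  (forall K x, f K x <= g K x) -> cell_int f <= cell_int g.
Proof.
move=> rf rg fg; apply: ler_sum => K _; rewrite !int_simplexE //.
by apply: ler_wpM2l => //; exact: le_sint.
Qed.

Lemma le_bnd_int f g : facet_regular f -> facet_regular g ->
  (forall K i x, f K i x <= g K i x) -> bnd_int f <= bnd_int g.
Proof.
move=> rf rg fg; apply: ler_sum => K _; apply: ler_sum => i _; rewrite !int_facetE.
by apply: ler_wpM2l; [exact: sqrtr_ge0|exact: le_sint].
Qed.

Lemma csbound_cell (J : finType) (f g : J -> cell T -> pt -> R) :
  (forall j, cell_regular (f j)) -> (forall j, cell_regular (g j)) ->
  csbound (cell_int (fun K x => \sum_j f j K x * g j K x))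
          (cell_int (fun K x => \sum_j f j K x ^+ 2))
          (cell_int (fun K x => \sum_j g j K x ^+ 2)).
Proof.
move=> rf rg; rewrite /cell_int; apply: csbound_sum => K.
have rff : regular_on (vert T K) (fun x => \sum_j f j K x ^+ 2).
  by apply: regular_on_sum => j; apply: regular_onX2; exact: rf.
have rgg : regular_on (vert T K) (fun x => \sum_j g j K x ^+ 2).
  by apply: regular_on_sum => j; apply: regular_onX2; exact: rg.
have rfg : regular_on (vert T K) (fun x => \sum_j f j K x * g j K x).
  by apply: regular_on_sum => j; apply: regular_onM; [exact: rf|exact: rg].
rewrite (int_simplexE (nd K) rff) (int_simplexE (nd K) rgg) (int_simplexE (nd K) rfg).
apply: csboundM; rewrite ?expr2 //.
by apply: csbound_sint_sum => j; [exact: rf|exact: rg].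
Qed.

Lemma csbound_bnd (c a b : cell T -> R) (J : finType)
    (f g : J -> cell T -> 'I_n.+2 -> pt -> R) :
  (forall K, 0 <= a K) -> (forall K, 0 <= b K) -> (forall K, c K ^+ 2 = a K * b K) ->
  (forall j, facet_regular (f j)) -> (forall j, facet_regular (g j)) ->
  csbound (bnd_int (fun K i x => c K * \sum_j f j K i x * g j K i x))
          (bnd_int (fun K i x => a K * \sum_j f j K i x ^+ 2))
          (bnd_int (fun K i x => b K * \sum_j g j K i x ^+ 2)).
Proof.
move=> a0 b0 cab rf rg; rewrite /bnd_int; apply: csbound_sum => K.
apply: csbound_sum => i; set w := fun l => vert T K (lift i l).
have rff : regular_on w (fun x => \sum_j f j K i x ^+ 2).
  by apply: regular_on_sum => j; apply: regular_onX2; exact: rf.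
have rgg : regular_on w (fun x => \sum_j g j K i x ^+ 2).
  by apply: regular_on_sum => j; apply: regular_onX2; exact: rg.
have rfg : regular_on w (fun x => \sum_j f j K i x * g j K i x).
  by apply: regular_on_sum => j; apply: regular_onM; [exact: rf|exact: rg].
rewrite (int_facetZ (c K) rfg) (int_facetZ (a K) rff) (int_facetZ (b K) rgg).
apply: csboundM => //; rewrite !int_facetE.
apply: csboundM; rewrite ?expr2 ?sqrtr_ge0 //.
by apply: csbound_sint_sum => j; [exact: rf|exact: rg].
Qed.

End MeshIntegrals.

(** * Piecewise polynomial fields *)
Section Fields.
Context {R : realType} {n : nat}.
Local Notation pt := 'rV[R]_n.+1.
Local Notation mpol := (mpoly n.+1 R).

Lemma deg_le_mderiv k i (p : mpol) : deg_le k p -> deg_le k (mderiv i p).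
Proof.
rewrite /deg_le => pk; rewrite mmeasureE big_seq.
apply: (big_ind (fun d => (d <= k.+1)%N)) => // [a b ak bk|m mp].
  by rewrite geq_max ak bk.
have : mnm_add m (mnm1 i) \in msupp p.
  rewrite mcoeff_msupp; move: mp; rewrite mcoeff_msupp mcoeff_deriv.
  by apply: contraNneq => ->; rewrite mul0rn.
move=> /msize_mdeg_lt; rewrite mdegD mdeg1 addn1 => h.
exact: leq_trans (ltnW h) pk.
Qed.

Lemma deg_leD k (p q : mpol) : deg_le k p -> deg_le k q -> deg_le k (p + q).
Proof.
move=> pk qk; apply: leq_trans (mmeasureD_le _ _ _) _.
by rewrite geq_max pk qk.
Qed.

Lemma deg_leZ k (c : R) (p : mpol) : deg_le k p -> deg_le k (c *: p).
Proof. by move=> pk; apply: leq_trans pk; exact: mmeasureZ_le. Qed.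

Variable T : mesh R n.

(** The entries of the strain as polynomials, to which the trace inequality
    applies. *)
Definition epsp (v : cvec T) (K : cell T) (p : 'I_n.+1 * 'I_n.+1) : mpol :=
  2^-1 *: (mderiv p.2 (v K p.1) + mderiv p.1 (v K p.2)).

Lemma epsE (v : cvec T) K x i j : eps v K x i j = ev (epsp v K (i, j)) x.
Proof. by rewrite !mxE /epsp /ev mevalZ mevalD. Qed.

Lemma deg_epsp k (v : cvec T) K p : Vh k v -> deg_le k (epsp v K p).
Proof.
by move=> hv; apply/deg_leZ/deg_leD; apply: deg_le_mderiv; exact: hv.
Qed.

Lemma frob_epsE (u v : cvec T) K x :
  frob (eps u K x) (eps v K x) = \sum_p ev (epsp u K p) x * ev (epsp v K p) x.
Proof.
rewrite /frob pair_bigA /=; apply: eq_bigr => -[i j] _ /=.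
by rewrite !epsE.
Qed.

Lemma vdivE (v : cvec T) K x : vdiv v K x = \sum_a ev (epsp v K (a, a)) x.
Proof.
rewrite /vdiv /mxtrace; apply: eq_bigr => a _; rewrite -epsE !mxE.
by field.
Qed.

Lemma dot_vvalE (u v : cvec T) K x :
  dot (vval u K x) (vval v K x) = \sum_a ev (u K a) x * ev (v K a) x.
Proof. by apply: eq_bigr => a _; rewrite !mxE. Qed.

Lemma sum_sqr_le (J : finType) (f : J -> R) :
  (\sum_j f j) ^+ 2 <= #|J|%:R * \sum_j f j ^+ 2.
Proof.
have := csbound_sum (index_enum J) (a := fun j => 1 * f j) (b := fun=> 1)
  (c := fun j => f j ^+ 2).
rewrite sumr_const => H; have [//|_ _] := H _ .
  by move=> j; split; rewrite ?ler01 ?sqr_ge0 ?mul1r.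
by under eq_bigr do rewrite mul1r.
Qed.

End Fields.

Section Continuity.
Context {R : realType} {n : nat}.
Local Notation pt := 'rV[R]_n.+1.
Local Notation mpol := (mpoly n.+1 R).
Variables (Omega : set pt) (T : mesh R n) (k : nat).
Hypotheses (oO : open Omega) (hT : conforming_triangulation Omega T).

Let nd (K : cell T) : nondegenerate (vert T K). Proof. by case: hT. Qed.

Definition trace_bound (C : R) : Prop := 0 <= C /\
  forall (J : finType) (P : J -> cell T -> mpol), (forall j K, deg_le k (P j K)) ->
    bnd_int (fun (K : cell T) i x => hsize K * \sum_j ev (P j K) x ^+ 2) <=
    C * cell_int (fun K x => \sum_j ev (P j K) x ^+ 2).

Lemma hsize_gt0 (K : cell T) : 0 < hsize K.
Proof. exact: diam_gt0. Qed.

Lemma trace_boundP (Ct Cr : R) : 0 <= Ct -> 0 <= Cr ->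
  (forall (v : 'I_n.+2 -> pt) (p : mpol) (i : 'I_n.+2), nondegenerate v ->
    deg_le k p -> int_facet v i (fun x => ev p x ^+ 2) <=
    Ct * enorm (bgrad v i) * int_simplex v (fun x => ev p x ^+ 2)) ->
  (forall (K : cell T) j, hsize K * enorm (bgrad (vert T K) j) <= Cr) ->
  trace_bound (n.+2%:R * (Ct * Cr)).
Proof.
move=> Ct0 Cr0 Ht Hr; split=> [|J P dP]; first by rewrite !mulr_ge0.
rewrite /bnd_int /cell_int mulr_sumr; apply: ler_sum => K _.
set S := int_simplex _ _.
have SE : S = \sum_j int_simplex (vert T K) (fun x => ev (P j K) x ^+ 2).
  by rewrite /S int_simplex_sum // => j; apply: regular_onX2; exact: regular_on_ev.
have -> : n.+2%:R * (Ct * Cr) * S = \sum_(i < n.+2) Ct * Cr * S.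
  by rewrite sumr_const card_ord -[RHS]mulr_natl !mulrA.
apply: ler_sum => i _.
have rs j : regular_on (fun l => vert T K (lift i l)) (fun x => ev (P j K) x ^+ 2).
  by apply: regular_onX2; exact: regular_on_ev.
rewrite int_facetZ; last exact: regular_on_sum.
rewrite int_facet_sum // SE !mulr_sumr; apply: ler_sum => j _.
apply: (@le_trans _ _ (hsize K * (Ct * enorm (bgrad (vert T K) i) *
    int_simplex (vert T K) (fun x => ev (P j K) x ^+ 2)))).
  by apply: ler_wpM2l; [exact/ltW/hsize_gt0|exact: Ht].
have I0 : 0 <= int_simplex (vert T K) (fun x => ev (P j K) x ^+ 2).
  rewrite int_simplexE //; last by apply: regular_onX2; exact: regular_on_ev.
  by rewrite mulr_ge0 // sint_ge0 // => x _; exact: sqr_ge0.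
rewrite [leLHS](_ : _ = hsize K * enorm (bgrad (vert T K) i) *
  (Ct * int_simplex (vert T K) (fun x => ev (P j K) x ^+ 2))); last by ring.
rewrite [leRHS](_ : _ = Cr *
  (Ct * int_simplex (vert T K) (fun x => ev (P j K) x ^+ 2))); last by ring.
by apply: ler_wpM2r; [exact: mulr_ge0|exact: Hr].
Qed.

Definition strain_sq (u : bvec T) : R :=
  cell_int (fun K x => frob (eps u.1 K x) (eps u.1 K x)).
Definition vjump_sq (u : bvec T) : R :=
  bnd_int (fun K i x => (hsize K)^-1 * dot (vjump u K i x) (vjump u K i x)).
Definition cell_sq (q : bscal T) : R :=
  cell_int (fun K x => ev (q.1 K) x * ev (q.1 K) x).
Definition trace_sq (q : bscal T) : R :=
  bnd_int (fun (K : cell T) i x => hsize K * q.2 (face K i) x * q.2 (face K i) x).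
Definition vcell_sq (z : cvec T) : R :=
  cell_int (fun K x => dot (vval z K x) (vval z K x)).
Definition grad_sq (q : bscal T) : R :=
  cell_int (fun K x => dot (qgrad q.1 K x) (qgrad q.1 K x)).
Definition qjump_sq (q : bscal T) : R :=
  bnd_int (fun K i x => (hsize K)^-1 * qjump q K i x * qjump q K i x).

Definition vspace (u : bvec T) : Prop := Vh k u.1 /\ Vbh Omega k T u.2.
Definition qspace (q : bscal T) : Prop := Qh k q.1 /\ Qbh k T q.2.

Lemma facet_regular_ev (p : cell T -> mpol) :
  facet_regular (fun (K : cell T) (_ : 'I_n.+2) x => ev (p K) x).
Proof. by move=> K i; exact: regular_on_ev. Qed.

Lemma cell_regular_ev (p : cell T -> mpol) : cell_regular (fun K x => ev (p K) x).
Proof. by move=> K; exact: regular_on_ev. Qed.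

Lemma facet_regular_vjump u a : vspace u ->
  facet_regular (fun (K : cell T) i x => vjump u K i x 0 a).
Proof.
move=> [_ hv] K i; apply: (@eq_regular_on _ _ _ _ _
    (fun x => ev (u.1 K a) x + - u.2 (face K i) x 0 a)).
  by move=> x _; rewrite !mxE.
apply: regular_onD; first exact: regular_on_ev.
by apply: regular_onN; exact: (facet_regular_on ((hv _ (mesh_face K i)).1 a)).
Qed.

Lemma facet_regular_trace q : qspace q ->
  facet_regular (fun (K : cell T) i x => q.2 (face K i) x).
Proof. by move=> [_ hq] K i; exact: (facet_regular_on (hq _ (mesh_face K i))). Qed.

Lemma facet_regular_qjump q : qspace q -> facet_regular (fun K i x => qjump q K i x).
Proof.
move=> hq K i; apply: regular_onD; first exact: regular_on_ev.
by apply: regular_onN; exact: facet_regular_trace.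
Qed.

Lemma cell_regular_dot (f g : cell T -> pt -> pt) :
  (forall a, cell_regular (fun K x => f K x 0 a)) ->
  (forall a, cell_regular (fun K x => g K x 0 a)) ->
  cell_regular (fun K x => dot (f K x) (g K x)).
Proof.
move=> rf rg K; apply: regular_on_sum => a.
by apply: regular_onM; [exact: rf|exact: rg].
Qed.

Lemma facet_regular_dot (f g : cell T -> 'I_n.+2 -> pt -> pt) :
  (forall a, facet_regular (fun K i x => f K i x 0 a)) ->
  (forall a, facet_regular (fun K i x => g K i x 0 a)) ->
  facet_regular (fun K i x => dot (f K i x) (g K i x)).
Proof.
move=> rf rg K i; apply: regular_on_sum => a.
by apply: regular_onM; [exact: rf|exact: rg].
Qed.

Lemma facet_regularM (f g : cell T -> 'I_n.+2 -> pt -> R) :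
  facet_regular f -> facet_regular g -> facet_regular (fun K i x => f K i x * g K i x).
Proof. by move=> rf rg K i; apply: regular_onM; [exact: rf|exact: rg]. Qed.

Lemma facet_regular_cst (c : cell T -> 'I_n.+2 -> R) :
  facet_regular (fun K i _ => c K i).
Proof. by move=> K i; exact: regular_on_cst. Qed.

Lemma facet_regularZ (c : cell T -> R) (f : cell T -> 'I_n.+2 -> pt -> R) :
  facet_regular f -> facet_regular (fun K i x => c K * f K i x).
Proof. by apply: facet_regularM; exact: (facet_regular_cst (fun K _ => c K)). Qed.

Lemma cell_regularM (f g : cell T -> pt -> R) :
  cell_regular f -> cell_regular g -> cell_regular (fun K x => f K x * g K x).
Proof. by move=> rf rg K; apply: regular_onM; [exact: rf|exact: rg]. Qed.

Lemma cell_regular_vval (v : cvec T) a : cell_regular (fun K x => vval v K x 0 a).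
Proof.
move=> K; apply: (@eq_regular_on _ _ _ _ _ (ev (v K a))); last exact: regular_on_ev.
by move=> x _; rewrite mxE.
Qed.

Lemma facet_regular_vval (v : cvec T) a :
  facet_regular (fun (K : cell T) (_ : 'I_n.+2) x => vval v K x 0 a).
Proof.
move=> K i; apply: (@eq_regular_on _ _ _ _ _ (ev (v K a))); last exact: regular_on_ev.
by move=> x _; rewrite mxE.
Qed.

Lemma cell_regular_qgrad (q : cscal T) a : cell_regular (fun K x => qgrad q K x 0 a).
Proof.
move=> K; apply: (@eq_regular_on _ _ _ _ _ (ev (mderiv a (q K)))); last exact: regular_on_ev.
by move=> x _; rewrite mxE.
Qed.

Lemma cell_regular_frob (u v : cvec T) : cell_regular (fun K x => frob (eps u K x) (eps v K x)).
Proof.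
move=> K; apply: (@eq_regular_on _ _ _ _ _
    (fun x => \sum_p ev (epsp u K p) x * ev (epsp v K p) x)).
  by move=> x _; exact: frob_epsE.
by apply: regular_on_sum => p; apply: regular_onM; exact: regular_on_ev.
Qed.

Lemma facet_regular_normal a : facet_regular (fun (K : cell T) i (_ : pt) => nrm K i 0 a).
Proof. exact: (facet_regular_cst (fun K i => nrm K i 0 a)). Qed.

Lemma csboundN (a b c : R) : csbound a b c -> csbound (- a) b c.
Proof. by move=> [b0 c0 h]; split=> //; rewrite sqrrN. Qed.

Lemma csbound_le (a b c b' c' : R) : csbound a b c -> b <= b' -> c <= c' -> csbound a b' c'.
Proof.
move=> [b0 c0 h] bb cc; split; [exact: le_trans bb|exact: le_trans cc|].
by apply: (le_trans h); exact: ler_pM.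
Qed.

Lemma csbound_cell1 (f g : cell T -> pt -> R) : cell_regular f -> cell_regular g ->
  csbound (cell_int (fun K x => f K x * g K x))
    (cell_int (fun K x => f K x * f K x)) (cell_int (fun K x => g K x * g K x)).
Proof.
move=> rf rg; have := @csbound_cell _ _ T nd unit (fun=> f) (fun=> g) (fun=> rf) (fun=> rg).
congr csbound; apply: eq_cell_int => K x; rewrite (big_pred1 tt) //; by case.
Qed.

Lemma csbound_cell_dot (f g : cell T -> pt -> pt) :
  (forall a, cell_regular (fun K x => f K x 0 a)) ->
  (forall a, cell_regular (fun K x => g K x 0 a)) ->
  csbound (cell_int (fun K x => dot (f K x) (g K x)))
    (cell_int (fun K x => dot (f K x) (f K x))) (cell_int (fun K x => dot (g K x) (g K x))).
Proof.
move=> rf rg.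
exact: (@csbound_cell _ _ T nd _ (fun a K x => f K x 0 a) (fun a K x => g K x 0 a)).
Qed.

Lemma csbound_bnd1 (c a b : cell T -> R) (f g : cell T -> 'I_n.+2 -> pt -> R) :
  (forall K, 0 <= a K) -> (forall K, 0 <= b K) -> (forall K, c K ^+ 2 = a K * b K) ->
  facet_regular f -> facet_regular g ->
  csbound (bnd_int (fun K i x => c K * (f K i x * g K i x)))
    (bnd_int (fun K i x => a K * (f K i x * f K i x)))
    (bnd_int (fun K i x => b K * (g K i x * g K i x))).
Proof.
move=> a0 b0 cab rf rg.
have := @csbound_bnd _ _ T c a b unit (fun=> f) (fun=> g) a0 b0 cab (fun=> rf) (fun=> rg).
by congr csbound; apply: eq_bnd_int => K i x; rewrite (big_pred1 tt) //; case.
Qed.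

Lemma csbound_bnd_dot (c a b : cell T -> R) (f g : cell T -> 'I_n.+2 -> pt -> pt) :
  (forall K, 0 <= a K) -> (forall K, 0 <= b K) -> (forall K, c K ^+ 2 = a K * b K) ->
  (forall j, facet_regular (fun K i x => f K i x 0 j)) ->
  (forall j, facet_regular (fun K i x => g K i x 0 j)) ->
  csbound (bnd_int (fun K i x => c K * dot (f K i x) (g K i x)))
    (bnd_int (fun K i x => a K * dot (f K i x) (f K i x)))
    (bnd_int (fun K i x => b K * dot (g K i x) (g K i x))).
Proof.
move=> a0 b0 cab rf rg.
exact: (@csbound_bnd _ _ T c a b _ (fun j K i x => f K i x 0 j) (fun j K i x => g K i x 0 j)).
Qed.

End Continuity.

(** * Elastic, Darcy and storage terms *)
Section Terms.
Context {R : realType} {n : nat}.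
Local Notation pt := 'rV[R]_n.+1.
Local Notation mpol := (mpoly n.+1 R).
Variables (Omega : set pt) (T : mesh R n) (k : nat).
Hypotheses (oO : open Omega) (hT : conforming_triangulation Omega T).
Variables (eta Ct : R).
Hypotheses (heta : 1 < eta) (hCt : trace_bound T k Ct).

Let nd (K : cell T) : nondegenerate (vert T K). Proof. by case: hT. Qed.
Let h0 (K : cell T) : 0 < hsize K. Proof. exact: (hsize_gt0 hT). Qed.
Let eta0 : 0 < eta. Proof. exact: lt_trans heta. Qed.
Local Notation vspace := (vspace Omega k).
Local Notation qspace := (qspace k).

Lemma strain_term (mu : R) (u v : bvec T) : 0 < mu ->
  csbound (cell_int (fun K x => mu * frob (eps u.1 K x) (eps v.1 K x)))
    (mu * strain_sq u) (mu * strain_sq v).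
Proof.
move=> mu0; rewrite (cell_intZ nd mu (cell_regular_frob u.1 v.1)).
apply: (csboundM (ltW mu0) (ltW mu0) (expr2 mu)).
have := @csbound_cell _ _ T nd _ (fun p K x => ev (epsp u.1 K p) x)
  (fun p K x => ev (epsp v.1 K p) x)
  (fun p => cell_regular_ev (fun K => epsp u.1 K p))
  (fun p => cell_regular_ev (fun K => epsp v.1 K p)).
by congr csbound; apply: eq_cell_int => K x; rewrite frob_epsE.
Qed.

Lemma jump_term (mu : R) (u v : bvec T) : 0 < mu -> vspace u -> vspace v ->
  csbound (bnd_int (fun K i x => eta * mu / hsize K * dot (vjump u K i x) (vjump v K i x)))
    (mu * eta * vjump_sq u) (mu * eta * vjump_sq v).
Proof.
move=> mu0 hu hv.
have -> : bnd_int (fun K i x => eta * mu / hsize K * dot (vjump u K i x) (vjump v K i x)) =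
    mu * eta * bnd_int (fun K i x => (hsize K)^-1 * dot (vjump u K i x) (vjump v K i x)).
  rewrite -bnd_intZ; first by apply: eq_bnd_int => K i x; rewrite mulrA (mulrC mu).
  apply: (facet_regularZ (fun K => (hsize K)^-1)).
  by apply: facet_regular_dot => a; exact: (@facet_regular_vjump _ _ Omega _ k).
have me0 : 0 <= mu * eta by rewrite mulr_ge0 // ltW.
apply: (csboundM me0 me0 (expr2 _)).
apply: csbound_bnd_dot => [K|K|K|a|a].
- by rewrite invr_ge0 ltW.
- by rewrite invr_ge0 ltW.
- by rewrite expr2.
- exact: (facet_regular_vjump a hu).
- exact: (facet_regular_vjump a hv).
Qed.

Lemma mapp_sq (A : 'M[R]_n.+1) (nu : pt) :
  dot (mapp A nu) (mapp A nu) <= frob A A * dot nu nu.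
Proof.
rewrite /frob mulr_suml; apply: ler_sum => i _.
have -> : mapp A nu 0 i = dot (row i A) nu.
  by rewrite /mapp /dot !mxE; apply: eq_bigr => j _; rewrite !mxE.
rewrite -expr2; apply: le_trans (dot_CauchySchwarz _ _) _.
by rewrite le_eqVlt; apply/orP; left; apply/eqP; congr (_ * _);
  apply: eq_bigr => j _; rewrite !mxE.
Qed.

Lemma dot_normal (K : cell T) i : dot (nrm K i) (nrm K i) = 1.
Proof. by rewrite -enorm_sqr enorm_normal // expr1n. Qed.

Lemma facet_regular_mapp (u : cvec T) a :
  facet_regular (fun K i x => mapp (eps u K x) (nrm K i) 0 a).
Proof.
move=> K i; apply: (@eq_regular_on _ _ _ _ _
    (fun x => \sum_j ev (epsp u K (a, j)) x * nrm K i 0 j)).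
  by move=> x _; rewrite /mapp !mxE; apply: eq_bigr => j _; rewrite epsE mxE.
by apply: regular_on_sum => j; apply: regular_onM; [exact: regular_on_ev|exact: regular_on_cst].
Qed.

Lemma traction_trace (u : cvec T) : Vh k u ->
  bnd_int (fun K i x => hsize K * dot (mapp (eps u K x) (nrm K i)) (mapp (eps u K x) (nrm K i)))
    <= Ct * cell_int (fun K x => frob (eps u K x) (eps u K x)).
Proof.
move=> hu; case: hCt => _ /(_ _ (fun p K => epsp u K p)) H.
have /H {}H : forall p K, deg_le k (epsp u K p) by move=> p K; exact: deg_epsp.
have -> : cell_int (fun K x => frob (eps u K x) (eps u K x)) =
    cell_int (fun K x => \sum_p ev (epsp u K p) x ^+ 2).
  by apply: eq_cell_int => K x; rewrite frob_epsE.
apply: le_trans H; apply: le_bnd_int.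
- apply: (facet_regularZ (fun K => hsize K)).
  by apply: facet_regular_dot => a; exact: facet_regular_mapp.
- apply: (facet_regularZ (fun K => hsize K)).
  by move=> K i; apply: regular_on_sum => p; apply: regular_onX2; exact: regular_on_ev.
- move=> K i x; apply: ler_wpM2l; first exact: ltW.
  apply: (le_trans (mapp_sq _ _)); rewrite dot_normal mulr1 frob_epsE.
  by rewrite le_eqVlt eqxx.
Qed.

Lemma traction_term (mu : R) (u v : bvec T) : 0 < mu -> vspace u -> vspace v ->
  csbound (bnd_int (fun K i x =>
      mu * dot (mapp (eps u.1 K x) (nrm K i)) (vjump v K i x)))
    (Ct * (mu * strain_sq u)) (mu * eta * vjump_sq v).
Proof.
move=> mu0 hu hv.
have rj a : facet_regular (fun K i x => vjump v K i x 0 a) by exact: (facet_regular_vjump a hv).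
have rm a := facet_regular_mapp u.1 a.
rewrite bnd_intZ; last exact: facet_regular_dot.
have := csbound_bnd_dot (c := fun=> 1) (a := fun K => hsize K) (b := fun K => (hsize K)^-1)
  (fun K => ltW (h0 K)) _ _ rm rj.
have -> : bnd_int (fun K i x => 1 * dot (mapp (eps u.1 K x) (nrm K i)) (vjump v K i x)) =
    bnd_int (fun K i x => dot (mapp (eps u.1 K x) (nrm K i)) (vjump v K i x)).
  by apply: eq_bnd_int => K i x; rewrite mul1r.
move=> H.
have {}H := csboundM (ltW mu0) (ltW mu0) (expr2 mu) (H _ _).
apply: csbound_le (H _ _) _ _.
- by move=> K; rewrite invr_ge0 ltW.
- by move=> K; rewrite expr1n divff // gt_eqF.
- rewrite [leRHS]mulrCA; apply: (ler_wpM2l (ltW mu0)); apply: traction_trace; by case: hu.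
- rewrite -mulrA; apply: ler_wpM2l; first exact: ltW.
  rewrite ler_peMl ?(ltW heta) //; apply: bnd_int_ge0 => K i x.
  by rewrite mulr_ge0 ?dot_ge0 // invr_ge0 ltW.
Qed.

Lemma darcy_term (kappa : R) (z w : cvec T) : 0 < kappa ->
  csbound (cell_int (fun K s => kappa^-1 * dot (vval z K s) (vval w K s)))
    (kappa^-1 * vcell_sq z) (kappa^-1 * vcell_sq w).
Proof.
move=> k0; have k1 : 0 <= kappa^-1 by rewrite invr_ge0 ltW.
have rd : cell_regular (fun K s => dot (vval z K s) (vval w K s)).
  by apply: cell_regular_dot => a; exact: cell_regular_vval.
rewrite (cell_intZ nd _ rd).
apply: (csboundM k1 k1 (expr2 _)); apply: (csbound_cell_dot hT) => a; exact: cell_regular_vval.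
Qed.

Lemma storage_term (c0 : R) (p q : bscal T) : 0 <= c0 ->
  csbound (cell_int (fun K s => c0 * ev (p.1 K) s * ev (q.1 K) s))
    (c0 * cell_sq p) (c0 * cell_sq q).
Proof.
move=> c00.
have -> : cell_int (fun K s => c0 * ev (p.1 K) s * ev (q.1 K) s) =
    c0 * cell_int (fun K s => ev (p.1 K) s * ev (q.1 K) s).
  have rd : cell_regular (fun K s => ev (p.1 K) s * ev (q.1 K) s).
    by apply: cell_regularM; exact: cell_regular_ev.
  by rewrite -(cell_intZ nd c0 rd); apply: eq_cell_int => K x; rewrite mulrA.
apply: (csboundM c00 c00 (expr2 _)); apply: (csbound_cell1 hT); exact: cell_regular_ev.
Qed.

Lemma cell_sq_ge0 (q : bscal T) : 0 <= cell_sq q.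
Proof.
apply: cell_int_ge0 => //; first by apply: cell_regularM; exact: cell_regular_ev.
by move=> K x; rewrite -expr2 sqr_ge0.
Qed.

Lemma exchange_term (lambda alpha : R) (p pT q qT : bscal T) : 0 < lambda ->
  csbound (lambda^-1 * cell_int (fun K s =>
      (alpha * ev (p.1 K) s - ev (pT.1 K) s) * (alpha * ev (q.1 K) s - ev (qT.1 K) s)))
    (2 * (alpha ^+ 2 * lambda^-1 * cell_sq p) + 2 * (lambda^-1 * cell_sq pT))
    (2 * (alpha ^+ 2 * lambda^-1 * cell_sq q) + 2 * (lambda^-1 * cell_sq qT)).
Proof.
move=> l0; have l1 : 0 <= lambda^-1 by rewrite invr_ge0 ltW.
pose f (p pT : bscal T) K s := alpha * ev (p.1 K) s - ev (pT.1 K) s.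
have rf (p' pT' : bscal T) : cell_regular (f p' pT').
  move=> K; apply: regular_onD; last by apply: regular_onN; exact: regular_on_ev.
  by apply: regular_onM; [exact: regular_on_cst|exact: regular_on_ev].
have bd (p' pT' : bscal T) : lambda^-1 * cell_int (fun K s => f p' pT' K s * f p' pT' K s) <=
    2 * (alpha ^+ 2 * lambda^-1 * cell_sq p') + 2 * (lambda^-1 * cell_sq pT').
  have rp : cell_regular (fun K x => ev (p'.1 K) x * ev (p'.1 K) x).
    by apply: cell_regularM; exact: cell_regular_ev.
  have rpT : cell_regular (fun K x => ev (pT'.1 K) x * ev (pT'.1 K) x).
    by apply: cell_regularM; exact: cell_regular_ev.
  have rc (c : R) g : cell_regular g -> cell_regular (fun (K : cell T) x => c * g K x).
    by move=> rg K; apply: regular_onM; [exact: regular_on_cst|exact: rg].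
  rewrite [leRHS](_ : _ = lambda^-1 *
      (2 * alpha ^+ 2 * cell_sq p' + 2 * cell_sq pT')); last by ring.
  apply: ler_wpM2l => //.
  rewrite /cell_sq -(cell_intZ nd _ rp) -(cell_intZ nd _ rpT).
  rewrite -(cell_intD nd (rc _ _ rp) (rc _ _ rpT)).
  apply: (le_cell_int nd).
  - by apply: cell_regularM; exact: rf.
  - by move=> K; apply: regular_onD; [exact: (rc _ _ rp K)|exact: (rc _ _ rpT K)].
  - move=> K x; have := sqr_ge0 (alpha * ev (p'.1 K) x + ev (pT'.1 K) x).
    rewrite /f; nra.
apply: csbound_le (bd p pT) (bd q qT).
apply: (csboundM l1 l1 (expr2 _)); apply: (csbound_cell1 hT); exact: rf.
Qed.

End Terms.

(** * Divergence terms *)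
Section Couplings.
Context {R : realType} {n : nat}.
Local Notation pt := 'rV[R]_n.+1.
Local Notation mpol := (mpoly n.+1 R).
Variables (Omega : set pt) (T : mesh R n) (k : nat).
Hypotheses (oO : open Omega) (hT : conforming_triangulation Omega T).
Variables (eta Ct : R).
Hypotheses (heta : 1 < eta) (hCt : trace_bound T k Ct).

Let nd (K : cell T) : nondegenerate (vert T K). Proof. by case: hT. Qed.
Let h0 (K : cell T) : 0 < hsize K. Proof. exact: (hsize_gt0 hT). Qed.
Let eta0 : 0 < eta. Proof. exact: lt_trans heta. Qed.
Local Notation vspace := (vspace Omega k).
Local Notation qspace := (qspace k).

Let hpos (K : cell T) : 0 <= hsize K. Proof. exact: ltW. Qed.
Let hinv (K : cell T) : 0 <= (hsize K)^-1. Proof. by rewrite invr_ge0 ltW. Qed.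
Let h1 (K : cell T) : 1 ^+ 2 = hsize K * (hsize K)^-1.
Proof. by rewrite expr1n divff // gt_eqF. Qed.
Let h1' (K : cell T) : 1 ^+ 2 = (hsize K)^-1 * hsize K.
Proof. by rewrite mulrC; exact: h1. Qed.

Lemma sqr_dot_unit (u nu : pt) : dot nu nu = 1 -> dot u nu * dot u nu <= dot u u.
Proof. by move=> nu1; rewrite -expr2 (le_trans (dot_CauchySchwarz _ _)) // nu1 mulr1. Qed.

Lemma facet_regular_dot_normal (f : cell T -> 'I_n.+2 -> pt -> pt) :
  (forall a, facet_regular (fun K i x => f K i x 0 a)) ->
  facet_regular (fun K i x => dot (f K i x) (nrm K i)).
Proof. by move=> rf; apply: facet_regular_dot => // a; exact: facet_regular_normal. Qed.

Lemma facet_regular_vtrace (v : bvec T) a : vspace v ->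
  facet_regular (fun (K : cell T) i x => v.2 (face K i) x 0 a).
Proof. by move=> [_ hv] K i; exact: (facet_regular_on ((hv _ (mesh_face K i)).1 a)). Qed.

(** Subtracting the vanishing flux of [v.2] leaves the jump of v, which the
    norm controls. *)
Lemma flux_jump (v : bvec T) (q : bscal T) : vspace v -> qspace q ->
  bnd_int (fun K i x => q.2 (face K i) x * dot (vval v.1 K x) (nrm K i)) =
  bnd_int (fun K i x => q.2 (face K i) x * dot (vjump v K i x) (nrm K i)).
Proof.
move=> hv hq.
have rq := facet_regular_trace hq.
have rj := facet_regularM rq (facet_regular_dot_normal (fun a => facet_regular_vjump a hv)).
have rt := facet_regularM rq (facet_regular_dot_normal (fun a => facet_regular_vtrace a hv)).
rewrite -[RHS]addr0 -(single_valued_flux oO hT hq.2 hv.2) -(bnd_intD rj rt).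
by apply: eq_bnd_int => K i x; rewrite -mulrDr -dotDl /vjump subrK.
Qed.

Lemma vdiv_sq_le (v : cvec T) K x : vdiv v K x * vdiv v K x <=
  n.+1%:R * frob (eps v K x) (eps v K x).
Proof.
rewrite -expr2 vdivE (le_trans (sum_sqr_le _)) // card_ord.
apply: ler_wpM2l => //; rewrite frob_epsE.
have <- : \sum_a \sum_b ev (epsp v K (a, b)) x * ev (epsp v K (a, b)) x =
    \sum_p ev (epsp v K p) x * ev (epsp v K p) x.
  by rewrite pair_bigA /=; apply: eq_bigr => -[].
apply: ler_sum => a _; rewrite expr2 (bigD1 a) //= lerDl sumr_ge0 // => b _.
by rewrite -expr2 sqr_ge0.
Qed.

Lemma cell_regular_vdiv (v : cvec T) : cell_regular (vdiv v).
Proof.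
move=> K; apply: (@eq_regular_on _ _ _ _ _ (fun x => \sum_a ev (epsp v K (a, a)) x)).
  by move=> x _; exact: vdivE.
by apply: regular_on_sum => a; exact: regular_on_ev.
Qed.

(** The divergence is the trace of the strain, whence the factor d = n.+1. *)
Lemma volumetric_term (mu : R) (v : bvec T) (q : bscal T) : 0 < mu ->
  vspace v -> qspace q ->
  csbound (b_h v.1 q)
    (mu^-1 * cell_sq q + mu^-1 * eta^-1 * trace_sq q)
    (n.+1%:R * (mu * strain_sq v) + mu * eta * vjump_sq v).
Proof.
move=> mu0 hv hq; rewrite /b_h (flux_jump hv hq).
have mi : 0 <= mu^-1 by rewrite invr_ge0 ltW.
have m1 : 1 ^+ 2 = mu^-1 * mu by rewrite expr1n mulVf // gt_eqF.
have me : 0 <= mu * eta by rewrite mulr_ge0 // ltW.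
have mei : 0 <= mu^-1 * eta^-1 by rewrite mulr_ge0 // invr_ge0 ltW.
have me1 : 1 ^+ 2 = (mu^-1 * eta^-1) * (mu * eta).
  by rewrite -invfM expr1n mulVf // mulf_neq0 // gt_eqF.
have rd := cell_regular_vdiv v.1.
apply: csboundD.
  apply: csboundN; rewrite -[cell_int _]mul1r.
  have := csboundM mi (ltW mu0) m1 (csbound_cell1 hT (cell_regular_ev q.1) rd).
  move=> H; apply: (csbound_le H) => //.
  rewrite [leRHS]mulrCA; apply: (ler_wpM2l (ltW mu0)).
  rewrite -(cell_intZ nd _ (cell_regular_frob v.1 v.1)).
  apply: (le_cell_int nd); first exact: cell_regularM.
    by move=> K; apply: regular_onM; [exact: regular_on_cst|exact: cell_regular_frob].
  exact: vdiv_sq_le.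
have rq := facet_regular_trace hq.
have rj a := facet_regular_vjump a hv.
have rn := facet_regular_dot_normal rj.
rewrite -[bnd_int _]mul1r.
have := csbound_bnd1 (c := fun=> 1) hpos hinv h1 rq rn.
have -> : bnd_int (fun K i x => 1 * (q.2 (face K i) x * dot (vjump v K i x) (nrm K i))) =
    bnd_int (fun K i x => q.2 (face K i) x * dot (vjump v K i x) (nrm K i)).
  by apply: eq_bnd_int => K i x; rewrite mul1r.
move=> /(csboundM mei me me1) H; apply: (csbound_le H).
  rewrite le_eqVlt; apply/orP; left; apply/eqP; congr (_ * _).
  by apply: eq_bnd_int => K i x; rewrite mulrA.
apply: (ler_wpM2l me); apply: le_bnd_int.
- apply: (facet_regularZ (fun K => (hsize K)^-1)).
  exact: facet_regularM.
- apply: (facet_regularZ (fun K => (hsize K)^-1)).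
  exact: facet_regular_dot.
- by move=> K i x; apply: ler_wpM2l => //; apply: sqr_dot_unit; exact: (dot_normal hT).
Qed.

(** This removes the derivatives of w, which the norm does not control. *)
Lemma b_h_by_parts (w : cvec T) (p : bscal T) : qspace p ->
  b_h w p = cell_int (fun K x => dot (qgrad p.1 K x) (vval w K x)) -
    bnd_int (fun K i x => qjump p K i x * dot (vval w K x) (nrm K i)).
Proof.
move=> hp.
have rd := cell_regular_vdiv w.
have rw := facet_regular_dot_normal (fun a => facet_regular_vval w a).
have rg : cell_regular (fun K x => dot (qgrad p.1 K x) (vval w K x)).
  apply: cell_regular_dot => a; [exact: cell_regular_qgrad|exact: cell_regular_vval].
have rpd : cell_regular (fun K x => ev (p.1 K) x * vdiv w K x).
  by apply: cell_regularM => //; exact: cell_regular_ev.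
have div : cell_int (fun K x => dot (qgrad p.1 K x) (vval w K x)) +
    cell_int (fun K x => ev (p.1 K) x * vdiv w K x) =
    bnd_int (fun K i x => ev (p.1 K) x * dot (vval w K x) (nrm K i)).
  rewrite -(cell_intD nd rg rpd) /cell_int /bnd_int; apply: eq_bigr => K _.
  transitivity (int_simplex (vert T K) (fun x =>
      \sum_a ev (mderiv a (p.1 K * w K a)) x)).
    congr int_simplex; apply/funext => x.
    rewrite /dot /vdiv /mxtrace mulr_sumr -big_split; apply: eq_bigr => a _ /=.
    by rewrite !mxE mderivM /ev mevalD !mevalM.
  rewrite (divergence_theorem (fun a => p.1 K * w K a) (nd K)).
  apply: eq_bigr => i _; congr int_facet; apply/funext => x.
  rewrite /dot mulr_sumr; apply: eq_bigr => a _.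
  by rewrite !mxE /ev mevalM mulrA.
have rev := facet_regularM (facet_regular_ev p.1) rw.
have rtr := facet_regularM (facet_regular_trace hp) rw.
have -> : bnd_int (fun K i x => qjump p K i x * dot (vval w K x) (nrm K i)) =
    bnd_int (fun K i x => ev (p.1 K) x * dot (vval w K x) (nrm K i)) -
    bnd_int (fun K i x => p.2 (face K i) x * dot (vval w K x) (nrm K i)).
  rewrite -[X in _ = _ + X]mulN1r -(bnd_intZ (-1) rtr) -bnd_intD //.
    by apply: eq_bnd_int => K i x; rewrite /qjump mulrBl mulN1r.
  exact: (facet_regularZ (fun=> -1)).
rewrite -div /b_h; ring.
Qed.

Lemma normal_trace (w : cvec T) : Vh k w ->
  bnd_int (fun K i x => hsize K * (dot (vval w K x) (nrm K i) * dot (vval w K x) (nrm K i)))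
    <= Ct * vcell_sq w.
Proof.
move=> hw; case: hCt => _ /(_ _ (fun a K => w K a)) H.
have /H {}H : forall a K, deg_le k (w K a) by move=> a K; exact: hw.
have -> : vcell_sq w = cell_int (fun K x => \sum_a ev (w K a) x ^+ 2).
  by apply: eq_cell_int => K x; rewrite dot_vvalE.
have rw := facet_regular_dot_normal (fun a => facet_regular_vval w a).
apply: le_trans H; apply: le_bnd_int.
- apply: (facet_regularZ (fun K => hsize K)).
  exact: facet_regularM.
- apply: (facet_regularZ (fun K => hsize K)).
  by move=> K i; apply: regular_on_sum => a; apply: regular_onX2; exact: regular_on_ev.
- move=> K i x; apply: ler_wpM2l => //.
  apply: (le_trans (sqr_dot_unit _ (dot_normal hT K i))).
  by rewrite dot_vvalE le_eqVlt eqxx.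
Qed.

Lemma vcell_sq_ge0 (w : cvec T) : 0 <= vcell_sq w.
Proof.
apply: (cell_int_ge0 nd); first by apply: cell_regular_dot => a; exact: cell_regular_vval.
by move=> K x; exact: dot_ge0.
Qed.

Lemma mass_flux_term (kappa : R) (w : cvec T) (p : bscal T) : 0 < kappa ->
  Vh k w -> qspace p ->
  csbound (b_h w p)
    (kappa * grad_sq p + kappa * eta * qjump_sq p)
    ((1 + Ct) * (kappa^-1 * vcell_sq w)).
Proof.
move=> k0 hw hp; rewrite (b_h_by_parts w hp).
have ki : 0 <= kappa^-1 by rewrite invr_ge0 ltW.
have k1 : 1 ^+ 2 = kappa * kappa^-1 by rewrite expr1n divff // gt_eqF.
have ke : 0 <= kappa * eta by rewrite mulr_ge0 // ltW.
have kei : 0 <= kappa^-1 * eta^-1 by rewrite mulr_ge0 // invr_ge0 ltW.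
have ke1 : 1 ^+ 2 = (kappa * eta) * (kappa^-1 * eta^-1).
  by rewrite -invfM expr1n divff // mulf_neq0 // gt_eqF.
rewrite mulrDl mul1r; apply: csboundD.
  rewrite -[cell_int _]mul1r; apply: (csboundM (ltW k0) ki k1).
  apply: (csbound_cell_dot hT) => a; [exact: cell_regular_qgrad|exact: cell_regular_vval].
apply: csboundN; rewrite -[bnd_int _]mul1r.
have rj := facet_regular_qjump hp.
have rw := facet_regular_dot_normal (fun a => facet_regular_vval w a).
have := csbound_bnd1 (c := fun=> 1) hinv hpos h1' rj rw.
have -> : bnd_int (fun K i x => 1 * (qjump p K i x * dot (vval w K x) (nrm K i))) =
    bnd_int (fun K i x => qjump p K i x * dot (vval w K x) (nrm K i)).
  by apply: eq_bnd_int => K i x; rewrite mul1r.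
move=> /(csboundM ke kei ke1) H; apply: (csbound_le H).
  rewrite le_eqVlt; apply/orP; left; apply/eqP; congr (_ * _).
  by apply: eq_bnd_int => K i x; rewrite mulrA.
have Ct0 : 0 <= Ct by case: hCt.
have W0 := vcell_sq_ge0 w.
rewrite [leRHS]mulrCA -mulrA; apply: (ler_wpM2l ki).
apply: (@le_trans _ _ (eta^-1 * (Ct * vcell_sq w))).
  by apply: ler_wpM2l; [rewrite invr_ge0 ltW|exact: normal_trace].
by rewrite ler_piMl ?mulr_ge0 // invf_le1 // ltW.
Qed.

End Couplings.

(** * Boundedness of the bilinear form *)
Section Boundedness.
Context {R : realType} {n : nat}.
Variables (Omega : set 'rV[R]_n.+1) (T : mesh R n) (k : nat).
Hypotheses (oO : open Omega) (hT : conforming_triangulation Omega T).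
Variables (eta Ct : R).
Hypotheses (heta : 1 < eta) (hCt : trace_bound T k Ct).
Variables (cl mu lambda alpha kappa c0 : R).
Hypotheses (hcl : 0 < cl) (mu0 : 0 < mu) (hlam : cl^-1 * mu <= lambda).
Hypotheses (k0 : 0 < kappa) (c00 : 0 <= c0).

Let lam0 : 0 < lambda.
Proof. by apply: lt_le_trans hlam; rewrite mulr_gt0 // invr_gt0. Qed.

Let ilam : lambda^-1 <= cl * mu^-1.
Proof. by rewrite -[cl]invrK -invfM lef_pV2 ?posrE // mulr_gt0 // invr_gt0. Qed.

Local Notation energy x := (ip_X eta mu lambda alpha kappa c0 x x).

(** The squared norm, grouped according to the bounds of the single terms. *)
Lemma energyE (x : hdg T) : energy x =
  (mu * strain_sq (xu x) + mu * eta * vjump_sq (xu x)) +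
  (mu^-1 * cell_sq (xpT x) + mu^-1 * eta^-1 * trace_sq (xpT x)) +
  kappa^-1 * vcell_sq (xz x) +
  ((c0 * cell_sq (xp x) + alpha ^+ 2 * lambda^-1 * cell_sq (xp x)) +
   (kappa * grad_sq (xp x) + kappa * eta * qjump_sq (xp x))).
Proof.
rewrite -mulrDl [X in _ = _ + X]addrA; reflexivity.
Qed.

(* [Ct] and [1 + Ct] come from the trace inequality, [n.+1] from the divergence,
   2 and [2 * cl] from the difference of the pressures *)
Let C : R := Ct + n.+1%:R + 3 + 2 * cl.

Let C0 : 0 <= C.
Proof. by case: hCt => Ct0 _; rewrite /C !addr_ge0 // mulr_ge0 // ltW. Qed.

Let le_energy (c E b : R) : 0 <= b -> b <= E -> c <= C -> 0 <= c -> c * b <= C * E.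
Proof. by move=> b0 bE cC cc0; exact: ler_pM. Qed.

Lemma energy_bounds (x : hdg T) : Xh Omega k x ->
  let E := energy x in
  [/\ mu * strain_sq (xu x) <= C * E /\ Ct * (mu * strain_sq (xu x)) <= C * E,
      mu * eta * vjump_sq (xu x) <= C * E /\
      n.+1%:R * (mu * strain_sq (xu x)) + mu * eta * vjump_sq (xu x) <= C * E,
      mu^-1 * cell_sq (xpT x) + mu^-1 * eta^-1 * trace_sq (xpT x) <= C * E /\
      kappa * grad_sq (xp x) + kappa * eta * qjump_sq (xp x) <= C * E,
      kappa^-1 * vcell_sq (xz x) <= C * E /\
      (1 + Ct) * (kappa^-1 * vcell_sq (xz x)) <= C * E &
      c0 * cell_sq (xp x) <= C * E /\
      2 * (alpha ^+ 2 * lambda^-1 * cell_sq (xp x)) + 2 * (lambda^-1 * cell_sq (xpT x))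
        <= C * E].
Proof.
move=> [hu hpT hz [hp [hpb _]]]; rewrite energyE.
have hP : qspace k (xp x) by split.
have [a1 _ _] := strain_term hT (xu x) (xu x) mu0.
have [a2 _ _] := jump_term hT heta mu0 hu hu.
have [a3 _ _] := volumetric_term oO hT heta mu0 hu hpT.
have [a4 _ _] := darcy_term hT (xz x) (xz x) k0.
have [a5 _ _] := storage_term hT (xp x) (xp x) c00.
have [a6 _ _] := mass_flux_term hT heta hCt k0 hz hP.
have a7 : 0 <= alpha ^+ 2 * lambda^-1 * cell_sq (xp x).
  apply: mulr_ge0; last exact: (cell_sq_ge0 hT).
  by rewrite mulr_ge0 ?sqr_ge0 // invr_ge0 ltW.
have a8 : 0 <= mu^-1 * eta^-1 * trace_sq (xpT x).
  apply: mulr_ge0; first by rewrite mulr_ge0 // invr_ge0 ltW // (lt_trans _ heta).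
  apply: bnd_int_ge0 => K i s; rewrite -mulrA -expr2.
  by rewrite mulr_ge0 ?sqr_ge0 // ltW // (hsize_gt0 hT).
have a9 : 0 <= mu^-1 * cell_sq (xpT x).
  by apply: mulr_ge0; [rewrite invr_ge0 ltW|exact: (cell_sq_ge0 hT)].
have lT : lambda^-1 * cell_sq (xpT x) <= cl * (mu^-1 * cell_sq (xpT x)).
  by rewrite mulrA; apply: ler_wpM2r; [exact: (cell_sq_ge0 hT)|exact: ilam].
have [Ct0 _] := hCt.
have n0 : 1 <= n.+1%:R :> R by rewrite ler1n.
have cl0 := ltW hcl.
move: a1 a2 a3 a4 a5 a6 a7 a8 a9 lT.
set A1 := mu * strain_sq _; set A2 := mu * eta * _; set A3 := mu^-1 * cell_sq _.
set A4 := mu^-1 * eta^-1 * _; set A5 := kappa^-1 * _; set A6 := c0 * _.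
set A7 := alpha ^+ 2 * _ * _; set A8 := _ + kappa * eta * _; set LT := lambda^-1 * _.
move=> a1 a2 a3 a4 a5 a6 a7 a8 a9 lT.
set E := _ + _ + _ + _.
have E1 : A1 + A2 <= E by rewrite /E; lra.
have one b : 0 <= b -> b <= E -> b <= C * E.
  by move=> b0 bE; rewrite -[b]mul1r; apply: le_energy => //; rewrite /C; lra.
split; split.
- by apply: one => //; lra.
- by apply: le_energy => //; [lra|rewrite /C; lra].
- by apply: one => //; lra.
- apply: (@le_trans _ _ (n.+1%:R * (A1 + A2))).
    by rewrite mulrDr lerD2l ler_peMl.
  by apply: le_energy => //; [lra|rewrite /C; lra].
- by apply: one => //; rewrite /E; lra.
- by apply: one => //; rewrite /E; lra.
- by apply: one => //; rewrite /E; lra.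
- by apply: le_energy => //; rewrite /E /C; lra.
- by apply: one => //; rewrite /E; lra.
- apply: (@le_trans _ _ ((2 + 2 * cl) * (A7 + A3))).
    have : 0 <= cl * A7 by exact: mulr_ge0.
    rewrite mulrDr !mulrDl; lra.
  by apply: le_energy; rewrite /E /C; lra.
Qed.

(** The form has 11 terms, each bounded by [C] times the product of the norms. *)
Lemma a_h_bounded (x y : hdg T) : Xh Omega k x -> Xh Omega k y ->
  `|a_h eta mu lambda alpha kappa c0 x y| <=
    11 * C * norm_X eta mu lambda alpha kappa c0 x * norm_X eta mu lambda alpha kappa c0 y.
Proof.
move=> hx hy.
have [[x1 x2] [x3 x4] [x5 x6] [x7 x8] [x9 x10]] := energy_bounds hx.
have [[y1 y2] [y3 y4] [y5 y6] [y7 y8] [y9 y10]] := energy_bounds hy.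
case: (hx) => hux hpTx hzx [hpx [hpbx _]].
case: (hy) => huy hpTy hzy [hpy [hpby _]].
have hPx : qspace k (xp x) by split.
have hPy : qspace k (xp y) by split.
have bd t b c := @csbound_norm _ C t b c (energy x) (energy y) C0.
have bd' t b c := @csbound_norm _ C t b c (energy y) (energy x) C0.
have t1 := bd _ _ _ (strain_term hT (xu x) (xu y) mu0) x1 y1.
have t2 := bd _ _ _ (jump_term hT heta mu0 hux huy) x3 y3.
have t3 := bd _ _ _ (traction_term hT heta hCt mu0 hux huy) x2 y3.
have t4 := bd' _ _ _ (traction_term hT heta hCt mu0 huy hux) y2 x3.
have t5 := bd _ _ _ (volumetric_term oO hT heta mu0 huy hpTx) x5 y4.
have t6 := bd' _ _ _ (volumetric_term oO hT heta mu0 hux hpTy) y5 x4.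
have t7 := bd _ _ _ (darcy_term hT (xz x) (xz y) k0) x7 y7.
have t8 := bd _ _ _ (mass_flux_term hT heta hCt k0 hzy hPx) x6 y8.
have t9 := bd' _ _ _ (mass_flux_term hT heta hCt k0 hzx hPy) y6 x8.
have t10 := bd _ _ _ (storage_term hT (xp x) (xp y) c00) x9 y9.
have t11 := bd _ _ _ (exchange_term hT alpha (xp x) (xpT x) (xp y) (xpT y) lam0) x10 y10.
have nD (a b A B : R) : `|a| <= A -> `|b| <= B -> `|a + b| <= A + B.
  by move=> aA bB; apply: (le_trans (ler_normD _ _)); exact: lerD.
have nB (a b A B : R) : `|a| <= A -> `|b| <= B -> `|a - b| <= A + B.
  by move=> aA bB; apply: nD => //; rewrite normrN.
have d := nB _ _ _ _ (nB _ _ _ _ (nD _ _ _ _ t1 t2) t3) t4.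
have := nB _ _ _ _ (nB _ _ _ _ (nD _ _ _ _ (nD _ _ _ _ (nD _ _ _ _
  (nD _ _ _ _ (nD _ _ _ _ d t5) t6) t7) t8) t9) t10) t11.
move=> H; apply: (le_trans H); rewrite /norm_X.
move: (Num.sqrt (energy x)) (Num.sqrt (energy y)) => a b.
rewrite le_eqVlt; apply/orP; left; apply/eqP; move: C => c; ring.
Qed.

End Boundedness.

Theorem lemma1 (R : realType) (n k : nat)
    (hd : n.+1 = 2%N \/ n.+1 = 3%N) (hk : (1 <= k)%N)
    (Omega : set 'rV[R]_n.+1) (hOmega : polyhedral_domain Omega)
    (I : Type) (Th : I -> mesh R n)
    (hTh : forall i, conforming_triangulation Omega (Th i))
    (hreg : shape_regular Th)
    (eta : R) (heta : 1 < eta) (cl : R) (hcl : 0 < cl) :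
  exists2 cb : R, 0 < cb &
    forall (i : I) (mu lambda alpha kappa c0 : R),
      0 < mu -> cl^-1 * mu <= lambda -> 0 < alpha -> alpha <= 1 ->
      0 < kappa -> 0 <= c0 ->
      forall x y : hdg (Th i), Xh Omega k x -> Xh Omega k y ->
        `|a_h eta mu lambda alpha kappa c0 x y|
          <= cb * norm_X eta mu lambda alpha kappa c0 x
                * norm_X eta mu lambda alpha kappa c0 y.
Proof.
have nd i (K : cell (Th i)) : nondegenerate (vert (Th i) K).
  by case: (hTh i) => + _ _ _; exact.
case: hOmega => oO _ _ _ _.
have [Cr Cr0 reg] := shape_regular_bgrad nd hreg.
have [Ctr Ctr0 tr] := @trace_inequality R n k.
pose Ct := n.+2%:R * (Ctr * Cr).
have hCt i : trace_bound (Th i) k Ct by apply: trace_boundP.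
have Ct0 : 0 <= Ct by rewrite !mulr_ge0.
exists (11 * (Ct + n.+1%:R + 3 + 2 * cl)).
  by rewrite mulr_gt0 // -addrA ltr_wpDl ?addr_ge0 // addr_gt0 // mulr_gt0.
move=> i mu lambda alpha kappa c0 mu0 lam _ _ k0 c00 x y hx hy.
have H := (a_h_bounded oO (hTh i) heta (hCt i) alpha hcl mu0 lam k0 c00 hx hy).
exact: H.
Qed.
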